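(* Let $p$ be fixed, $\boldsymbol\beta^*\in\mathbb{R}^p$, and for each $n$ let $\mathbf{y}=(y_1,\dots,y_n)'$ and $\mathbf{X}$ the $n\times p$ matrix with rows $\mathbf{x}_i$, where (A1) $y_i=\mathbf{x}_i\boldsymbol\beta^*+\epsilon_i$ with $\epsilon_1,\dots,\epsilon_n$ i.i.d. with mean $0$ and variance $\sigma^2>0$; (A2) $\frac1n\mathbf{X}'\mathbf{X}\to\mathbf{C}$, with $\mathbf{C}$ a positive definite matrix. Let $\boldsymbol\beta^{(0)}_n$ be the least squares estimator, let $\alpha^{\dagger}_n>0$, $\eta^{\dagger}_n>0$, and define $$\boldsymbol\beta^{(1)}_n=\arg\min_{\boldsymbol\beta\in\mathbb{R}^p}\left\{(\mathbf{y}-\mathbf{X}\boldsymbol\beta)'(\mathbf{y}-\mathbf{X}\boldsymbol\beta)+\alpha^{\dagger}_n\sum_{j=1}^p\frac{|\beta_j|}{|\beta^{(0)}_{nj}|+\eta^{\dagger}_n}\right\}.$$ Let $\mathcal{A}=\{j:\beta^*_j\neq0\}$ and $\mathcal{A}_n=\{j:\beta^{(1)}_{nj}\neq0\}$. Suppose $\alpha^{\dagger}_n\to\infty$, $\alpha^{\dagger}_n/\sqrt n\to0$ and $\eta^{\dagger}_n\sqrt n\to c<\infty$. Then (1) $\lim_{n\to\infty}\mathbb{P}(\mathcal{A}_n=\mathcal{A})=1$; (2) $\sqrt n(\boldsymbol\beta^{(1)}_{n\mathcal{A}}-\boldsymbol\beta^*_{\mathcal{A}})\xrightarrow{d}\m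athrm{N}(\mathbf{0},\sigma^2\mathbf{C}_{\mathcal{A}}^{-1})$.
   Context: For a vector $\boldsymbol\beta$, $\boldsymbol\beta_{\mathcal{A}}$ is the subvector of entries indexed by $\mathcal{A}$; $\mathbf{C}_{\mathcal{A}}$ is the submatrix of $\mathbf{C}$ with rows and columns indexed by $\mathcal{A}$. $\boldsymbol\beta^{(1)}_n$ is the one-step (GDP(OS)) estimator, a weighted $\ell_1$-penalized least squares estimator with weights built from the initial estimate $\boldsymbol\beta^{(0)}_n$. *)

(* Defs.v *)
From HB Require Import structures.
From mathcomp Require Import all_boot all_order all_algebra.
From mathcomp Require Import all_classical all_reals all_analysis.
Set Implicit Arguments. Unset Strict Implicit. Unset Printing Implicit Defensive.
Import Order.TTheory GRing.Theory Num.Theory.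
Import numFieldNormedType.Exports.
Local Open Scope classical_set_scope.
Local Open Scope ring_scope.

Definition subcol (R : Type) (p : nat) (A : {set 'I_p}) (v : 'cV[R]_p)
  : 'cV[R]_#|A| := \col_(i < #|A|) v (enum_val i) 0.
Definition principal_submx (R : Type) (p : nat) (A : {set 'I_p}) (C : 'M[R]_p)
  : 'M[R]_#|A| := \matrix_(i < #|A|, j < #|A|) C (enum_val i) (enum_val j).

Definition posdef (R : numDomainType) (p : nat) (C : 'M[R]_p) : Prop :=
  C^T = C /\ forall u : 'rV[R]_p, u != 0 -> 0 < (u *m C *m u^T) 0 0.

Fixpoint iter_lebesgue_int (R : realType) (k : nat) : ('cV[R]_k -> R) -> R :=
  match k return ('cV[R]_k -> R) -> R with
  | 0 => fun g => g 0
  | k'.+1 => fun g =>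
      Rintegral (@lebesgue_measure R) setT
        (fun x : R => iter_lebesgue_int (fun v : 'cV[R]_k' => g (col_mx (const_mx x : 'cV[R]_1) v)))
  end.

Definition normal_density (R : realType) (k : nat) (S : 'M[R]_k) (x : 'cV[R]_k) : R :=
  expR (- ((x^T *m invmx S *m x) 0 0) / 2) / Num.sqrt ((2 * pi) ^+ k * \det S).

Definition cvg_in_dist_normal d (T : measurableType d) (R : realType)
  (P : probability T R) (k : nat) (Z : nat -> T -> 'cV[R]_k) (S : 'M[R]_k) : Prop :=
  forall f : 'cV[R]_k -> R, continuous f -> (exists M : R, forall x, `|f x| <= M) ->
    (fun n => fine ('E_P[fun w => f (Z n w)])%E) @ \oo -->
      iter_lebesgue_int (fun x => f x * normal_density S x).

Definition mutually_independent d (T : measurableType d) (R : realType)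
  (P : probability T R) (e : nat -> T -> R) : Prop :=
  forall (I : seq nat) (B : nat -> set R), uniq I -> (forall i, measurable (B i)) ->
    P (\bigcap_(i in [set` I]) (e i @^-1` B i)) = (\prod_(i <- I) P (e i @^-1` B i))%E.

Definition identically_distributed d (T : measurableType d) (R : realType)
  (P : probability T R) (e : nat -> T -> R) : Prop :=
  forall i (B : set R), measurable B -> P (e i @^-1` B) = P (e 0%N @^-1` B).

Definition design (R : Type) (p : nat) (x : nat -> 'rV[R]_p) (n : nat) : 'M[R]_(n, p) :=
  \matrix_(i < n, j < p) x i 0 j.
Definition response (R : pzRingType) (p : nat) (x : nat -> 'rV[R]_p) (bstar : 'cV[R]_p)
  (eps : nat -> R) (n : nat) : 'cV[R]_n :=
  \col_(i < n) ((x i *m bstar) 0 0 + eps i).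

Definition rss (R : pzRingType) (n p : nat) (X : 'M[R]_(n, p)) (y : 'cV[R]_n) (b : 'cV[R]_p) : R :=
  ((y - X *m b)^T *m (y - X *m b)) 0 0.
Definition gdp_os_obj (R : realFieldType) (n p : nat) (X : 'M[R]_(n, p)) (y : 'cV[R]_n)
  (b0 : 'cV[R]_p) (alpha eta : R) (b : 'cV[R]_p) : R :=
  rss X y b + alpha * \sum_(j < p) `|b j 0| / (`|b0 j 0| + eta).

(* Main.v *)
Require Import Defs.
From HB Require Import structures.
From mathcomp Require Import all_boot all_order all_algebra.
From mathcomp Require Import all_classical all_reals all_analysis.
From mathcomp Require Import measurable_realfun ring lra.
Set Implicit Arguments. Unset Strict Implicit. Unset Printing Implicit Defensive.
Import Order.TTheory GRing.Theory Num.Theory.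
Import numFieldNormedType.Exports.
Local Open Scope classical_set_scope.
Local Open Scope ring_scope.

(* Write W_n = X'eps / sqrt n.  In the rescaled variable u = sqrt n (beta - beta^* ) the penalized
   objective is u'(X'X/n)u - 2 W_n'u plus the penalty, and on the event |W_n| <= M everything is
   deterministic: least squares is within O(1/sqrt n) of beta^*, so the penalty weight of a
   coordinate outside A is at least of order alpha_n and the first-order conditions force that
   coordinate to vanish, while the weights on A are O(alpha_n / sqrt n) and the first-order
   conditions give sqrt n (beta^(1)_A - beta^*_A) = C_A^{-1} W_{n,A} + o(1).  By Chebyshev the event
   has probability close to 1 for M large, uniformly in n, which yields (1) and reduces (2) to a
   central limit theorem for linear combinations of W_n.

   The limit theorem is used in the form E cos(u + th'W_n) -> exp(-sigma^2 th'C th / 2) cos u,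
   obtained by peeling off one error at a time with a second-order Taylor bound.  Bernstein
   polynomials in (1 + sin (a x_j)) / 2 approximate a bounded continuous function, uniformly on a box
   and without increasing its bound, so tightness turns convergence of these cosine integrals into
   convergence in distribution; the Gaussian integrals are computed after a Cholesky substitution
   S = L L'. *)

(** * Bounded random variables *)

(** The limit law enters through [iter_lebesgue_int], an iterated one-dimensional integral against a
    density. This dictates the tools: a triangular factor L lets the substitution proceed one
    coordinate at a time, the first coordinate being outermost and shifting the mean of the others,
    so the induction on the dimension carries an arbitrary mean. Cosines with a free phase u replace
    complex exponentials: a sine is a cosine with the phase moved by pi / 2, so all integrals stay
    real and the family is closed under peeling off one error, one Gaussian coordinate or one factor
    of a product. The errors have only two moments, which forces remainder bounds that are cubic
    near 0 but quadratic everywhere, combined by truncation. The estimators enter the deterministic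
    part as arbitrary minimizers, and its threshold in n precedes the quantifiers over noise and
    minimizers, so that it applies at every sample point of the event. Since the absolute value is
    not differentiable at 0, its first-order conditions come from comparing values of the
    objective. *)

Section RintegralExtra.
Context d (T : measurableType d) (R : realType) (mu : {measure set T -> \bar R}).
Local Notation int f := (mu.-integrable setT (EFin \o f)).

Lemma Rintegral_dominated (f_ : nat -> T -> R) (f g : T -> R) :
  (forall n, measurable_fun setT (f_ n)) ->
  (forall x, f_ ^~ x @ \oo --> f x) ->
  int g -> (forall n x, `|f_ n x| <= g x) ->
  \int[mu]_x f_ n x @[n --> \oo] --> \int[mu]_x f x.
Proof.
move=> mf_ cf ig fg.
have mf : measurable_fun setT f.
  by apply: (measurable_fun_cvg mf_) => x _; exact: cf.
have fg' x : `|f x| <= g x.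
  apply: (cvgr_to_le (cvg_norm (cf x))); exact: nearW.
have intf : int f.
  apply: (le_integrable _ _ _ ig) => //; first exact/measurable_EFinP.
  move=> x _ /=; rewrite lee_fin (le_trans (fg' x))// ler_norm//.
apply: fine_cvg.
rewrite fineK; last exact: integrable_fin_num.
apply: (@dominated_cvg _ _ _ mu setT measurableT (fun n x => (f_ n x)%:E) _ (EFin \o g)) => //.
- by move=> n; apply/measurable_EFinP; exact: mf_.
- by move=> x _; apply: cvg_EFin; [exact: nearW|exact: cf].
- by move=> n x _; rewrite lee_fin.
Qed.

Lemma integrable_EFinD (f g : T -> R) : int f -> int g -> int (fun x => f x + g x).
Proof. by move=> fi gi; have := integrableD measurableT fi gi. Qed.

Lemma integrable_EFinZ (a : R) (f : T -> R) : int f -> int (fun x => a * f x).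
Proof. by move=> fi; have := integrableZl measurableT a fi. Qed.

Lemma integrable_EFin_sum (I : Type) (r : seq I) (f : I -> T -> R) :
  (forall i, int (f i)) -> int (fun x => \sum_(i <- r) f i x).
Proof.
move=> fi; elim: r => [|i r IH].
  under eq_fun do rewrite big_nil; exact: integrable0.
by under eq_fun do rewrite big_cons; exact: integrable_EFinD.
Qed.

Lemma Rintegral_sum (I : Type) (r : seq I) (f : I -> T -> R) :
  (forall i, int (f i)) ->
  \int[mu]_x (\sum_(i <- r) f i x) = \sum_(i <- r) \int[mu]_x f i x.
Proof.
move=> fi; elim: r => [|i r IH].
  by rewrite big_nil; under eq_Rintegral do rewrite big_nil; rewrite /Rintegral integral0.
rewrite big_cons; under eq_Rintegral do rewrite big_cons.
by rewrite RintegralD ?IH//; exact: integrable_EFin_sum.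
Qed.

End RintegralExtra.

Section BoundedMeasurable.
Context d (T : measurableType d) (R : realType).

Definition bounded_measurable (f : T -> R) : Prop :=
  measurable_fun setT f /\ exists M : R, forall x, `|f x| <= M.

Local Notation bm := bounded_measurable.

Lemma bm_cst (a : R) : bm (fun=> a).
Proof. by split; [exact: measurable_cst|exists `|a|]. Qed.

Lemma bmD f g : bm f -> bm g -> bm (fun x => f x + g x).
Proof.
move=> [mf [a fa]] [mg [b gb]]; split; first exact: measurable_funD.
by exists (a + b) => x; rewrite (le_trans (ler_normD _ _))// lerD.
Qed.

Lemma bmM f g : bm f -> bm g -> bm (fun x => f x * g x).
Proof.
move=> [mf [a fa]] [mg [b gb]]; split; first exact: measurable_funM.
by exists (a * b) => x; rewrite normrM ler_pM.
Qed.

Lemma bmZ (a : R) f : bm f -> bm (fun x => a * f x).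
Proof. by move=> bf; apply: bmM => //; exact: bm_cst. Qed.

Lemma bmN f : bm f -> bm (fun x => - f x).
Proof.
move=> bf; have := bmZ (-1) bf.
by under eq_fun do rewrite mulN1r.
Qed.

Lemma bm_sum (I : Type) (r : seq I) (f : I -> T -> R) :
  (forall i, bm (f i)) -> bm (fun x => \sum_(i <- r) f i x).
Proof.
move=> bf; elim: r => [|i r IH].
  by under eq_fun do rewrite big_nil; exact: bm_cst.
by under eq_fun do rewrite big_cons; exact: bmD.
Qed.

Lemma bm_indic (A : set T) : measurable A -> bm (\1_A : T -> R).
Proof.
move=> mA; split; first exact: measurable_indic.
by exists 1 => x; rewrite indicE; case: (x \in A); rewrite ?normr0 ?normr1.
Qed.

Lemma bm_cos (f : T -> R) : measurable_fun setT f -> bm (fun x => cos (f x)).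
Proof.
move=> mf; split.
  by apply: measurableT_comp => //; exact: (continuous_measurable_fun (@continuous_cos R)).
by exists 1 => x; rewrite ler_norml cos_geN1 cos_le1.
Qed.

Lemma bm_sin (f : T -> R) : measurable_fun setT f -> bm (fun x => sin (f x)).
Proof.
move=> mf; split.
  by apply: measurableT_comp => //; exact: (continuous_measurable_fun (@continuous_sin R)).
by exists 1 => x; rewrite ler_norml sin_geN1 sin_le1.
Qed.

Variable P : probability T R.
Local Notation E f := (\int[P]_x f x).

Lemma bm_integrable f : bm f -> P.-integrable setT (EFin \o f).
Proof.
move=> [mf [M fM]]; apply: measurable_bounded_integrable => //.
  exact: (le_lt_trans (probability_le1 P measurableT) (ltry _)).
exists M; split; first exact: num_real.
by move=> K MK x _; exact: le_trans (fM x) (ltW MK).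
Qed.

Lemma Rintegral_cst1 (a : R) : \int[P]_x a = a.
Proof.
transitivity (a * fine (P setT)); first exact: Rintegral_cst.
by rewrite probability_setT mulr1.
Qed.

Lemma le_E f g : bm f -> bm g -> (forall x, f x <= g x) -> E f <= E g.
Proof. by move=> bf bg fg; apply: le_Rintegral => //; exact: bm_integrable. Qed.

Lemma ED f g : bm f -> bm g -> \int[P]_x (f x + g x) = E f + E g.
Proof. by move=> bf bg; rewrite RintegralD//; exact: bm_integrable. Qed.

Lemma EB f g : bm f -> bm g -> \int[P]_x (f x - g x) = E f - E g.
Proof. by move=> bf bg; rewrite RintegralB//; exact: bm_integrable. Qed.

Lemma EZ a f : bm f -> \int[P]_x (a * f x) = a * E f.
Proof. by move=> bf; rewrite RintegralZl//; exact: bm_integrable. Qed.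

Lemma E_indic (A : set T) : measurable A -> \int[P]_x (\1_A x : R) = fine (P A).
Proof. by move=> mA; rewrite /Rintegral integral_indic// setIT. Qed.

Lemma normE_le f (M : R) : bm f -> (forall x, `|f x| <= M) -> `|E f| <= M.
Proof.
move=> bf fM; apply: le_trans (le_normr_Rintegral _ _) _ => //; first exact: bm_integrable.
rewrite -[leRHS]Rintegral_cst1; apply: le_Rintegral => //.
- apply: bm_integrable; split; last by exists M => x; rewrite normr_id.
  by apply: measurableT_comp => //; case: bf.
- by apply: bm_integrable; exact: bm_cst.
Qed.

End BoundedMeasurable.

(** * Central limit theorem for linear combinations *)

Section Taylor.
Variable R : realType.

(** Integrates a derivative bound from 0. The chain sin, cos - 1, sin - id, cos - 1 + id^2 / 2 is
    climbed with it one order at a time; the constants 1 are not optimal. *)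
Lemma mvt_bound (F F' : R -> R) (M y : R) :
  (forall x : R, is_derive x 1 F (F' x)) -> F 0 = 0 ->
  (forall c, `|c| <= `|y| -> `|F' c| <= M) -> `|F y| <= M * `|y|.
Proof.
move=> dF F0 F'M.
have cF x : {for x, continuous F}.
  by apply: differentiable_continuous; apply/derivable1_diffP; case: (dF x).
have cw a b : {within `[a, b], continuous F}.
  by apply: continuous_subspaceT => x; exact: cF.
have [y0|y0] := leP 0 y.
  have [c] := MVT_segment y0 (fun x _ => dF x) (cw _ _).
  rewrite in_itv/= F0 !subr0 => /andP[c0 cy] ->.
  by rewrite normrM ler_wpM2r// F'M// !ger0_norm.
have [c] := MVT_segment (ltW y0) (fun x _ => dF x) (cw _ _).
rewrite in_itv/= F0 !sub0r => /andP[cy c0] Fy.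
rewrite -normrN Fy normrM normrN ler_wpM2r// F'M// !ler0_norm ?lerN2//.
exact: ltW.
Qed.

Lemma sin_le_norm (y : R) : `|sin y| <= `|y|.
Proof.
rewrite -[leRHS]mul1r; apply: (@mvt_bound _ cos).
- exact: sin0.
- by move=> c _; rewrite ler_norml cos_geN1 cos_le1.
Qed.

Lemma cosB1_le (y : R) : `|cos y - 1| <= y ^+ 2.
Proof.
rewrite -real_normK ?num_real// expr2.
apply: (@mvt_bound (fun x => cos x - 1) (fun x => - sin x)).
- move=> x; rewrite -[- sin x]subr0.
  exact: is_deriveB.
- by rewrite cos0 subrr.
- by move=> c cy; rewrite normrN (le_trans (sin_le_norm c)).
Qed.

Lemma sinB_le (y : R) : `|sin y - y| <= `|y| ^+ 3.
Proof.
rewrite exprSr; apply: (@mvt_bound (fun x => sin x - x) (fun x => cos x - 1)).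
- by rewrite sin0 subrr.
- move=> c cy; rewrite (le_trans (cosB1_le c))// -real_normK ?num_real//.
  by rewrite lerXn2r// nnegrE.
Qed.

(** A global quadratic bound is integrable with two moments, unlike the cubic one. For |y| > 1 it
    follows from |y| <= y^2. *)
Lemma sinB_le_sqr (y : R) : `|sin y - y| <= 2 * y ^+ 2.
Proof.
have [y1|y1] := leP `|y| 1.
  rewrite (le_trans (sinB_le y))// exprS real_normK ?num_real//.
  by rewrite ler_wpM2r ?sqr_ge0//; lra.
rewrite (le_trans (ler_normB _ _))// (@le_trans _ _ (`|y| + `|y|)) ?lerD ?sin_le_norm//.
by rewrite -[y ^+ 2]real_normK ?num_real//; nra.
Qed.

Lemma cos_taylor_le (y : R) : `|cos y - 1 + y ^+ 2 / 2| <= `|y| ^+ 4.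
Proof.
have D (x : R) : is_derive x 1 (fun x : R => cos x - 1 + x ^+ 2 / 2) (x - sin x).
  apply: is_derive_eq; rewrite /GRing.scale/=.
  by field.
rewrite [leRHS]exprSr; apply: (mvt_bound D).
- by rewrite cos0 expr0n/= mul0r addr0 subrr.
- move=> c cy; rewrite distrC (le_trans (sinB_le c))//.
  by rewrite lerXn2r// nnegrE.
Qed.

Lemma cos_taylor_le_sqr (y : R) : `|cos y - 1 + y ^+ 2 / 2| <= 2 * y ^+ 2.
Proof.
rewrite (le_trans (ler_normD _ _))//.
have := cosB1_le y; rewrite (@ger0_norm _ (y ^+ 2 / 2)) ?divr_ge0 ?sqr_ge0//.
have := sqr_ge0 y; lra.
Qed.

(** Squeezes exp(-s) between 1 - s and 1 / (1 + s), the latter being at most 1 - s + s^2. *)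
Lemma expRN_taylor_le (s : R) : 0 <= s -> `|expR (- s) - 1 + s| <= s ^+ 2.
Proof.
move=> s0; have h1 := expR_ge1Dx (- s).
rewrite ger0_norm; last by lra.
have := expR_ge1Dx s => h2.
have : expR (- s) <= (1 + s)^-1 by rewrite expRN lef_pV2// ?posrE ?expR_gt0//; lra.
suff : (1 + s)^-1 <= 1 - s + s ^+ 2 by lra.
rewrite -div1r ler_pdivrMr; last by lra.
have := exprn_ge0 3 s0; nra.
Qed.

End Taylor.

(** * Cesaro means of squared weights *)

Section Averages.
Variables (R : realType) (s : nat -> R) (q : R).
Hypothesis avg : (fun n : nat => (\sum_(i < n) s i ^+ 2) / n%:R) @ \oo --> q.

(** With Q_n the mean of the first n squares, the sequence equals Q_{n+1} - Q_n n / (n+1), a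
    difference of two sequences with the same limit q. *)
Lemma avg_last_small : (fun n : nat => s n ^+ 2 / n.+1%:R) @ \oo --> (0 : R).
Proof.
pose Q (n : nat) : R := (\sum_(i < n) s i ^+ 2) / n%:R.
have -> : (fun n : nat => s n ^+ 2 / n.+1%:R) = (fun n => Q n.+1 - Q n * (1 - n.+1%:R^-1)).
  apply/funext => n; rewrite /Q big_ord_recr/=.
  case: n => [|n]; first by rewrite !big_ord0 add0r mul0r mul0r subr0.
  have n1 : n.+1%:R != 0 :> R by rewrite pnatr_eq0.
  have n2 : n.+2%:R != 0 :> R by rewrite pnatr_eq0.
  set S := \sum_(i < n.+1) _.
  have -> : 1 - n.+2%:R^-1 = n.+1%:R / n.+2%:R :> R.
    by rewrite -{1}(divff n2) -[X in _ - X]mul1r -mulrBl -{1}natr1 addrK.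
  by rewrite mulf_div [_ * n.+1%:R]mulrC -mulf_div divff// mul1r -mulrBl addrAC subrr add0r.
have cQ : Q n @[n --> \oo] --> q by [].
have cQ1 : Q n.+1 @[n --> \oo] --> q by rewrite (cvg_shiftS Q).
have -> : 0 = q - q * (1 - 0) by rewrite subr0 mulr1 subrr.
apply: cvgB => //; apply: cvgM => //; apply: cvgB; first exact: cvg_cst.
exact: cvg_harmonic.
Qed.

(* Lindeberg's negligibility condition for the weights s_i / sqrt n. *)
Lemma avg_max_small (eta : R) : 0 < eta ->
  \forall n \near \oo, forall i, (i < n)%N -> s i ^+ 2 <= eta * n%:R.
Proof.
move=> e0; have /cvgr_le /(_ _ e0) [N _ HN] := avg_last_small.
near=> n; move=> i ni; have [iN|Ni] := ltnP i N; last first.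
  have := HN i Ni; rewrite /= ler_pdivrMr ?ltr0n// => h.
  by rewrite (le_trans h)// ler_wpM2l ?ler_nat// ltW.
(* The finitely many indices below N share one fixed bound, which eta * n eventually exceeds. *)
apply: (@le_trans _ _ (\sum_(j < N) s j ^+ 2)).
  by rewrite (bigD1 (Ordinal iN))//= lerDl sumr_ge0// => j _; exact: sqr_ge0.
rewrite mulrC -ler_pdivrMr//; near: n; exact: nbhs_infty_ger.
Unshelve. all: by end_near. Qed.

End Averages.

(** * Independent errors: factorization, moments, and the cosine limit *)

Section Independence.
Context d (T : measurableType d) (R : realType) (P : probability T R).
Local Notation E f := (\int[P]_x f x).
Local Notation bm := bounded_measurable.

Lemma sum_nat_ltn (m N : nat) : (m <= N)%N ->
  (\sum_(k < N) ((k < m)%N : nat) = m)%N.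
Proof.
elim: N m => [|N IH] m; first by rewrite leqn0 => /eqP ->; rewrite big_ord0.
case: m => [_|m mN]; first by rewrite big1.
by rewrite big_ord_recl/= IH.
Qed.

(* Layer-cake discretisation: a number in [0,1] is, up to 1/N, the average of its indicators over the N levels k/N. *)
Lemma superlevel_average (a : R) (N : nat) : (0 < N)%N -> 0 <= a <= 1 ->
  `|a - N%:R^-1 * \sum_(k < N) (k.+1%:R <= N%:R * a)%R%:R| <= N%:R^-1.
Proof.
move=> N0 /andP[a0 a1].
have Np : (0 : R) < N%:R by rewrite ltr0n.
have Na0 : 0 <= N%:R * a by rewrite mulr_ge0 ?ler0n.
rewrite -natr_sum (eq_bigr (fun k : 'I_N => ((k < Num.trunc (N%:R * a))%N : nat))); last first.
  by move=> k _; rewrite truncn_gt_nat.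
rewrite sum_nat_ltn; last first.
  rewrite -[leqRHS](@natrK R); apply: le_truncn.
  by rewrite ler_piMr// ltW.
have /andP[t1 t2] := truncn_itv Na0.
rewrite -[X in X - _](mulKf (lt0r_neq0 Np)) -mulrBr normrM.
have NV : 0 <= N%:R^-1 :> R by rewrite invr_ge0 ler0n.
rewrite (ger0_norm NV) ler_piMr//.
rewrite ger0_norm; last by rewrite subr_ge0.
by rewrite lerBlDl natr1 ltW.
Qed.

(* E[X h(Y)] = E X E h(Y) passes from indicators h to bounded measurable h. *)
Lemma E_mul_indic_ext (X : T -> R) (Y : T -> R) :
  bm X -> measurable_fun setT Y ->
  (forall B : set R, measurable B ->
     \int[P]_w (X w * \1_B (Y w)) = E X * \int[P]_w (\1_B (Y w))) ->
  forall h : R -> R, bm h ->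
    \int[P]_w (X w * h (Y w)) = E X * \int[P]_w h (Y w).
Proof.
move=> bX mY XB.
have bY (g : R -> R) : bm g -> bm (fun w => g (Y w)).
  by move=> [mg [M gM]]; split; [exact: measurableT_comp|exists M].
have [mX [K XK]] := bX.
(* No point of [T] is at hand, so the sign of K is read off its integral under the probability. *)
have K0 : 0 <= K.
  rewrite -(Rintegral_cst1 P K); apply: Rintegral_ge0 => w _.
  exact: le_trans (XK w).
have unit (h : R -> R) : bm h -> (forall x, 0 <= h x <= 1) ->
    \int[P]_w (X w * h (Y w)) = E X * \int[P]_w h (Y w).
  move=> bh h01; apply/eqP; rewrite -subr_eq0 -normr_eq0; apply/eqP/le_anti.
  rewrite normr_ge0 andbT; apply/ler_addgt0Pl => e e0; rewrite addr0.
  (* Two errors of size K / N arise below; this N makes their sum at most e. *)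
  pose N := (Num.trunc (2 * K / e)).+1.
  have N0 : (0 < N)%N by [].
  pose B k : set R := [set x | k.+1%:R <= N%:R * h x].
  have mB k : measurable (B k).
    rewrite -[B k]setTI; apply: measurable_fun_ler => //.
    by apply: measurable_funM => //; case: bh.
  pose g x : R := N%:R^-1 * \sum_(k < N) \1_(B k) x.
  have bI k : bm (\1_(B k) : R -> R) by exact: bm_indic.
  have bIY k := bY _ (bI k).
  have bg : bm g by apply/bmZ/bm_sum => k; exact: bI.
  have gE : \int[P]_w (X w * g (Y w)) = E X * \int[P]_w g (Y w).
    have bXk k : bm (fun w => X w * \1_(B k) (Y w)).
      by exact: bmM.
    under eq_Rintegral do rewrite /g mulrCA mulr_sumr.
    rewrite EZ; last by apply: bm_sum => k.
    rewrite Rintegral_sum; last by move=> k; apply: bm_integrable.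
    rewrite [X in _ = _ * X]EZ; last exact: bm_sum.
    rewrite Rintegral_sum; last by move=> k; exact: bm_integrable.
    by rewrite [in RHS]mulrCA [in RHS]mulr_sumr; congr (_ * _); apply: eq_bigr => k _; exact: XB.
  have hg x : `|h x - g x| <= N%:R^-1.
    have := superlevel_average N0 (h01 x); rewrite /g.
    by under [in X in _ -> X]eq_bigr do rewrite indicE mem_setE.
  (* The defect of the product rule is linear in h and vanishes at g, so only h - g contributes. *)
  have -> : \int[P]_w (X w * h (Y w)) - E X * \int[P]_w h (Y w) =
      \int[P]_w (X w * (h (Y w) - g (Y w))) - E X * \int[P]_w (h (Y w) - g (Y w)).
    rewrite EB; [|exact: bY|exact: bY].
    under [in RHS]eq_Rintegral do rewrite mulrBr.
    rewrite EB; [|by apply: bmM => //; exact: bY|by apply: bmM => //; exact: bY].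
    by rewrite gE; ring.
  have bhg : bm (fun w => h (Y w) - g (Y w)).
    by apply: bmD; [exact: bY|apply: bmN; exact: bY].
  have NV : 0 <= N%:R^-1 :> R by rewrite invr_ge0.
  apply: (@le_trans _ _ (K * N%:R^-1 + K * N%:R^-1)).
    apply: (le_trans (ler_normB _ _)); apply: lerD.
      by apply: normE_le; [exact: bmM|move=> w; rewrite normrM ler_pM].
    by rewrite normrM ler_pM//; apply: normE_le.
  have := truncnS_gt (2 * K / e); rewrite -/N ltr_pdivrMr// => KN.
  by rewrite -mulrDl ler_pdivrMr ?ltr0n//; lra.
move=> h bh; have [mh [M hM]] := bh.
(* A general h is mapped affinely into [0,1]; adding 1 keeps the scale positive when M = 0. *)
pose M' := M + 1.
have M0 : 0 < M' by rewrite ltr_pwDr// (le_trans _ (hM 0)).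
pose g x := (2 * M')^-1 * (h x + M').
have bg : bm g by apply/bmZ/bmD => //; exact: bm_cst.
have hE x : h x = 2 * M' * g x - M'.
  by rewrite /g mulVKf ?addrK// mulf_neq0// gt_eqF.
have := unit g bg.
have g01 x : 0 <= g x <= 1.
  have := hM x; rewrite ler_norml => /andP[h1 h2].
  have M20 : 0 < 2 * M' by rewrite mulr_gt0.
  rewrite /g; apply/andP; split; last by rewrite ler_pdivrMl// mulr1 /M'; lra.
  by rewrite mulr_ge0 ?invr_ge0 ?(ltW M20)// /M'; lra.
move=> /(_ g01) gE.
have -> : (fun w => X w * h (Y w)) = (fun w => 2 * M' * (X w * g (Y w)) - M' * X w).
  by apply/funext => w; rewrite hE; ring.
rewrite EB; [|by apply: bmZ; apply: bmM => //; exact: bY|exact: bmZ].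
rewrite EZ; last by apply: bmM => //; exact: bY.
rewrite EZ// gE.
have -> : (fun w => h (Y w)) = (fun w => 2 * M' * g (Y w) - M').
  by apply/funext => w; rewrite hE.
rewrite EB; [|by apply: bmZ; exact: bY|exact: bm_cst].
rewrite EZ; last exact: bY.
by rewrite Rintegral_cst1; ring.
Qed.

Variable e : nat -> T -> R.
Hypothesis me : forall i, measurable_fun setT (e i).
Hypothesis indep : mutually_independent P e.
Hypothesis same : identically_distributed P e.

Definition cylinder (I : seq nat) (B : nat -> set R) : set T :=
  \bigcap_(i in [set` I]) (e i @^-1` B i).

Lemma measurable_cylinder I B : (forall i, measurable (B i)) -> measurable (cylinder I B).
Proof.
move=> mB; apply: bigcap_measurableType => i _.
by rewrite -[_ @^-1` _]setTI; exact: me.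
Qed.

Lemma cylinder_cons i I B : cylinder (i :: I) B = (e i @^-1` B i) `&` cylinder I B.
Proof.
apply/seteqP; split=> w /=.
  move=> H; split; first by apply: H; rewrite /= inE eqxx.
  by move=> j /= jI; apply: H; rewrite /= inE jI orbT.
by move=> [H1 H2] j /=; rewrite inE => /orP[/eqP ->//|jI]; exact: H2.
Qed.

Lemma P_cylinder_cons i I B : i \notin I -> uniq I -> (forall i, measurable (B i)) ->
  fine (P (cylinder (i :: I) B)) = fine (P (e i @^-1` B i)) * fine (P (cylinder I B)).
Proof.
move=> iI uI mB; rewrite /cylinder !indep//= ?iI ?uI// big_cons fineM//.
  apply: fin_num_measure; rewrite -[_ @^-1` _]setTI; exact: me.
rewrite -indep//; apply: fin_num_measure; exact: measurable_cylinder.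
Qed.

(* X behaves like a function of e_0, ..., e_{m-1}: it is uncorrelated with every event depending on later e_i. *)
Definition past (m : nat) (X : T -> R) : Prop :=
  bm X /\ forall I B, uniq I -> {in I, forall i, (m <= i)%N} ->
    (forall i, measurable (B i)) ->
    \int[P]_w (X w * \1_(cylinder I B) w) = E X * fine (P (cylinder I B)).

Lemma past_le m n X : (m <= n)%N -> past m X -> past n X.
Proof.
move=> mn [bX H]; split=> // I B uI nI mB; apply: H => // i /nI.
exact: leq_trans.
Qed.

Lemma past_cst (a : R) : past 0 (fun=> a).
Proof.
split; first exact: bm_cst.
move=> I B uI _ mB; have mc := measurable_cylinder I mB.
by rewrite EZ ?E_indic ?Rintegral_cst1//; exact: bm_indic.
Qed.

Lemma pastB m X Y : past m X -> past m Y -> past m (fun w => X w - Y w).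
Proof.
move=> [bX HX] [bY HY]; split; first by apply: bmD => //; exact: bmN.
move=> I B uI mI mB; have mc := bm_indic R (measurable_cylinder I mB).
under eq_Rintegral do rewrite mulrBl.
rewrite [LHS]EB; [|exact: bmM|exact: bmM].
by rewrite HX// HY// [in RHS]EB// mulrBl.
Qed.

Lemma bm_comp_e i (h : R -> R) : bm h -> bm (fun w => h (e i w)).
Proof. by move=> [mh [M hM]]; split; [exact: measurableT_comp|exists M]. Qed.

Lemma past_mul m X h : past m X -> bm h ->
  \int[P]_w (X w * h (e m w)) = E X * \int[P]_w h (e m w).
Proof.
move=> [bX HX] bh; apply: E_mul_indic_ext => // B mB.
have eB w : \1_B (e m w) = \1_(cylinder [:: m] (fun=> B)) w :> R.
  rewrite !indicE; congr (_%:R); congr nat_of_bool.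
  rewrite cylinder_cons /cylinder set_nil bigcap_set0 setIT.
  by apply/idP/idP; rewrite !inE.
have mc : measurable (cylinder [:: m] (fun=> B)) by exact: measurable_cylinder.
have -> : \int[P]_w (\1_B (e m w) : R) = fine (P (cylinder [:: m] (fun=> B))).
  by rewrite -E_indic//; apply: eq_Rintegral => w _; exact: eB.
under eq_Rintegral do rewrite eB.
by rewrite HX// => i; rewrite inE => /eqP ->.
Qed.

(** Here independence moves forward by one index. The product rule is applied with X times a later
    cylinder indicator as first factor; for an indicator h, the event on e_m and the later cylinder
    merge into one cylinder over [m :: I]. *)
Lemma pastM m X h : past m X -> bm h -> past m.+1 (fun w => X w * h (e m w)).
Proof.
move=> pX bh; have [bX HX] := pX; split; first by apply: bmM => //; exact: bm_comp_e.
move=> I B uI mI mB; have mc := measurable_cylinder I mB.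
have bI := bm_indic R mc.
have bXI : bm (fun w => X w * \1_(cylinder I B) w) by exact: bmM.
rewrite (past_mul pX bh).
under eq_Rintegral do rewrite mulrAC.
have mI0 : {in I, forall i, (m <= i)%N} by move=> i /mI /ltnW.
have mI' : m \notin I by apply/negP => /mI; rewrite ltnn.
rewrite E_mul_indic_ext//.
  by rewrite (HX I B uI mI0 mB) mulrAC.
(* Since m does not occur in I, changing the family at m leaves the cylinder over I unchanged. *)
move=> C mC; pose B' i := if i == m then C else B i.
have mB' i : measurable (B' i) by rewrite /B'; case: ifP.
have cI : cylinder I B' = cylinder I B.
  apply: eq_bigcapr => i /= iI; rewrite /B'; case: eqP => // im.
  by move: mI'; rewrite -im iI.
have mmI : {in m :: I, forall i, (m <= i)%N}.
  by move=> i; rewrite inE => /orP[/eqP ->//|/mI0].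
transitivity (\int[P]_w (X w * \1_(cylinder (m :: I) B') w)).
  apply: eq_Rintegral => w _; rewrite -mulrA; congr (_ * _).
  by rewrite cylinder_cons indicI cI /B' eqxx mulrC.
rewrite HX//=; last by rewrite mI'.
rewrite P_cylinder_cons// cI /B' eqxx.
rewrite (HX I B uI mI0 mB).
have -> : \int[P]_w (\1_C (e m w) : R) = fine (P (e m @^-1` C)).
  by rewrite -E_indic//; rewrite -[_ @^-1` _]setTI; exact: me.
by rewrite mulrCA mulrC.
Qed.

(** Both sides are integrals of h against the law of an error, and these laws agree on measurable
    sets. *)
Lemma ge0_integral_same i (h : R -> \bar R) : measurable_fun setT h ->
  (forall x, 0 <= h x)%E ->
  (\int[P]_w h (e i w) = \int[P]_w h (e 0%N w))%E.
Proof.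
move=> mh h0.
pose X j : {mfun T >-> R} := HB.pack (e j) (isMeasurableFun.Build _ _ _ _ (e j) (me j)).
rewrite -[LHS](ge0_integral_distribution (P := P) (X i))// -[RHS](ge0_integral_distribution (P := P) (X 0%N))//.
by apply: eq_measure_integral => A mA _; exact: same.
Qed.

Lemma integrable_same i (h : R -> R) : measurable_fun setT h ->
  P.-integrable setT (EFin \o (h \o e 0%N)) -> P.-integrable setT (EFin \o (h \o e i)).
Proof.
move=> mh /integrableP[_ ih]; apply/integrableP; split.
  by apply/measurable_EFinP; exact: measurableT_comp.
rewrite (@ge0_integral_same i (fun x => `|(h x)%:E|%E))//.
by apply: measurableT_comp => //; exact/measurable_EFinP.
Qed.

Lemma Rintegral_same i (h : R -> R) : measurable_fun setT h ->
  P.-integrable setT (EFin \o (h \o e 0%N)) ->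
  \int[P]_w h (e i w) = \int[P]_w h (e 0%N w).
Proof.
move=> mh ih; have ihi := integrable_same i mh ih.
pose X j : {mfun T >-> R} := HB.pack (e j) (isMeasurableFun.Build _ _ _ _ (e j) (me j)).
congr fine.
have mEh : measurable_fun setT (EFin \o h) by exact/measurable_EFinP.
rewrite -[LHS](@integral_distribution _ _ _ _ _ P (X i) (EFin \o h))//.
rewrite -[RHS](@integral_distribution _ _ _ _ _ P (X 0%N) (EFin \o h))//.
by apply: eq_measure_integral => A mA _; exact: same.
Qed.

Variable sigma : R.
Hypothesis integrable_sqr : P.-integrable setT (EFin \o (fun w => e 0%N w ^+ 2)).
Hypothesis mean0 : \int[P]_w e 0%N w = 0.
Hypothesis var0 : \int[P]_w (e 0%N w ^+ 2) = sigma ^+ 2.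

Lemma integrable_sqr_dom (f : T -> R) (K : R) : measurable_fun setT f ->
  (forall w, `|f w| <= K + K * e 0%N w ^+ 2) -> P.-integrable setT (EFin \o f).
Proof.
move=> mf fK.
apply: (@le_integrable _ _ _ P setT measurableT _ (EFin \o (fun w => K + K * e 0%N w ^+ 2))).
- exact/measurable_EFinP.
- by move=> w _; rewrite /= lee_fin (le_trans (fK w))// ler_norm.
- apply: integrable_EFinD; last exact: integrable_EFinZ.
  exact/bm_integrable/bm_cst.
Qed.

Lemma integrable_e0 : P.-integrable setT (EFin \o e 0%N).
Proof. by apply: (@integrable_sqr_dom _ 1) => // w; rewrite mul1r ler_norml; nra. Qed.

Lemma integrable_e i : P.-integrable setT (EFin \o e i).
Proof. by apply: (@integrable_same i id) => //; exact: integrable_e0. Qed.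

Lemma mean_e i : \int[P]_w e i w = 0.
Proof. by rewrite (@Rintegral_same i id)//; exact: integrable_e0. Qed.

Lemma integrable_e2 i : P.-integrable setT (EFin \o (fun w => e i w ^+ 2)).
Proof. by apply: (@integrable_same i (fun x => x ^+ 2)) => //; exact: measurable_funX. Qed.

Lemma var_e i : \int[P]_w (e i w ^+ 2) = sigma ^+ 2.
Proof. by rewrite (@Rintegral_same i (fun x => x ^+ 2))//; exact: measurable_funX. Qed.

(** Truncation that makes the errors bounded, as the product rule [past_mul] requires. At level 1/2
    it later confines the argument of asin. *)
Definition clamp (K x : R) : R := Num.max (- K) (Num.min x K).

Lemma measurable_clamp K : measurable_fun setT (clamp K).
Proof.
by apply: measurable_maxr => //; apply: measurable_minr.
Qed.

Lemma clamp_le (K x : R) : 0 <= K -> `|clamp K x| <= K.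
Proof.
by move=> K0; rewrite ler_norml /clamp le_max lexx/= ge_max ge_min lexx orbT andbT; lra.
Qed.

Lemma clamp_le_norm (K x : R) : 0 <= K -> `|clamp K x| <= `|x|.
Proof.
rewrite /clamp => K0; case: (leP x K) => xK.
  case: (leP (- K) x) => h; rewrite ?lexx// normrN ger0_norm// ler0_norm; lra.
case: (leP (- K) K) => h; first by rewrite ger0_norm// ger0_norm; lra.
by lra.
Qed.

Lemma cvg_clamp x : (fun n : nat => clamp n%:R x) @ \oo --> x.
Proof.
apply: cvg_near_cst; near=> n.
have xn : `|x| <= n%:R by near: n; exact: nbhs_infty_ger.
move: xn; rewrite ler_norml /clamp => /andP[x1 x2].
by rewrite (min_idPl x2) (max_idPr x1).
Unshelve. all: by end_near. Qed.

Lemma integrable_ee i j : P.-integrable setT (EFin \o (fun w => e i w * e j w)).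
Proof.
apply: (@le_integrable _ _ _ P setT measurableT _ (EFin \o (fun w => e i w ^+ 2 + e j w ^+ 2))).
- by apply/measurable_EFinP; exact: measurable_funM.
- move=> w _; rewrite /= lee_fin [leRHS]ger0_norm ?addr_ge0 ?sqr_ge0//.
  by rewrite ler_norml; nra.
- by apply: integrable_EFinD; exact: integrable_e2.
Qed.

Lemma bm_clamp (n : nat) : bm (clamp n%:R).
Proof.
by split; [exact: measurable_clamp|exists n%:R => x; exact: clamp_le].
Qed.

Lemma cvg_E_clamp i : (fun n : nat => \int[P]_w clamp n%:R (e i w)) @ \oo --> (0 : R).
Proof.
rewrite -(mean_e i); apply: (@Rintegral_dominated _ _ _ _ _ _ (fun w => `|e i w|)).
- by move=> n; exact: measurableT_comp (measurable_clamp _) (me i).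
- by move=> w; exact: cvg_clamp.
- by have := integrable_norm (integrable_e i).
- by move=> n w; exact: clamp_le_norm.
Qed.

(** The product rule covers bounded functions, so both errors are truncated at level n. Dominated
    convergence then identifies the limit of the product of means, 0, with the mean of the
    product. *)
Lemma E_ee i j : (i < j)%N -> \int[P]_w (e i w * e j w) = 0.
Proof.
move=> ij.
have Hc (n : nat) : \int[P]_w (clamp n%:R (e i w) * clamp n%:R (e j w)) =
    \int[P]_w clamp n%:R (e i w) * \int[P]_w clamp n%:R (e j w).
  have bc := bm_clamp n.
  have := pastM (past_le (leq0n i) (past_cst 1)) bc.
  under eq_fun do rewrite mul1r.
  by move=> /(past_le ij) /past_mul; exact.
have l1 : (fun n : nat => \int[P]_w (clamp n%:R (e i w) * clamp n%:R (e j w))) @ \oo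
    --> \int[P]_w (e i w * e j w).
  apply: (@Rintegral_dominated _ _ _ _ _ _ (fun w => `|e i w * e j w|)).
  - by move=> n; apply: measurable_funM; exact: measurableT_comp (measurable_clamp _) (me _).
  - by move=> w; apply: cvgM; exact: cvg_clamp.
  - by have := integrable_norm (integrable_ee i j).
  - by move=> n w; rewrite !normrM ler_pM//; exact: clamp_le_norm.
have l2 : (fun n : nat => \int[P]_w (clamp n%:R (e i w) * clamp n%:R (e j w))) @ \oo --> (0 : R).
  under eq_fun do rewrite Hc.
  by rewrite -[0](mulr0 0); apply: cvgM; exact: cvg_E_clamp.
exact: (cvg_unique _ l1 l2).
Qed.

Definition linsum (t : nat -> R) (n : nat) (w : T) : R := \sum_(i < n) t i * e i w.

Lemma measurable_linsum t n : measurable_fun setT (linsum t n).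
Proof.
by apply: measurable_sum => i; exact: measurable_funM.
Qed.

Lemma linsumS t n w : linsum t n.+1 w = linsum t n w + t n * e n w.
Proof. by rewrite /linsum big_ord_recr. Qed.

Lemma linsum_sqr t n : P.-integrable setT (EFin \o (fun w => linsum t n w ^+ 2)) /\
  \int[P]_w (linsum t n w ^+ 2) = sigma ^+ 2 * \sum_(i < n) t i ^+ 2.
Proof.
have iee : forall i j, P.-integrable setT (EFin \o (fun w => t i * t j * (e i w * e j w))).
  by move=> i j; apply: integrable_EFinZ; exact: integrable_ee.
have -> : (fun w => linsum t n w ^+ 2) =
    (fun w => \sum_(i < n) \sum_(j < n) t i * t j * (e i w * e j w)).
  apply/funext => w; rewrite expr2 /linsum mulr_suml; apply: eq_bigr => i _.
  by rewrite mulr_sumr; apply: eq_bigr => j _; ring.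
split; first by apply: integrable_EFin_sum => i; exact: integrable_EFin_sum.
rewrite Rintegral_sum; last by move=> i; exact: integrable_EFin_sum.
rewrite mulr_sumr; apply: eq_bigr => i _.
rewrite Rintegral_sum// (bigD1 i)//= big1 ?addr0.
  rewrite RintegralZl//; last exact: integrable_ee.
  under eq_Rintegral do rewrite -expr2.
  by rewrite var_e; ring.
move=> j ji; rewrite RintegralZl//; last exact: integrable_ee.
have : (i : nat) != j by rewrite eq_sym.
rewrite neq_ltn => /orP[ij|ij]; first by rewrite E_ee// mulr0.
by under eq_Rintegral do rewrite mulrC; rewrite E_ee// mulr0.
Qed.

Lemma linsum_chebyshev t n (M : R) : 0 < M ->
  fine (P [set w | M < `|linsum t n w|]) <= sigma ^+ 2 * (\sum_(i < n) t i ^+ 2) / M ^+ 2.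
Proof.
move=> M0; have [iS ES] := linsum_sqr t n.
set A := [set w | _].
have mA : measurable A.
  rewrite -[A]setTI; apply: measurable_fun_ltr => //.
  by apply: measurableT_comp => //; exact: measurable_linsum.
rewrite ler_pdivlMr ?exprn_gt0// -ES mulrC -(E_indic P mA).
rewrite -EZ; last exact: bm_indic.
apply: le_Rintegral => //; first by apply/bm_integrable/bmZ/bm_indic.
move=> w _; rewrite indicE; case: (boolP (w \in A)) => wA; last by rewrite mulr0 sqr_ge0.
move: wA; rewrite inE /A/= mulr1 => Mw.
by rewrite -[leRHS]real_normK ?num_real// lerXn2r// ?nnegrE ltW.
Qed.

Lemma bm_cos_linsum t n u : bm (fun w => cos (u + linsum t n w)).
Proof.
by apply: bm_cos; apply: measurable_funD => //; exact: measurable_linsum.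
Qed.

Lemma bm_cosZ (t : R) : bm (fun x : R => cos (t * x)).
Proof. by apply: bm_cos; exact: measurable_funM. Qed.

Lemma bm_sinZ (t : R) : bm (fun x : R => sin (t * x)).
Proof. by apply: bm_sin; exact: measurable_funM. Qed.

(** The real substitute for multiplicativity of the exponential: the phase shift by pi / 2 writes -
    sin as a cosine, so peeling off an error stays among the cosines of [linsum] with some phase. *)
Lemma cos_linsumS t n u w : cos (u + linsum t n.+1 w) =
  cos (u + linsum t n w) * cos (t n * e n w) +
  cos (u + pi / 2 + linsum t n w) * sin (t n * e n w).
Proof. rewrite linsumS addrA (addrAC u (pi / 2)) cosDpihalf mulNr.
exact: cosD. Qed.

Lemma past_cos t n u : past n (fun w => cos (u + linsum t n w)).
Proof.
elim: n u => [|n IH] u.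
  have -> : (fun w => cos (u + linsum t 0 w)) = (fun=> cos u).
    by apply/funext => w; rewrite /linsum big_ord0 addr0.
  exact: past_cst.
have -> : (fun w => cos (u + linsum t n.+1 w)) =
   (fun w => cos (u + linsum t n w) * cos (t n * e n w) -
     - cos (u + pi / 2 + linsum t n w) * sin (t n * e n w)).
  by apply/funext => w; rewrite cos_linsumS mulNr opprK.
apply: pastB; first exact: (pastM (IH u) (bm_cosZ (t n))).
(* The sign introduced to use [pastB] is absorbed by a further phase shift by pi, and the induction
   hypothesis holds for every phase. *)
under eq_fun do rewrite -cosDpi addrAC.
exact: (pastM (IH _) (bm_sinZ (t n))).
Qed.

Lemma E_cos_linsumS t n u : \int[P]_w cos (u + linsum t n.+1 w) =
  \int[P]_w cos (u + linsum t n w) * \int[P]_w cos (t n * e 0%N w) +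
  \int[P]_w cos (u + pi / 2 + linsum t n w) * \int[P]_w sin (t n * e 0%N w).
Proof.
have bc := bm_cosZ (t n); have bs := bm_sinZ (t n).
under eq_Rintegral do rewrite cos_linsumS.
rewrite ED; [|apply: bmM; [exact: bm_cos_linsum|exact: (bm_comp_e n bc)]
             |apply: bmM; [exact: bm_cos_linsum|exact: (bm_comp_e n bs)]].
rewrite (past_mul (past_cos t n u) bc) (past_mul (past_cos t n (u + pi / 2)) bs).
rewrite (@Rintegral_same n (fun x => cos (t n * x))); last 2 first.
- by case: bc.
- exact: (bm_integrable P (bm_comp_e 0%N bc)).
rewrite (@Rintegral_same n (fun x => sin (t n * x)))//; first by case: bs.
exact: (bm_integrable P (bm_comp_e 0%N bs)).
Qed.

(** One error at a time is exchanged for its Gaussian factor. Each exchange costs delta t_i^2 twice,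
    once for the cosine mean and once for the sine mean; all accompanying factors are at most 1 in
    absolute value, so the costs add up. *)
Lemma E_cos_linsum_error t n u (delta : R) :
  (forall i, (i < n)%N ->
    `|\int[P]_w cos (t i * e 0%N w) - expR (- (sigma ^+ 2 * t i ^+ 2 / 2))| <= delta * t i ^+ 2 /\
    `|\int[P]_w sin (t i * e 0%N w)| <= delta * t i ^+ 2) ->
  `|\int[P]_w cos (u + linsum t n w) -
     expR (- (sigma ^+ 2 * (\sum_(i < n) t i ^+ 2) / 2)) * cos u|
  <= 2 * delta * \sum_(i < n) t i ^+ 2.
Proof.
elim: n u => [|n IH] u H.
  have -> : (fun w => cos (u + linsum t 0 w)) = (fun=> cos u).
    by apply/funext => w; rewrite /linsum big_ord0 addr0.
  by rewrite big_ord0 mulr0 mul0r oppr0 expR0 mul1r Rintegral_cst1 subrr normr0 mulr0.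
rewrite E_cos_linsumS !big_ord_recr/=.
have {IH}IH := IH u (fun i ni => H i (ltnW ni)).
have [H1 H2] := H n (ltnSn n).
set S := \sum_(i < n) t i ^+ 2 in IH *.
set A := \int[P]_w cos (u + linsum t n w) in IH *.
set B := \int[P]_w cos (u + pi / 2 + linsum t n w).
set a := \int[P]_w cos _ in H1 *; set b := \int[P]_w sin _ in H2 *.
have A1 : `|A| <= 1.
  apply: normE_le; first exact: bm_cos_linsum.
  by move=> w; rewrite ler_norml cos_geN1 cos_le1.
have B1 : `|B| <= 1.
  apply: normE_le; first exact: bm_cos_linsum.
  by move=> w; rewrite ler_norml cos_geN1 cos_le1.
rewrite (mulrDr (sigma ^+ 2)) mulrDl opprD expRD.
set E1 := expR _ in IH *; set E2 := expR _ in H1 *.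
have E21 : `|E2| <= 1.
  rewrite ger0_norm ?expR_ge0// -expR0 ler_expR oppr_le0.
  by rewrite divr_ge0// mulr_ge0 ?sqr_ge0.
have -> : A * a + B * b - E1 * E2 * cos u = A * (a - E2) + E2 * (A - E1 * cos u) + B * b by ring.
have -> : 2 * delta * (S + t n ^+ 2) = delta * t n ^+ 2 + 2 * delta * S + delta * t n ^+ 2 by ring.
have L (x y c : R) : `|x| <= 1 -> `|y| <= c -> `|x * y| <= c.
  by move=> x1 yc; rewrite normrM -[leRHS]mul1r ler_pM.
by apply: le_trans (ler_normD _ _) _; apply: lerD; [apply: le_trans (ler_normD _ _) _; apply: lerD|]; exact: L.
Qed.

(** The part of the squared error above level n, whose mean is the quantity in Lindeberg's
    condition. *)
Definition tail_sqr (n : nat) (w : T) : R :=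
  if `|e 0%N w| <= n%:R then 0 else e 0%N w ^+ 2.

Lemma measurable_tail_sqr n : measurable_fun setT (tail_sqr n).
Proof.
apply: measurable_fun_ifT => //; last exact: measurable_funX.
by apply: measurable_fun_ler => //; exact: measurableT_comp.
Qed.

Lemma tail_sqr_le n w : 0 <= tail_sqr n w <= e 0%N w ^+ 2.
Proof. by rewrite /tail_sqr; case: ifP => _; rewrite ?lexx sqr_ge0. Qed.

Lemma integrable_tail n : P.-integrable setT (EFin \o tail_sqr n).
Proof.
apply: (@integrable_sqr_dom _ 1); first exact: measurable_tail_sqr.
by move=> w; have /andP[t0 t1] := tail_sqr_le n w; rewrite ger0_norm// mul1r; lra.
Qed.

Lemma cvg_E_tail : (fun n : nat => \int[P]_w tail_sqr n w) @ \oo --> (0 : R).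
Proof.
have -> : 0 = \int[P]_w (0 : R) by rewrite Rintegral_cst1.
apply: (@Rintegral_dominated _ _ _ _ _ _ (fun w => e 0%N w ^+ 2)) => //.
- exact: measurable_tail_sqr.
- move=> w; apply: cvg_near_cst; near=> n.
  by rewrite /tail_sqr ifT//; near: n; exact: nbhs_infty_ger.
- by move=> n w; have /andP[t0 t1] := tail_sqr_le n w; rewrite ger0_norm.
Unshelve. all: by end_near. Qed.

(** Lindeberg's splitting. Where |e_0| <= K the cubic bound costs |t|^3 K^3, small against t^2 for
    small t; where |e_0| > K the quadratic bound is paid for by the tail of the second moment, small
    for large K. *)
Lemma E_remainder_small (g : R -> R) (delta : R) : 0 < delta ->
  measurable_fun setT g ->
  (forall y, `|g y| <= 2 * y ^+ 2) -> (forall y, `|y| <= 1 -> `|g y| <= `|y| ^+ 3) ->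
  exists2 eta : R, 0 < eta & forall t : R, `|t| <= eta ->
    P.-integrable setT (EFin \o (fun w => g (t * e 0%N w))) /\
    `|\int[P]_w g (t * e 0%N w)| <= delta * t ^+ 2.
Proof.
move=> d0 mg g2 g3.
have [n tn] : exists n, \int[P]_w tail_sqr n.+1 w <= delta / 4.
  have : \forall n \near \oo, \int[P]_w tail_sqr n w <= delta / 4.
    have d40 : 0 < delta / 4 by rewrite divr_gt0.
    by have /cvgr_le := cvg_E_tail; apply.
  by move=> [N _ HN]; exists N; apply: HN; exact: leqnSn.
set K : R := n.+1%:R; have K0 : 0 < K by rewrite ltr0n.
(* The first bound gives |t e_0| <= 1 wherever |e_0| <= K, so that the cubic estimate applies; the
   second gives |t| K^3 <= delta / 2. The tail contributes the other half of delta. *)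
exists (Num.min K^-1 (delta / (2 * K ^+ 3))).
  by rewrite lt_min invr_gt0 K0 divr_gt0// mulr_gt0// exprn_gt0.
move=> t; rewrite le_min => /andP[tK td].
have ig : P.-integrable setT (EFin \o (fun w => g (t * e 0%N w))).
  apply: (@integrable_sqr_dom _ (2 * t ^+ 2)).
    by apply: measurableT_comp => //; exact: measurable_funM.
  move=> w; rewrite (le_trans (g2 _))// exprMn mulrA lerDr.
  by rewrite mulr_ge0 ?sqr_ge0.
split => //.
apply: le_trans (le_normr_Rintegral _ _) _ => //.
have tK3 : `|t| * K ^+ 3 <= delta / 2.
  move: td; rewrite -ler_pdivlMr ?exprn_gt0//.
  by rewrite invfM mulrA.
apply: (@le_trans _ _ (\int[P]_w (`|t| ^+ 3 * K ^+ 3 + 2 * t ^+ 2 * tail_sqr n.+1 w))).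
  apply: le_Rintegral => //.
  - by have := integrable_norm ig.
  - apply: integrable_EFinD; first exact/bm_integrable/bm_cst.
    by apply: integrable_EFinZ; exact: integrable_tail.
  - move=> w _; rewrite /tail_sqr; case: ifPn => eK.
      rewrite mulr0 addr0 -exprMn.
      have te : `|t * e 0%N w| <= `|t| * K by rewrite normrM ler_wpM2l.
      have t1 : `|t * e 0%N w| <= 1 by rewrite (le_trans te)// -ler_pdivlMr// div1r.
      by rewrite (le_trans (g3 _ t1))// lerXn2r// nnegrE (le_trans _ te).
    rewrite (le_trans (g2 _))// exprMn mulrA lerDr.
    by rewrite mulr_ge0 ?exprn_ge0// ltW.
rewrite RintegralD//; last 2 first.
- exact/bm_integrable/bm_cst.
- by apply: integrable_EFinZ; exact: integrable_tail.
rewrite Rintegral_cst1 RintegralZl//; last exact: integrable_tail.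
have t2 : `|t| ^+ 2 = t ^+ 2 by rewrite real_normK ?num_real.
have -> : `|t| ^+ 3 * K ^+ 3 = `|t| * K ^+ 3 * t ^+ 2 by rewrite -t2; ring.
have := sqr_ge0 t; nra.
Qed.

(** Agreement with the Gaussian up to o(t^2): the zero mean removes the linear term of the sine, and
    the variance makes the cosine and exp(-s), s = sigma^2 t^2 / 2, share the expansion 1 - s. *)
Lemma char_small (delta : R) : 0 < delta -> exists2 eta : R, 0 < eta & forall t : R, `|t| <= eta ->
    `|\int[P]_w cos (t * e 0%N w) - expR (- (sigma ^+ 2 * t ^+ 2 / 2))| <= delta * t ^+ 2 /\
    `|\int[P]_w sin (t * e 0%N w)| <= delta * t ^+ 2.
Proof.
move=> d0.
have cm (f : R -> R) : continuous f -> measurable_fun setT f by exact: continuous_measurable_fun.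
have d20 : 0 < delta / 2 by rewrite divr_gt0.
have cube (y : R) : `|y| <= 1 -> `|y| ^+ 4 <= `|y| ^+ 3.
  by move=> y1; rewrite exprS ler_piMl.
have mcos := cm _ (@continuous_cos R).
have msin := cm _ (@continuous_sin R).
have [|||e1 e10 H1] := @E_remainder_small (fun y => cos y - 1 + y ^+ 2 / 2) _ d20.
- apply: measurable_funD; first exact: measurable_funB.
  by apply: measurable_funM => //; exact: measurable_funX.
- exact: cos_taylor_le_sqr.
- by move=> y y1; rewrite (le_trans (cos_taylor_le y))// cube.
have [|||e2 e20 H2] := @E_remainder_small (fun y => sin y - y) _ d20.
- exact: measurable_funB.
- exact: sinB_le_sqr.
- by move=> y y1; rewrite (le_trans (sinB_le y)).
(* This bound on t makes s^2 = sigma^4 t^4 / 4, the error in expanding exp(-s), at most delta t^2 /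
   2. *)
pose e3 := Num.min 1 (delta / (sigma ^+ 4 + 1)).
have s4 : 0 <= sigma ^+ 4 by rewrite exprn_even_ge0.
have s41 : 0 < sigma ^+ 4 + 1 by rewrite ltr_wpDl.
have e30 : 0 < e3 by rewrite lt_min ltr01 divr_gt0.
exists (Num.min e1 (Num.min e2 e3)); first by rewrite 2!lt_min e10 e20.
move=> t; rewrite !le_min => /and3P[/H1[i1 t1] /H2[i2 t2] /andP[t31 t3d]].
have bcos : bm (fun w => cos (t * e 0%N w)) by apply: bm_cos; exact: measurable_funM.
have bsin : bm (fun w => sin (t * e 0%N w)) by apply: bm_sin; exact: measurable_funM.
have ie0 : P.-integrable setT (EFin \o (fun w => t * e 0%N w)).
  by apply: integrable_EFinZ; exact: integrable_e0.
split; last first.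
  rewrite [X in `|X|](_ : _ = \int[P]_w (sin (t * e 0%N w) - t * e 0%N w)).
    by rewrite (le_trans t2)// ler_wpM2r ?sqr_ge0//; lra.
  rewrite RintegralB//; last exact: bm_integrable.
  by rewrite [X in _ - X]RintegralZl ?mean0 ?mulr0 ?subr0//; exact: integrable_e0.
have Ec : \int[P]_w (cos (t * e 0%N w) - 1 + (t * e 0%N w) ^+ 2 / 2) =
    \int[P]_w cos (t * e 0%N w) - 1 + sigma ^+ 2 * t ^+ 2 / 2.
  have -> : (fun w => cos (t * e 0%N w) - 1 + (t * e 0%N w) ^+ 2 / 2) =
     (fun w => (cos (t * e 0%N w) - 1) + (t ^+ 2 / 2) * e 0%N w ^+ 2).
    by apply/funext => w; ring.
  rewrite RintegralD//; last 2 first.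
  - by apply/bm_integrable/bmD => //; exact: bm_cst.
  - exact: integrable_EFinZ.
  rewrite EB//; last exact: bm_cst.
  by rewrite Rintegral_cst1 RintegralZl// var0; ring.
rewrite Ec in t1.
set s := sigma ^+ 2 * t ^+ 2 / 2 in t1 *.
have s0 : 0 <= s by rewrite divr_ge0// mulr_ge0 ?sqr_ge0.
have Hs := expRN_taylor_le s0.
have s2 : s ^+ 2 <= delta / 2 * t ^+ 2.
  have -> : s ^+ 2 = (sigma ^+ 4 * t ^+ 2) / 4 * t ^+ 2 by rewrite /s; field.
  rewrite ler_wpM2r ?sqr_ge0// -[t ^+ 2]real_normK ?num_real//.
  have : sigma ^+ 4 * `|t| <= delta.
    have : (sigma ^+ 4 + 1) * `|t| <= delta by rewrite mulrC -ler_pdivlMr.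
    have := normr_ge0 t; lra.
  have := normr_ge0 t; have : `|t| <= 1 by []; nra.
set E := \int[P]_w _ in t1 *.
have -> : E - expR (- s) = (E - 1 + s) - (expR (- s) - 1 + s) by ring.
apply: le_trans (ler_normB _ _) _; lra.
Qed.

(** Once n is large, every weight s_i / sqrt n lies in the range of [char_small], so the accumulated
    error is at most 2 delta times the mean square of the s_i, which stays bounded. *)
Lemma clt_cos (s : nat -> R) (q u : R) :
  (fun n : nat => (\sum_(i < n) s i ^+ 2) / n%:R) @ \oo --> q ->
  (fun n : nat => \int[P]_w cos (u + linsum (fun i => s i / Num.sqrt n%:R) n w)) @ \oo -->
    expR (- (sigma ^+ 2 * q / 2)) * cos u.
Proof.
move=> avg.
pose Q (n : nat) : R := (\sum_(i < n) s i ^+ 2) / n%:R.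
have QE (n : nat) : \sum_(i < n) (s i / Num.sqrt n%:R) ^+ 2 = Q n.
  rewrite /Q mulr_suml; apply: eq_bigr => i _.
  by rewrite exprMn exprVn sqr_sqrtr.
have l1 : (fun n => expR (- (sigma ^+ 2 * Q n / 2)) * cos u) @ \oo -->
    expR (- (sigma ^+ 2 * q / 2)) * cos u.
  apply: cvgMl; apply: continuous_cvg; first exact: continuous_expR.
  by apply: cvgN; apply: cvgMl; apply: cvgMr.
apply/cvgrPdist_le => /= eps e0.
have q10 : 0 < `|q| + 1 by rewrite ltr_wpDl.
(* The mean square is eventually at most |q| + 1, so the accumulated error is at most eps / 2. *)
pose delta := eps / (4 * (`|q| + 1)).
have d0 : 0 < delta by rewrite divr_gt0// mulr_gt0.
have [eta eta0 Heta] := char_small d0.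
have e20 : 0 < eps / 2 by rewrite divr_gt0.
have q1 : `|q| < `|q| + 1 by rewrite ltrDl.
have Qle : \forall n \near \oo, `|Q n| <= `|q| + 1.
  by apply: cvgr_le q1; exact: cvg_norm.
have eta20 : 0 < eta ^+ 2 by rewrite exprn_gt0.
move/cvgrPdist_le : l1 => /(_ _ e20) l1.
near=> n.
have n0 : (0 < n)%N by near: n; exists 1%N.
have nR : 0 < n%:R :> R by rewrite ltr0n.
have small i : (i < n)%N -> `|s i / Num.sqrt n%:R| <= eta.
  move=> ni; rewrite -(@ler_pXn2r _ 2)// ?nnegrE ?(ltW eta0)//.
  rewrite real_normK ?num_real// exprMn exprVn sqr_sqrtr// ler_pdivrMr//.
  by move: i ni; near: n; exact: (avg_max_small avg).
have err := @E_cos_linsum_error (fun i => s i / Num.sqrt n%:R) n u delta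
  (fun i ni => Heta _ (small i ni)).
rewrite QE in err.
have Qn : Q n <= `|q| + 1.
  by rewrite (le_trans (ler_norm _))//; near: n; exact: Qle.
have Q2 : 2 * delta * Q n <= eps / 2.
  apply: (@le_trans _ _ (2 * delta * (`|q| + 1))).
    by rewrite ler_wpM2l// mulr_ge0// ltW.
  rewrite /delta le_eqVlt; apply/orP; left; apply/eqP; field.
  exact: lt0r_neq0.
have l1n : `|expR (- (sigma ^+ 2 * q / 2)) * cos u - expR (- (sigma ^+ 2 * Q n / 2)) * cos u| <= eps / 2.
  by near: n; exact: l1.
move: err l1n; set a := \int[P]_w _; set b := _ * cos u; set c := _ * cos u => err l1n.
have -> : c - a = (c - b) - (a - b) by ring.
by rewrite (le_trans (ler_normB _ _))//; lra.
Unshelve. all: by end_near. Qed.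

End Independence.

(** * Gaussian integrals *)

Lemma cvg_mx (R : realType) (T : Type) (F : set_system T) (FF : Filter F) (m n : nat)
  (f : T -> 'M[R]_(m, n)) (M : 'M[R]_(m, n)) :
  (forall i j, (fun x => f x i j) @ F --> M i j) -> f @ F --> M.
Proof.
move=> H A [B MB BA]; apply: (filterS (P := fun x => forall i j, B i j (f x i j))).
  by move=> x Hx; apply: BA.
apply: filter_forall => i; apply: filter_forall => j.
exact: (H i j _ (MB i j)).
Qed.

Lemma continuous_mx (R : realType) (T : topologicalType) (m n : nat) (f : T -> 'M[R]_(m, n)) :
  (forall i j, continuous (fun x => f x i j)) -> continuous f.
Proof. by move=> H x; apply: cvg_mx => i j; exact: H. Qed.

Section ContinuousR.
Context {T : topologicalType} {R : realType}.
Implicit Types f g : T -> R.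

Lemma continuousDR f g : continuous f -> continuous g -> continuous (fun x => f x + g x).
Proof. by move=> cf cg x; apply: cvgD; [exact: cf|exact: cg]. Qed.

Lemma continuousMR f g : continuous f -> continuous g -> continuous (fun x => f x * g x).
Proof. by move=> cf cg x; apply: cvgM; [exact: cf|exact: cg]. Qed.

Lemma continuousZR (a : R) f : continuous f -> continuous (fun x => a * f x).
Proof. by move=> cf; apply: continuousMR => // x; exact: cvg_cst. Qed.

Lemma continuous_sumR (I : Type) (r : seq I) (F : I -> T -> R) :
  (forall i, continuous (F i)) -> continuous (fun x => \sum_(i <- r) F i x).
Proof. by move=> cF; apply: continuous_big => //; exact: add_continuous. Qed.

Lemma continuous_compR (h : R -> R) f : continuous h -> continuous f -> continuous (fun x => h (f x)).
Proof. by move=> ch cf x; apply: (@continuous_comp _ _ _ f h); [exact: cf|exact: ch]. Qed.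

End ContinuousR.

Section DeriveR.
Variable R : realType.
Implicit Types (f g : R -> R) (x a b : R).

Lemma is_derive_compR f g x a b : is_derive x 1 g b -> is_derive (g x) 1 f a ->
  is_derive x 1 (fun y => f (g y)) (a * b).
Proof. by move=> dg df; exact: (is_derive1_comp df dg). Qed.

Lemma is_deriveMR f g x a b : is_derive x 1 f a -> is_derive x 1 g b ->
  is_derive x 1 (fun y => f y * g y) (a * g x + f x * b).
Proof.
move=> df dg; apply: (is_derive_eq (is_deriveM df dg)).
by rewrite /GRing.scale/=; ring.
Qed.

Lemma is_deriveZR f x a b : is_derive x 1 f a -> is_derive x 1 (fun y => b * f y) (b * a).
Proof. exact: is_deriveZ. Qed.

Lemma is_deriveBR f g x a b : is_derive x 1 f a -> is_derive x 1 g b ->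
  is_derive x 1 (fun y => f y - g y) (a - b).
Proof. exact: is_deriveB. Qed.

End DeriveR.

(** * The cosine transform of the standard normal density *)

Section Gauss1.
Variable R : realType.
Local Notation mu := (@lebesgue_measure R).
Local Notation phi := (@normal_pdf R 0 1).
Local Notation int f := (mu.-integrable setT (EFin \o f)).

Lemma phiE x : phi x = normal_peak 1 * expR (- (x ^+ 2 / 2)).
Proof.
rewrite normal_pdfE ?oner_eq0// /normal_fun subr0 expr1n.
by rewrite mulNr.
Qed.

Lemma int_phi : int phi.
Proof. exact: integrable_normal_pdf. Qed.

Lemma continuous_phi : continuous phi.
Proof. by apply: continuous_normal_pdf; exact: oner_neq0. Qed.

Lemma measurable_phi : measurable_fun setT phi.
Proof. exact: measurable_normal_pdf. Qed.

Lemma phi_ge0 x : 0 <= phi x.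
Proof. exact: normal_pdf_ge0. Qed.

Lemma integral_phi : \int[mu]_x phi x = 1.
Proof. by rewrite /Rintegral integral_normal_pdf. Qed.

Lemma int_bm_phi (h : R -> R) : bounded_measurable h -> int (fun x => h x * phi x).
Proof.
move=> [mh [M hM]].
apply: (@le_integrable _ _ _ mu setT measurableT _ (EFin \o (fun x => M * phi x))).
- by apply/measurable_EFinP; apply: measurable_funM => //; exact: measurable_phi.
- move=> x _; rewrite /= lee_fin !normrM (ger0_norm (phi_ge0 x)) ler_wpM2r ?phi_ge0//.
  by rewrite (le_trans (hM x))// ler_norm.
- by apply: integrable_EFinZ; exact: int_phi.
Qed.

(** From |x| <= 1 + x^2 / 4 <= exp(x^2 / 4), the function is dominated by a multiple of exp(-x^2 /
    4), that is, of the centred normal density of variance 2. *)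
Lemma int_norm_phi : int (fun x => `|x| * phi x).
Proof.
pose s : R := Num.sqrt 2.
have s0 : s != 0 by rewrite sqrtr_eq0 -ltNge.
apply: (@le_integrable _ _ _ mu setT measurableT _
  (EFin \o (fun x => normal_peak 1 / normal_peak s * normal_pdf 0 s x))).
- by apply/measurable_EFinP; apply: measurable_funM => //; exact: measurable_phi.
- move=> x _; rewrite /= lee_fin [leRHS]ger0_norm; last first.
    by rewrite mulr_ge0 ?normal_pdf_ge0// divr_ge0 ?normal_peak_ge0.
  rewrite ger0_norm ?mulr_ge0 ?phi_ge0// phiE normal_pdfE// /normal_fun subr0.
  rewrite sqr_sqrtr// mulrA divfK ?gt_eqF ?normal_peak_gt0//.
  rewrite mulrCA ler_wpM2l ?normal_peak_ge0//.
  rewrite (_ : - (x ^+ 2 / 2) = - (x ^+ 2 / 4) + - (x ^+ 2 / 4)); last by field.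
  rewrite (_ : - x ^+ 2 / (2 *+ 2) = - (x ^+ 2 / 4)); last by rewrite -mulr_natl; field.
  rewrite expRD mulrA -[leRHS]mul1r ler_wpM2r ?expR_ge0//.
  rewrite expRN -ler_pdivlMr ?invr_gt0 ?expR_gt0// invrK mul1r.
  apply: le_trans (expR_ge1Dx _).
  have := real_normK (num_real x); have := sqr_ge0 (`|x| - 2); nra.
- by apply: integrable_EFinZ; exact: integrable_normal_pdf.
Qed.

Lemma is_derive_phi (x : R) : is_derive x 1 phi (- x * phi x).
Proof.
rewrite (_ : phi = fun x => normal_peak 1 * expR (- (x ^+ 2 / 2))); last first.
  by apply/funext => y; exact: phiE.
have D : is_derive x 1 (fun x : R => - (x ^+ 2 / 2)) (- x).
  by apply: is_derive_eq; rewrite /GRing.scale/=; field.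
by apply: (is_derive_eq (is_deriveZR (normal_peak 1) (is_derive_compR D (is_derive_expR (- (x ^+ 2 / 2)))))); ring.
Qed.

Lemma int_xphi (h : R -> R) : bounded_measurable h -> int (fun x => x * h x * phi x).
Proof.
move=> [mh [M hM]].
apply: (@le_integrable _ _ _ mu setT measurableT _ (EFin \o (fun x => M * (`|x| * phi x)))).
- apply/measurable_EFinP; apply: measurable_funM => //; last exact: measurable_phi.
  exact: measurable_funM.
- move=> x _; rewrite /= lee_fin !normrM (ger0_norm (phi_ge0 x)) normr_id mulrA ler_wpM2r ?phi_ge0//.
  by rewrite mulrC ler_wpM2r// (le_trans (hM x))// ler_norm.
- by apply: integrable_EFinZ; exact: int_norm_phi.
Qed.

Lemma continuous_affine (u t : R) : continuous (fun x : R => u + t * x).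
Proof.
by move=> x; apply: cvgD; [exact: cvg_cst|apply: cvgMr; exact: cvg_id].
Qed.

Lemma bm_sin_affine (u t : R) : bounded_measurable (fun x : R => sin (u + t * x)).
Proof. by apply: bm_sin; apply: measurable_funD => //; exact: measurable_funM. Qed.

Lemma bm_cos_affine (u t : R) : bounded_measurable (fun x : R => cos (u + t * x)).
Proof. by apply: bm_cos; apply: measurable_funD => //; exact: measurable_funM. Qed.

Lemma phi_le1V (n : nat) : phi n.+1%:R <= normal_peak 1 * n.+1%:R^-1.
Proof.
rewrite phiE ler_wpM2l ?normal_peak_ge0// expRN lef_pV2 ?posrE ?expR_gt0//.
apply: le_trans (expR_ge1Dx _).
by have : 0 <= (n.+1%:R - 1 : R) ^+ 2; [exact: sqr_ge0|nra].
Qed.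

Lemma cvg_phi : (fun n : nat => phi n%:R) @ \oo --> (0 : R).
Proof.
rewrite -cvg_shiftS; apply: (@squeeze_cvgr _ _ _ _ (fun=> 0) (fun n => normal_peak 1 * n.+1%:R^-1)).
- by apply: nearW => n; rewrite phi_ge0 phi_le1V.
- exact: cvg_cst.
- by rewrite -[0](mulr0 (normal_peak 1)); apply: cvgMr; exact: cvg_harmonic.
Qed.

Lemma Rintegral_symm_cvg (f : R -> R) : int f ->
  (fun n : nat => \int[mu]_(x in `[- n%:R, n%:R]) f x) @ \oo --> \int[mu]_x f x.
Proof.
move=> fi; have mf : measurable_fun setT f by apply/measurable_EFinP; case/integrableP: fi.
under eq_fun do rewrite Rintegral_mkcond.
apply: (@Rintegral_dominated _ _ _ mu (fun n => f \_ `[- n%:R, n%:R]) f (fun x => `|f x|)).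
- by move=> n; apply/measurable_restrict => //; rewrite setTI; exact: measurable_funTS.
- move=> x; apply: cvg_near_cst; near=> n.
  rewrite patchE ifT// inE/= in_itv/= -ler_norml.
  by near: n; exact: nbhs_infty_ger.
- by have := integrable_norm fi.
- by move=> n x; rewrite patchE; case: ifP; rewrite ?normr0.
Unshelve. all: by end_near. Qed.

Lemma continuous_sin_affine (u t : R) : continuous (fun x : R => sin (u + t * x)).
Proof.
move=> x; apply: (continuous_comp (@continuous_affine u t x)); exact: continuous_sin.
Qed.

Lemma continuous_cos_affine (u t : R) : continuous (fun x : R => cos (u + t * x)).
Proof.
move=> x; apply: (continuous_comp (@continuous_affine u t x)); exact: continuous_cos.
Qed.

(* Gaussian integration by parts: the derivative of sin(u + t x) phi(x) integrates to 0. *)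
Lemma stein_cos (u t : R) :
  \int[mu]_x (x * sin (u + t * x) * phi x) = t * \int[mu]_x (cos (u + t * x) * phi x).
Proof.
pose g x := sin (u + t * x) * phi x.
pose g' x := t * (cos (u + t * x) * phi x) - x * sin (u + t * x) * phi x.
have ic := int_bm_phi (bm_cos_affine u t).
have is_ := int_xphi (bm_sin_affine u t).
have ig' : int g'.
  have := integrableB measurableT (integrable_EFinZ t ic) is_.
  by apply: eq_integrable.
have dg (x : R) : is_derive x 1 g (g' x).
  have D0 : is_derive x 1 (fun x : R => u + t * x) t.
    by apply: is_derive_eq; rewrite /GRing.scale/=; ring.
  have D1 := is_derive_compR D0 (is_derive_sin (u + t * x)).
  by apply: (is_derive_eq (is_deriveMR D1 (is_derive_phi x))); rewrite /g'; ring.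
have cg' : continuous g'.
  move=> x; apply: cvgB.
    apply: cvgMr; apply: cvgM; [exact: continuous_cos_affine|exact: continuous_phi].
  apply: cvgM; last exact: continuous_phi.
  by apply: cvgM; [exact: cvg_id|exact: continuous_sin_affine].
have cg : continuous g.
  by move=> x; apply: cvgM; [exact: continuous_sin_affine|exact: continuous_phi].
(* The level [n.+1] keeps the interval nondegenerate for every n. *)
have FTC (n : nat) : \int[mu]_(x in `[- n.+1%:R, n.+1%:R]) g' x = g n.+1%:R - g (- n.+1%:R).
  rewrite /Rintegral (@continuous_FTC2 _ g' g)//.
  - by rewrite gtrN.
  - exact: continuous_subspaceT.
  - split; first by move=> x _; case: (dg x).
    + by apply: cvg_at_right_filter; exact: cg.
    + by apply: cvg_at_left_filter; exact: cg.
  - by move=> x _; rewrite derive1E; case: (dg x).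
have L1 : (fun n : nat => \int[mu]_(x in `[- n.+1%:R, n.+1%:R]) g' x) @ \oo --> \int[mu]_x g' x.
  have := Rintegral_symm_cvg ig'.
  by rewrite -cvg_shiftS.
have L2 : (fun n : nat => \int[mu]_(x in `[- n.+1%:R, n.+1%:R]) g' x) @ \oo --> (0 : R).
  under eq_fun do rewrite FTC.
  have gle (x : R) : `|g x| <= phi x.
    rewrite normrM (ger0_norm (phi_ge0 x)) -[leRHS]mul1r ler_wpM2r ?phi_ge0//.
    by rewrite ler_norml sin_geN1 sin_le1.
  have phiN (x : R) : phi (- x) = phi x by rewrite !phiE sqrrN.
  apply/cvgr0Pnorm_le => eps e0.
  have e20 : 0 < eps / 2 by rewrite divr_gt0.
  have : \forall n \near \oo, phi n.+1%:R <= eps / 2.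
    apply: cvgr_le e20; have := cvg_phi; by rewrite -cvg_shiftS.
  apply: filterS => n hn.
  rewrite (le_trans (ler_normB _ _))//.
  have := gle n.+1%:R; have := gle (- n.+1%:R); rewrite phiN; lra.
have : \int[mu]_x g' x = 0 by exact: (cvg_unique _ L1 L2).
rewrite /g' RintegralB//; last exact: integrable_EFinZ.
by rewrite RintegralZl// => /eqP; rewrite subr_eq0 => /eqP.
Qed.

(** As a function F of t the integral solves F' = - t F: differentiate under the integral, with |y|
    phi(y) as dominating function, and apply [stein_cos]. Hence F(t) exp(t^2 / 2) is constant, with
    value F(0) = cos u. *)
Lemma gauss_cos (u t : R) :
  \int[mu]_x (cos (u + t * x) * phi x) = expR (- (t ^+ 2 / 2)) * cos u.
Proof.
pose F t := \int[mu]_x (cos (u + t * x) * phi x).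
have dF (s : R) : is_derive s 1 F (- s * F s).
  have Is : s \in `]s - 1, s + 1[ by rewrite in_itv/=; apply/andP; split; lra.
  have If (x : R) : `](s - 1), (s + 1)[%classic x -> int (fun y => cos (u + x * y) * phi y).
    by move=> _; exact: (int_bm_phi (bm_cos_affine u x)).
  have D (x y : R) : is_derive x 1 (fun x => cos (u + x * y) * phi y) (- (y * sin (u + x * y) * phi y)).
    have D0 : is_derive x 1 (fun x : R => u + x * y) y.
      by apply: is_derive_eq; rewrite /GRing.scale/=; ring.
    have D1 := is_derive_compR D0 (is_derive_cos (u + x * y)).
    under eq_fun do rewrite mulrC.
    by apply: (is_derive_eq (is_deriveZR (phi y) D1)); ring.
  have d1 x y : partial1of2 (fun x y => cos (u + x * y) * phi y) x y = - (y * sin (u + x * y) * phi y).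
    by rewrite partial1of2E; case: (D x y).
  have G0 (y : R) : 0 <= `|y| * phi y by rewrite mulr_ge0 ?phi_ge0.
  have ub (x y : R) : `](s - 1), (s + 1)[%classic x -> setT y ->
      `|partial1of2 (fun x y => cos (u + x * y) * phi y) x y| <= `|y| * phi y.
    move=> _ _; rewrite d1 normrN !normrM (ger0_norm (phi_ge0 y)) ler_wpM2r ?phi_ge0//.
    by rewrite ler_piMr// ler_norml sin_geN1 sin_le1.
  have dd (x y : R) : `](s - 1), (s + 1)[%classic x -> setT y ->
      derivable (fun x : R => cos (u + x * y) * phi y) x 1.
    by move=> _ _; case: (D x y).
  have DU := @derivable_under_integral _ _ _ mu (fun x y => cos (u + x * y) * phi y) setT measurableT
    s (s - 1) (s + 1) Is If dd _ G0 int_norm_phi ub.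
  have EU := @differentiation_under_integral _ _ _ mu (fun x y => cos (u + x * y) * phi y) setT measurableT
    s (s - 1) (s + 1) Is If dd _ G0 int_norm_phi ub.
  apply: DeriveDef; first exact: DU.
  rewrite -derive1E EU.
  under eq_Rintegral do rewrite d1.
  rewrite mulNr /F -stein_cos.
  have is_ := int_xphi (bm_sin_affine u s).
  under eq_Rintegral do rewrite -mulN1r.
  by rewrite RintegralZl// mulN1r.
pose H t := F t * expR (t ^+ 2 / 2).
have dH (s : R) : is_derive s 1 H 0.
  have D : is_derive s 1 (fun x : R => x ^+ 2 / 2) s.
    by apply: is_derive_eq; rewrite /GRing.scale/=; field.
  have D2 := is_derive_compR D (is_derive_expR (s ^+ 2 / 2)).
  by apply: (is_derive_eq (is_deriveMR (dF s) D2)); ring.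
have H0 : H t = H 0.
  have D (x : R) : is_derive x 1 (fun x : R => H x - H 0) 0.
    by apply: (is_derive_eq (is_deriveBR (dH x) (is_derive_cst (H 0) x 1))); rewrite subr0.
  have : `|H t - H 0| <= 0 * `|t|.
    by apply: (mvt_bound D) => [|c _]; rewrite ?subrr ?normr0.
  by rewrite mul0r normr_le0 subr_eq0 => /eqP.
have F0 : F 0 = cos u.
  rewrite /F; under eq_Rintegral do rewrite mul0r addr0.
  by rewrite RintegralZl ?integral_phi ?mulr1//; exact: int_phi.
move: H0; rewrite /H expr0n/= mul0r expR0 mulr1 F0 => <-.
by rewrite mulrCA -expRD addNr expR0 mulr1.
Qed.

End Gauss1.

(** * Iterated Gaussian integrals and the Cholesky substitution *)

Section GaussN.
Variable R : realType.
Local Notation mu := (@lebesgue_measure R).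
Local Notation phi := (@normal_pdf R 0 1).
Local Notation int f := (mu.-integrable setT (EFin \o f)).

Definition gauss_int (h : R -> R) : R := \int[mu]_z (h z * phi z).

Lemma bm_continuous (h : R -> R) (M : R) : continuous h -> (forall x, `|h x| <= M) ->
  bounded_measurable h.
Proof. by move=> ch hM; split; [exact: continuous_measurable_fun|exists M]. Qed.

Lemma gauss_int_cvg (h_ : nat -> R -> R) (h : R -> R) (M : R) :
  (forall n, measurable_fun setT (h_ n)) -> (forall n x, `|h_ n x| <= M) ->
  (forall x, h_ ^~ x @ \oo --> h x) ->
  (fun n => gauss_int (h_ n)) @ \oo --> gauss_int h.
Proof.
move=> mh hM ch.
have mhp n : measurable_fun setT (fun z : R => h_ n z * phi z).
  by apply: measurable_funM => //; exact: measurable_phi.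
apply: (@Rintegral_dominated _ _ _ mu (fun n z => h_ n z * phi z) (fun z => h z * phi z) (fun z => M * phi z)).
- exact: mhp.
- by move=> x; apply: cvgMl; exact: ch.
- by apply: integrable_EFinZ; exact: int_phi.
- by move=> n x; rewrite normrM (ger0_norm (phi_ge0 x)) ler_wpM2r ?phi_ge0.
Qed.

Lemma gauss_int_le (h : R -> R) (M : R) : measurable_fun setT h ->
  (forall x, `|h x| <= M) -> `|gauss_int h| <= M.
Proof.
move=> mh hM; have bh : bounded_measurable h by split => //; exists M.
apply: le_trans (le_normr_Rintegral _ _) _ => //; first exact: int_bm_phi.
apply: (@le_trans _ _ (\int[mu]_x (M * phi x))); last first.
  by rewrite RintegralZl ?integral_phi ?mulr1//; exact: int_phi.
apply: le_Rintegral => //.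
- by have := integrable_norm (int_bm_phi bh).
- by apply: integrable_EFinZ; exact: int_phi.
- by move=> x _; rewrite normrM (ger0_norm (phi_ge0 x)) ler_wpM2r ?phi_ge0.
Qed.

Lemma gauss_intZ (a : R) (h : R -> R) : bounded_measurable h ->
  gauss_int (fun z => a * h z) = a * gauss_int h.
Proof.
move=> bh; rewrite /gauss_int.
under eq_Rintegral do rewrite -mulrA.
by rewrite RintegralZl//; exact: int_bm_phi.
Qed.

Lemma gauss_intD (g h : R -> R) : bounded_measurable g -> bounded_measurable h ->
  gauss_int (fun z => g z + h z) = gauss_int g + gauss_int h.
Proof.
move=> bg bh; rewrite /gauss_int.
under eq_Rintegral do rewrite mulrDl.
by rewrite RintegralD//; exact: int_bm_phi.
Qed.

Lemma normal_pdf_scale (m l z : R) : 0 < l -> normal_pdf m l (m + l * z) * l = phi z.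
Proof.
move=> l0; rewrite normal_pdfE ?gt_eqF// phiE /normal_fun.
rewrite addrAC subrr add0r exprMn -mulNr.
rewrite (_ : - l ^+ 2 * z ^+ 2 / (l ^+ 2 *+ 2) = - (z ^+ 2 / 2)); last first.
  by rewrite -mulr_natl; field; rewrite gt_eqF.
rewrite mulrAC; congr (_ * _).
rewrite /normal_peak expr1n mul1r -mulrnAr sqrtrM ?sqr_ge0// sqrtr_sqr gtr0_norm//.
by rewrite invfM mulrAC mulVf ?mul1r// gt_eqF.
Qed.

Lemma int_bm_pdf (m l : R) (h : R -> R) : bounded_measurable h -> int (fun x => h x * normal_pdf m l x).
Proof.
move=> [mh [M hM]].
apply: (@le_integrable _ _ _ mu setT measurableT _ (EFin \o (fun x => M * normal_pdf m l x))).
- by apply/measurable_EFinP; apply: measurable_funM => //; exact: measurable_normal_pdf.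
- move=> x _; rewrite /= lee_fin !normrM (ger0_norm (normal_pdf_ge0 m l x)) ler_wpM2r ?normal_pdf_ge0//.
  by rewrite (le_trans (hM x))// ler_norm.
- by apply: integrable_EFinZ; exact: integrable_normal_pdf.
Qed.

(** The substitution x = m + l z is made for a nonnegative integrand, so G is first raised to G + M;
    both integrals of the constant M equal M and cancel. *)
Lemma Rintegral_normal_pdf_scale (G : R -> R) (M m l : R) : 0 < l -> continuous G ->
  (forall x, `|G x| <= M) ->
  \int[mu]_x (G x * normal_pdf m l x) = gauss_int (fun z => G (m + l * z)).
Proof.
move=> l0 cG GM.
have bG := bm_continuous cG GM.
have caff : continuous (fun z : R => m + l * z) by exact: continuous_affine.
have cGa : continuous (fun z => G (m + l * z)).
  by move=> z; apply: (@continuous_comp _ _ _ (fun z => m + l * z) G); [exact: caff|exact: cG].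
have bGa : bounded_measurable (fun z => G (m + l * z)) by apply: (@bm_continuous _ M).
have ip : int (normal_pdf m l) by exact: integrable_normal_pdf.
have bM : bounded_measurable (fun _ : R => M) by exact: bm_cst.
have E1 := gauss_intD bGa bM.
have E2 : \int[mu]_x ((G x + M) * normal_pdf m l x) = \int[mu]_x (G x * normal_pdf m l x) + M.
  transitivity (\int[mu]_x (G x * normal_pdf m l x + M * normal_pdf m l x)).
    by apply: eq_Rintegral => x _; rewrite mulrDl.
  transitivity (\int[mu]_x (G x * normal_pdf m l x) + \int[mu]_x (M * normal_pdf m l x)).
    exact: (RintegralD measurableT (int_bm_pdf m l bG) (integrable_EFinZ M ip)).
  congr (_ + _); transitivity (M * \int[mu]_x normal_pdf m l x).
    exact: (@RintegralZl _ _ R mu setT (normal_pdf m l) M measurableT ip).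
  by rewrite /Rintegral integral_normal_pdf mulr1.
have E3 : gauss_int (fun _ : R => M) = M.
  transitivity (M * \int[mu]_x phi x); first exact: (@RintegralZl _ _ R mu setT phi M measurableT (int_phi R)).
  by rewrite integral_phi mulr1.
suff E4 : \int[mu]_x ((G x + M) * normal_pdf m l x) = gauss_int (fun z => G (m + l * z) + M).
  exact: (addIr M (etrans (esym E2) (etrans E4 (etrans E1 (congr1 _ E3))))).
pose H x := (G x + M) * normal_pdf m l x.
have dF (x : R) : is_derive x 1 (fun z : R => m + l * z) l.
  by apply: is_derive_eq; rewrite /GRing.scale/=; ring.
have F' : (fun z : R => m + l * z)^`()%classic = cst l.
  by apply/funext => z; rewrite derive1E; case: (dF z).
have affE : (fun z : R => m + l * z) = (fun y => m + y) \o (fun x : R => x * l).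
  by apply/funext => z /=; rewrite mulrC.
rewrite /gauss_int /Rintegral; congr fine.
rewrite (@increasing_ge0_integration_by_substitutionT R (fun z => m + l * z) H).
- apply: eq_integral => z _; rewrite F' /H /=; congr (_%:E).
  by rewrite -(normal_pdf_scale m z l0); rewrite !fctE/=; ring.
- by move=> x y xy; rewrite ltrD2l ltr_pM2l.
- by rewrite F'; exact: cst_continuous.
- by rewrite F'; exact: is_cvg_cst.
- by rewrite F'; exact: is_cvg_cst.
- by move=> x; case: (dF x).
- rewrite affE; apply: (@cvg_comp _ _ _ (fun x : R => x * l) (fun y => m + y) _ -oo _ _ (cvg_addrl_Ny m)).
  by apply: gt0_cvgMlNy => //; exact: cvg_id.
- rewrite affE; apply: (@cvg_comp _ _ _ (fun x : R => x * l) (fun y => m + y) _ +oo _ _ (cvg_addrl m)).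
  by apply: gt0_cvgMly => //; exact: cvg_id.
- move=> x; apply: cvgM; first by apply: cvgD; [exact: cG|exact: cvg_cst].
  by apply: continuous_normal_pdf; rewrite gt_eqF.
- move=> x; rewrite mulr_ge0 ?normal_pdf_ge0//.
  by have := GM x; rewrite ler_norml => /andP[h _]; lra.
Qed.

Definition cons_cV k (z : R) (v : 'cV[R]_k) : 'cV[R]_k.+1 :=
  col_mx (const_mx z : 'cV_1) v.

(** The standard normal expectation in dimension k, built with the same recursion as
    [iter_lebesgue_int] so that the two unfold in parallel. *)
Fixpoint gauss_iter (k : nat) : ('cV[R]_k -> R) -> R :=
  match k return ('cV[R]_k -> R) -> R with
  | 0 => fun h => h 0
  | k'.+1 => fun h => gauss_int (fun z => gauss_iter (fun v : 'cV[R]_k' => h (cons_cV z v)))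
  end.

Lemma cons_cVE k (z : R) (v : 'cV[R]_k) i j :
  cons_cV z v i j = if unlift 0 i is Some i' then v i' j else z.
Proof.
rewrite /cons_cV; case: unliftP => [i'|] ->.
  have -> : lift 0 i' = rshift 1 i' by exact: val_inj.
  exact: (@col_mxEd R 1 k 1).
have -> : (0 : 'I_k.+1) = lshift k (0 : 'I_1) by exact: val_inj.
by rewrite (@col_mxEu R 1 k 1) mxE.
Qed.

Lemma cons_cV_sqr k (z : R) (v : 'cV[R]_k) :
  ((cons_cV z v)^T *m cons_cV z v) 0 0 = z ^+ 2 + (v^T *m v) 0 0.
Proof.
rewrite /cons_cV (@tr_col_mx R 1 k 1) (@mul_row_col R 1 1 k 1) mxE.
by congr (_ + _); rewrite !mxE big_ord1 !mxE expr2.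
Qed.

Lemma continuous_cons_cVl k (v : 'cV[R]_k) : continuous (fun z => cons_cV z v).
Proof.
apply: continuous_mx => i j.
under eq_fun do rewrite cons_cVE.
by case: (unlift 0 i) => [i'|] x; [exact: cvg_cst|exact: cvg_id].
Qed.

Lemma continuous_cons_cVr k (z : R) : continuous (fun v : 'cV[R]_k => cons_cV z v).
Proof.
apply: continuous_mx => i j.
under eq_fun do rewrite cons_cVE.
case: (unlift 0 i) => [i'|]; first exact: (@coord_continuous R k 1 i' j).
exact: (@cst_continuous 'cV[R]_k R z).
Qed.

Definition bounded_continuous k (h : 'cV[R]_k -> R) :=
  continuous h /\ exists M : R, forall x, `|h x| <= M.

(** Boundedness and dominated convergence are proved in one induction: the outer integrand must be
    measurable, which follows from its continuity, and this is dominated convergence along sequences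
    in the lower dimension. *)
Lemma gauss_iter_bound_cvg k :
  (forall (h : 'cV[R]_k -> R) (M : R), continuous h -> (forall x, `|h x| <= M) -> `|gauss_iter h| <= M) /\
  (forall (h_ : nat -> 'cV[R]_k -> R) h (M : R), (forall n, continuous (h_ n)) ->
    (forall n x, `|h_ n x| <= M) -> (forall x, h_ ^~ x @ \oo --> h x) ->
    (fun n => gauss_iter (h_ n)) @ \oo --> gauss_iter h).
Proof.
elim: k => [|k [IHb IHc]].
  by split=> [h M _ hM|h_ h M _ _ ch] /=; [exact: hM|exact: ch].
have cr (h : 'cV[R]_k.+1 -> R) z : continuous h -> continuous (fun v => h (cons_cV z v)).
  move=> ch v; apply: (@continuous_comp _ _ _ (cons_cV z) h); last exact: ch.
  exact: continuous_cons_cVr.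
have cl (h : 'cV[R]_k.+1 -> R) (M : R) : continuous h -> (forall x, `|h x| <= M) ->
    continuous (fun z => gauss_iter (fun v => h (cons_cV z v))).
  move=> ch hM z; apply/(@cvg_nbhsP _ R^o) => u uz.
  apply: (IHc (fun n v => h (cons_cV (u n) v)) _ M).
  - by move=> n; exact: cr.
  - by move=> n x; exact: hM.
  - move=> v; have c1 : {for z, continuous (fun z => h (cons_cV z v))}.
      apply: (@continuous_comp _ _ _ (fun z => cons_cV z v) h); last exact: ch.
      exact: continuous_cons_cVl.
    by move/(@cvg_nbhsP _ R^o) : c1; exact.
split=> [h M ch hM|h_ h M ch hM hh] /=.
  apply: gauss_int_le; first by apply: continuous_measurable_fun; exact: (cl h M).
  by move=> z; apply: IHb => // v; exact: cr.
apply: (@gauss_int_cvg _ _ M).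
- by move=> n; apply: continuous_measurable_fun; exact: (cl _ M (ch n) (hM n)).
- by move=> n z; apply: IHb => // v; exact: cr.
- by move=> z; apply: IHc => [n|n v|v]; [exact: cr|exact: hM|exact: hh].
Qed.

Lemma gauss_iter_le k (h : 'cV[R]_k -> R) (M : R) : continuous h ->
  (forall x, `|h x| <= M) -> `|gauss_iter h| <= M.
Proof. exact: (gauss_iter_bound_cvg k).1. Qed.

Lemma gauss_iter_cvg k (h_ : nat -> 'cV[R]_k -> R) h (M : R) :
  (forall n, continuous (h_ n)) -> (forall n x, `|h_ n x| <= M) ->
  (forall x, h_ ^~ x @ \oo --> h x) ->
  (fun n => gauss_iter (h_ n)) @ \oo --> gauss_iter h.
Proof. exact: (gauss_iter_bound_cvg k).2. Qed.

Lemma continuous_fix_l k (h : 'cV[R]_k.+1 -> R) z : continuous h ->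
  continuous (fun v => h (cons_cV z v)).
Proof.
move=> ch v; apply: (@continuous_comp _ _ _ (cons_cV z) h); last exact: ch.
exact: continuous_cons_cVr.
Qed.

Lemma continuous_gauss_iter k (h : R -> 'cV[R]_k -> R) (M : R) :
  (forall z, continuous (h z)) -> (forall v, continuous (h ^~ v)) ->
  (forall z x, `|h z x| <= M) -> continuous (fun z => gauss_iter (h z)).
Proof.
move=> c1 c2 hM z; apply/(@cvg_nbhsP _ R^o) => u uz.
apply: (gauss_iter_cvg (h_ := fun n => h (u n)) (M := M)) => // v.
by have /(@cvg_nbhsP _ R^o) := c2 v z; exact.
Qed.

Lemma bm_gauss_iter_cons k (h : 'cV[R]_k.+1 -> R) (M : R) : continuous h ->
  (forall x, `|h x| <= M) -> bounded_measurable (fun z => gauss_iter (fun v => h (cons_cV z v))).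
Proof.
move=> ch hM; apply: (@bm_continuous _ M); last first.
  by move=> z; apply: gauss_iter_le => //; exact: continuous_fix_l.
apply: (continuous_gauss_iter (M := M)) => //; first by move=> z; exact: continuous_fix_l.
move=> v z; apply: (@continuous_comp _ _ _ (fun z => cons_cV z v) h); last exact: ch.
exact: continuous_cons_cVl.
Qed.

Lemma gauss_iterZ k (h : 'cV[R]_k -> R) (a : R) : bounded_continuous h ->
  gauss_iter (fun x => a * h x) = a * gauss_iter h.
Proof.
elim: k h => [//|k IH] h [ch [M hM]] /=.
rewrite -gauss_intZ; last exact: (bm_gauss_iter_cons ch hM).
congr gauss_int; apply/funext => z; apply: IH; split; first exact: continuous_fix_l.
by exists M.
Qed.

Lemma gauss_iterD k (g h : 'cV[R]_k -> R) : bounded_continuous g -> bounded_continuous h ->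
  gauss_iter (fun x => g x + h x) = gauss_iter g + gauss_iter h.
Proof.
elim: k g h => [//|k IH] g h [cg [N gN]] [ch [M hM]] /=.
rewrite -gauss_intD; [|exact: (bm_gauss_iter_cons cg gN)|exact: (bm_gauss_iter_cons ch hM)].
congr gauss_int; apply/funext => z; apply: IH; split; try exact: continuous_fix_l.
  by exists N.
by exists M.
Qed.

(** The phase absorbs the outermost coordinate while the inner ones are integrated, which is why u
    is general in the induction. *)
Lemma gauss_iter_cos k (th : 'rV[R]_k) (u : R) :
  gauss_iter (fun z => cos (u + (th *m z) 0 0)) =
  expR (- ((th *m th^T) 0 0 / 2)) * cos u.
Proof.
elim: k th u => [|k IH] th u /=.
  by rewrite !(thinmx0, flatmx0) !mulmx0 !mxE mul0r oppr0 expR0 mul1r addr0.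
pose a := lsubmx (th : 'rV_(1 + k)) 0 0; pose th' := rsubmx (th : 'rV_(1 + k)).
have thE : th = row_mx a%:M th' :> 'rV_(1 + k).
  by rewrite -[LHS](@hsubmxK R 1 1 k) {1}[lsubmx _]mx11_scalar.
have E1 z v : (th *m cons_cV z v) 0 0 = a * z + (th' *m v) 0 0.
  by rewrite /cons_cV thE (@mul_row_col R 1 1 k) mul_scalar_mx !mxE.
have E2 : (th *m th^T) 0 0 = a ^+ 2 + (th' *m th'^T) 0 0.
  rewrite thE (@tr_row_mx R 1 1 k) (@mul_row_col R 1 1 k) tr_scalar_mx mul_scalar_mx !mxE eqxx mulr1n.
  by rewrite expr2.
have -> : (fun z : R => gauss_iter (fun v => cos (u + (th *m cons_cV z v) 0 0))) =
    (fun z => expR (- ((th' *m th'^T) 0 0 / 2)) * cos (u + a * z)).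
  apply/funext => z; rewrite -IH; congr gauss_iter; apply/funext => v.
  by rewrite E1 addrA.
rewrite gauss_intZ; last exact: bm_cos_affine.
by rewrite /gauss_int gauss_cos E2 mulrDl opprD expRD; ring.
Qed.

Lemma continuous_mx_affine k l (L : 'M[R]_(l, k)) (m : 'cV[R]_l) :
  continuous (fun z : 'cV[R]_k => m + L *m z).
Proof.
apply: continuous_mx => i j.
rewrite (_ : (fun _ => _) = fun z : 'cV[R]_k => m i j + \sum_q L i q * z q j); last first.
  by apply/funext => z; rewrite !mxE.
apply: (@continuousDR 'cV[R]_k); first exact: (@cst_continuous 'cV[R]_k R).
apply: (@continuous_sumR 'cV[R]_k) => q; apply: (@continuousZR 'cV[R]_k).
exact: (@coord_continuous R k 1 q j).
Qed.

Lemma bounded_continuous_affine k l (f : 'cV[R]_l -> R) (L : 'M[R]_(l, k)) (m : 'cV[R]_l) :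
  bounded_continuous f -> bounded_continuous (fun z => f (m + L *m z)).
Proof.
move=> [cf [M fM]]; split; last by exists M.
move=> z; apply: (@continuous_comp _ _ _ (fun z => m + L *m z) f); last exact: cf.
exact: continuous_mx_affine.
Qed.

Lemma posdef_diag_gt0 k (S : 'M[R]_k) i : posdef S -> 0 < S i i.
Proof.
move=> [_ HS].
have d0 : delta_mx 0 i != 0 :> 'rV[R]_k.
  by apply/eqP => /rowP/(_ i)/eqP; rewrite !mxE !eqxx oner_eq0.
have := HS _ d0.
rewrite -rowE mxE (bigD1 i)//= big1 => [|j ji]; last first.
  by rewrite !mxE eqxx (negbTE ji) mulr0.
by rewrite !mxE !eqxx mulr1 addr0.
Qed.

(* One step of the Cholesky factorisation: S = L0 diag(1, S') L0^T with S' the Schur complement. *)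
Lemma posdef_schur k (S : 'M[R]_(1 + k)) : posdef S ->
  exists (l : R) (w : 'cV[R]_k) (S' : 'M[R]_k), [/\ 0 < l, posdef S' &
    S = block_mx (l ^+ 2)%:M (l *: w^T) (l *: w) (w *m w^T + S')].
Proof.
move=> pS; have [sS HS] := pS.
have s0 : 0 < S (lshift k 0) (lshift k 0) by exact: posdef_diag_gt0.
set s := S _ _ in s0; pose l : R := Num.sqrt s.
have l0 : 0 < l by rewrite sqrtr_gt0.
have l2 : l ^+ 2 = s by rewrite sqr_sqrtr// ltW.
pose w : 'cV[R]_k := l^-1 *: dlsubmx S.
pose S' : 'M[R]_k := drsubmx S - w *m w^T.
have lw : l *: w = dlsubmx S by rewrite scalerA divff ?scale1r// gt_eqF.
have SE : S = block_mx (l ^+ 2)%:M (l *: w^T) (l *: w) (w *m w^T + S').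
  rewrite -[LHS]submxK; congr block_mx.
  - by rewrite [LHS]mx11_scalar l2 !mxE.
  - have -> : l *: w^T = (l *: w)^T by apply/matrixP => i j; rewrite !mxE.
    by rewrite lw trmx_dlsub sS.
  - by rewrite lw.
  - by rewrite /S' addrC subrK.
exists l, w, S'; split => //; split.
  by rewrite /S' linearB/= trmx_mul trmxK trmx_drsub sS.
move=> u u0.
(* The first entry solves l a + u w = 0; it cancels every term but the Schur complement in the
   quadratic form of S. *)
pose a : R := - l^-1 * (u *m w) 0 0.
pose v : 'rV[R]_(1 + k) := row_mx a%:M u.
have v0 : v != 0.
  apply: contra_neq u0 => /(congr1 rsubmx); rewrite row_mxKr => ->.
  by apply/rowP => j; rewrite !mxE.
have := HS _ v0.
suff -> : v *m S *m v^T = u *m S' *m u^T by [].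
have uw : u *m w = (- (l * a))%:M.
  by rewrite [LHS]mx11_scalar /a mulrA mulrN mulNr opprK divff ?mul1r// gt_eqF.
rewrite SE /v mul_row_block tr_row_mx mul_row_col tr_scalar_mx.
have e1 : a%:M *m (l ^+ 2)%:M + u *m (l *: w) = (0 : 'M[R]_(1, 1)).
  rewrite -scalemxAr uw -scalar_mxM scale_scalar_mx.
  apply/matrixP => i j; rewrite 3!mxE -mulrnDl mxE.
  by rewrite (_ : _ + _ = 0) ?mul0rn//; ring.
have e2 : a%:M *m (l *: w^T) + u *m (w *m w^T + S') = u *m S'.
  rewrite mulmxDr mulmxA uw addrA -scalemxAr !mul_scalar_mx scalerA -scalerDl.
  by rewrite subrr scale0r add0r.
by rewrite e1 e2 mul0mx add0r.
Qed.

Lemma quad_invmx k (L : 'M[R]_k) (y : 'cV[R]_k) : L \in unitmx ->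
  (L *m y)^T *m invmx (L *m L^T) *m (L *m y) = y^T *m y.
Proof.
move=> uL.
have uLT : L^T \in unitmx by rewrite unitmx_tr.
have -> : invmx (L *m L^T) = invmx L^T *m invmx L.
  have uLL : L *m L^T \in unitmx by rewrite unitmx_mul uL.
  apply: (can_inj (mulKmx uLL)); rewrite mulmxV// !mulmxA mulmxK// mulmxV//.
rewrite trmx_mul !mulmxA mulmxK// -!mulmxA mulKmx//.
Qed.

(** Conditioning on the first coordinate: the density is a one-dimensional normal density times a
    normal density with the Schur complement as covariance and a mean affine in the first
    coordinate. The free mean m lets the induction hypothesis handle this second factor. *)
Lemma gaussian_cholesky k (S : 'M[R]_k) : posdef S ->
  exists L : 'M[R]_k, [/\ L \in unitmx, S = L *m L^T &
    forall (f : 'cV[R]_k -> R) (m : 'cV[R]_k), bounded_continuous f ->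
      iter_lebesgue_int (fun x => f x * normal_density S (x - m)) =
      gauss_iter (fun z => f (m + L *m z))].
Proof.
elim: k S => [|k IH] S pS.
  exists S; split; first by rewrite unitmxE det_mx00 unitr1.
    by rewrite [LHS]flatmx0 [RHS]flatmx0.
  move=> f m _ /=; rewrite /normal_density det_mx00 expr0 mulr1 sqrtr1 divr1.
  rewrite [0 - m]flatmx0 [m + _]flatmx0 mulmx0 mxE oppr0 mul0r expR0 mulr1.
  by congr f; apply/matrixP => -[].
have [l [w [S' [l0 pS' SE]]]] := posdef_schur pS.
have [L' [uL' SL' IHf]] := IH _ pS'.
pose L : 'M[R]_(1 + k) := block_mx l%:M 0 w L'.
have uL : L \in unitmx.
  by rewrite unitmxE det_lblock det_scalar expr1 unitrM -unitmxE uL' andbT unitfE gt_eqF.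
have SL : S = L *m L^T.
  rewrite SE /L tr_block_mx mulmx_block trmx0 !mul0mx !mulmx0 !addr0 tr_scalar_mx.
  by rewrite -scalar_mxM mul_scalar_mx mul_mx_scalar -SL'.
exists L; split => // f m [cf [M fM]].
pose m1 := m 0 0; pose m' : 'cV[R]_k := dsubmx (m : 'cV_(1 + k)).
have mE : m = cons_cV m1 m'.
  apply/matrixP => i j; rewrite cons_cVE ord1.
  case: unliftP => [i'|] -> //; rewrite mxE; congr (m _ _); exact: val_inj.
clearbody m1 m'.
have LE z v : L *m cons_cV z v = cons_cV (l * z) (z *: w + L' *m v).
  rewrite /cons_cV /L (@mul_block_col R 1 k 1 k); congr col_mx.
    rewrite mul0mx addr0 mul_scalar_mx.
    by apply/matrixP => i j; rewrite !mxE.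
  congr (_ + _); apply/matrixP => i j; rewrite !mxE big_ord_recl big_ord0 addr0 !mxE.
  by rewrite (ord1 j) mulrC.
have dE : \det S = l ^+ 2 * \det S'.
  rewrite SL SL' !det_mulmx !det_tr /L (@det_lblock R 1 k) det_scalar expr1.
  by ring.
have dS'0 : 0 <= \det S' by rewrite SL' det_mulmx det_tr -expr2 sqr_ge0.
have pi0 : 0 <= (2 * pi : R) by rewrite mulr_ge0// pi_ge0.
(* Marginal density of the first coordinate times the conditional density of the others. *)
have densE x1 v : normal_density S (cons_cV x1 v - m) =
    normal_pdf m1 l x1 * normal_density S' (v - (m' + ((x1 - m1) / l) *: w)).
  set z1 := (x1 - m1) / l.
  pose y' := invmx L' *m (v - (m' + z1 *: w)).
  have Ly' : v - (m' + z1 *: w) = L' *m y' by rewrite /y' mulKVmx.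
  have -> : cons_cV x1 v - m = L *m cons_cV z1 y'.
    rewrite LE -Ly' mE; apply/matrixP => i j.
    rewrite [LHS]mxE [X in _ + X]mxE !cons_cVE.
    case: (unlift 0 i) => [i'|]; first by rewrite !mxE; ring.
    by rewrite /z1 mulrCA divff ?mulr1// gt_eqF.
  rewrite Ly' /normal_density {1}SL quad_invmx// {1}SL' quad_invmx//.
  rewrite cons_cV_sqr.
  rewrite dE normal_pdfE ?gt_eqF// /normal_fun /normal_peak.
  rewrite (_ : (2 * pi) ^+ k.+1 * (l ^+ 2 * \det S') =
     (l ^+ 2 * pi *+ 2) * ((2 * pi) ^+ k * \det S')); last by rewrite exprS; ring.
  rewrite sqrtrM; last by rewrite mulrn_wge0// mulr_ge0 ?sqr_ge0 ?pi_ge0.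
  rewrite opprD mulrDl expRD invfM.
  rewrite (_ : - z1 ^+ 2 / 2 = - (x1 - m1) ^+ 2 / (l ^+ 2 *+ 2)); last first.
    by rewrite /z1 -mulr_natl; field; rewrite gt_eqF.
  by ring.
pose G (x1 : R) := gauss_iter (fun v => f (cons_cV x1 (m' + ((x1 - m1) / l) *: w + L' *m v))).
have inner (x1 : R) : iter_lebesgue_int (fun v => f (cons_cV x1 v) * normal_density S (cons_cV x1 v - m)) =
    G x1 * normal_pdf m1 l x1.
  rewrite (_ : (fun v => f (cons_cV x1 v) * _) = fun v => (normal_pdf m1 l x1 * f (cons_cV x1 v)) *
       normal_density S' (v - (m' + ((x1 - m1) / l) *: w))); last first.
    by apply/funext => v; rewrite densE; ring.
  rewrite (IHf (fun v => normal_pdf m1 l x1 * f (cons_cV x1 v))); last first.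
    split; last first.
      by exists (normal_pdf m1 l x1 * M) => v; rewrite normrM (ger0_norm (normal_pdf_ge0 _ _ _)) ler_wpM2l ?normal_pdf_ge0.
    by apply: (@continuousZR 'cV[R]_k); exact: continuous_fix_l.
  rewrite (gauss_iterZ (h := fun v => f (cons_cV x1 (m' + ((x1 - m1) / l) *: w + L' *m v)))).
    by rewrite mulrC.
  apply: (bounded_continuous_affine (f := fun v => f (cons_cV x1 v))).
  by split; [exact: continuous_fix_l|exists M].
transitivity (\int[mu]_x1 (G x1 * normal_pdf m1 l x1)).
  by apply: eq_Rintegral => x1 _; exact: inner.
rewrite (Rintegral_normal_pdf_scale (M := M))//.
- congr gauss_int; apply/funext => z; rewrite /G; congr gauss_iter; apply/funext => v.
  congr f; rewrite LE mE; apply/matrixP => i j; rewrite [RHS]mxE !cons_cVE.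
  case: (unlift 0 i) => [i'|//]; rewrite !mxE.
  rewrite (_ : (m1 + l * z - m1) / l = z); last by field; rewrite gt_eqF.
  by rewrite addrA.
- apply: (continuous_gauss_iter (M := M)) => //.
  + move=> x1 v; apply: (@continuous_comp _ _ _ (fun v => m' + ((x1 - m1) / l) *: w + L' *m v) (fun v => f (cons_cV x1 v))).
      exact: continuous_mx_affine.
    exact: continuous_fix_l.
  + move=> v x1; apply: (@continuous_comp _ _ _ (fun x1 => cons_cV x1 (m' + ((x1 - m1) / l) *: w + L' *m v)) f); last exact: cf.
    have aff i' j : continuous (fun x1 : R => (m' + ((x1 - m1) / l) *: w + L' *m v) i' j).
      rewrite (_ : (fun _ => _) = fun x1 =>
          m' i' j - m1 / l * w i' j + (L' *m v) i' j + w i' j / l * x1).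
        exact: continuous_affine.
      by apply/funext => y; rewrite [LHS]mxE [X in X + _]mxE [X in _ + X + _]mxE; ring.
    apply: continuous_mx => i j; under eq_fun do rewrite cons_cVE.
    by case: (unlift 0 i) => [i'|]; [exact: aff|move=> ?; exact: cvg_id].
- move=> x1; apply: gauss_iter_le => //.
  move=> v; apply: (@continuous_comp _ _ _ (fun v => m' + ((x1 - m1) / l) *: w + L' *m v) (fun v => f (cons_cV x1 v))).
    exact: continuous_mx_affine.
  exact: continuous_fix_l.
Qed.

End GaussN.

(** * Trigonometric approximation *)

Section TrigPoly.
Variables (R : realType) (k : nat).

(** A triple lists amplitude, phase and frequency. The phase covers sines, and products stay in the
    class by the product-to-sum formula. *)
Definition trig_eval (s : seq (R * R * 'rV[R]_k)) (x : 'cV[R]_k) : R :=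
  \sum_(a <- s) a.1.1 * cos (a.1.2 + (a.2 *m x) 0 0).

Definition trig_poly (g : 'cV[R]_k -> R) : Prop := exists s, g =1 trig_eval s.

Lemma trig_poly_cst (c : R) : trig_poly (fun=> c).
Proof.
exists [:: (c, 0, 0)] => x; rewrite /trig_eval big_seq1/=.
by rewrite mul0mx mxE addr0 cos0 mulr1.
Qed.

Lemma trig_polyD f g : trig_poly f -> trig_poly g -> trig_poly (fun x => f x + g x).
Proof. by move=> [s fs] [t gt]; exists (s ++ t) => x; rewrite fs gt /trig_eval big_cat. Qed.

Lemma cosM (a b : R) : cos a * cos b = (cos (a + b) + cos (a - b)) / 2.
Proof. by rewrite cosD cosB; field. Qed.

Lemma trig_poly_mul_cos f (c u : R) (th : 'rV[R]_k) : trig_poly f ->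
  trig_poly (fun x => c * cos (u + (th *m x) 0 0) * f x).
Proof.
move=> [s fs].
pose t := [seq (c * a.1.1 / 2, u + a.1.2, th + a.2) | a <- s] ++
          [seq (c * a.1.1 / 2, u - a.1.2, th - a.2) | a <- s].
exists t => x; rewrite fs /trig_eval big_cat !big_map/= mulr_sumr -big_split/=.
apply: eq_bigr => a _.
rewrite mulrACA cosM mulmxDl mulmxBl !mxE.
rewrite (_ : u + _ + (a.1.2 + _) = u + a.1.2 + ((th *m x) 0 0 + (a.2 *m x) 0 0)); last by rewrite !mxE; ring.
rewrite (_ : u + _ - (a.1.2 + _) = u - a.1.2 + ((th *m x) 0 0 - (a.2 *m x) 0 0)); last by rewrite !mxE; ring.
by rewrite !mxE; ring.
Qed.

Lemma trig_poly_ext f g : f =1 g -> trig_poly f -> trig_poly g.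
Proof. by move=> fg [s fs]; exists s => x; rewrite -fg fs. Qed.

Lemma trig_polyM f g : trig_poly f -> trig_poly g -> trig_poly (fun x => f x * g x).
Proof.
move=> [s fs] tg; apply: (@trig_poly_ext (fun x => trig_eval s x * g x)) => [x|].
  by rewrite fs.
elim: s {fs} => [|a s IH].
  apply: (trig_poly_ext _ (trig_poly_cst 0)) => x.
  by rewrite /trig_eval big_nil mul0r.
apply: (trig_poly_ext _ (trig_polyD (trig_poly_mul_cos a.1.1 a.1.2 a.2 tg) IH)) => x.
by rewrite /trig_eval big_cons mulrDl.
Qed.

Lemma trig_poly_sum (I : Type) (r : seq I) (F : I -> 'cV[R]_k -> R) :
  (forall i, trig_poly (F i)) -> trig_poly (fun x => \sum_(i <- r) F i x).
Proof.
move=> HF; elim: r => [|i r IH].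
  by apply: (trig_poly_ext _ (trig_poly_cst 0)) => x; rewrite big_nil.
by apply: (trig_poly_ext _ (trig_polyD (HF i) IH)) => x; rewrite big_cons.
Qed.

Lemma trig_poly_prod (I : Type) (r : seq I) (F : I -> 'cV[R]_k -> R) :
  (forall i, trig_poly (F i)) -> trig_poly (fun x => \prod_(i <- r) F i x).
Proof.
move=> HF; elim: r => [|i r IH].
  by apply: (trig_poly_ext _ (trig_poly_cst 1)) => x; rewrite big_nil.
by apply: (trig_poly_ext _ (trig_polyM (HF i) IH)) => x; rewrite big_cons.
Qed.

Lemma trig_poly_sin (s : R) (j : 'I_k) : trig_poly (fun x => sin (s * x j 0)).
Proof.
exists [:: (1, - (pi / 2), s *: delta_mx 0 j)] => x.
rewrite /trig_eval big_seq1/= mul1r addrC cosBpihalf -scalemxAl -rowE mxE.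
by rewrite mxE.
Qed.

End TrigPoly.

(** * Bernstein polynomials on the unit cube *)

Section Bernstein.
Variable R : realType.

(* Binomial weights C(m,i) t^i (1-t)^(m-i), defined by Pascal's recursion so that moments follow by induction. *)
Fixpoint bern (m : nat) (t : R) (i : nat) : R :=
  if m is m'.+1 then (1 - t) * bern m' t i + (if i is i'.+1 then t * bern m' t i' else 0)
  else (i == 0%N)%:R.

Lemma bern_ge0 m t i : 0 <= t <= 1 -> 0 <= bern m t i.
Proof.
move=> /andP[t0 t1]; elim: m i => [|m IH] i //=.
rewrite addr_ge0 ?mulr_ge0 ?subr_ge0//.
by case: i => // i; rewrite mulr_ge0.
Qed.

Lemma bern_gt m t i : (m < i)%N -> bern m t i = 0.
Proof.
elim: m i => [|m IH] [|i] //= mi.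
by rewrite !IH// ?mulr0 ?addr0// ltnW.
Qed.

Lemma bern_sumS m t (g : nat -> R) : \sum_(i < m.+2) bern m.+1 t i * g i =
  (1 - t) * \sum_(i < m.+1) bern m t i * g i + t * \sum_(i < m.+1) bern m t i * g i.+1.
Proof.
rewrite (eq_bigr (fun i : 'I_m.+2 => (1 - t) * (bern m t i * g i) +
   (if (i : nat) is i'.+1 then t * bern m t i' else 0) * g i)); last first.
  by move=> i _; rewrite mulrA -mulrDl.
rewrite big_split/=; congr (_ + _).
  by rewrite big_ord_recr/= bern_gt// mul0r mulr0 addr0 mulr_sumr.
by rewrite big_ord_recl/= mul0r add0r mulr_sumr; apply: eq_bigr => i _; rewrite mulrA.
Qed.

Lemma bern_sum1 m t : \sum_(i < m.+1) bern m t i = 1.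
Proof.
have : \sum_(i < m.+1) bern m t i * 1 = 1.
  elim: m => [|m IH]; first by rewrite big_ord1 /= mulr1.
  by rewrite (bern_sumS m t (fun=> 1)) IH; ring.
by under eq_bigr do rewrite mulr1.
Qed.

(** The second moment of the binomial law about an arbitrary centre: Pascal's recursion moves the
    centre from a to a - 1, so a must vary in the induction. *)
Lemma bern_var m t (a : R) : \sum_(i < m.+1) bern m t i * (i%:R - a) ^+ 2 =
  m%:R * (t * (1 - t)) + (m%:R * t - a) ^+ 2.
Proof.
elim: m a => [|m IH] a; first by rewrite big_ord1 /=; ring.
rewrite (bern_sumS m t (fun i => (i%:R - a) ^+ 2)) IH.
rewrite (eq_bigr (fun i : 'I_m.+1 => bern m t i * (i%:R - (a - 1)) ^+ 2)); last first.
  by move=> i _; rewrite -[i.+1%:R]natr1; congr (_ * _); ring.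
by rewrite IH -[m.+1%:R]natr1; ring.
Qed.

Variable k : nat.
Implicit Types (x : 'cV[R]_k).

Definition grid m (kap : {ffun 'I_k -> 'I_m.+1}) : 'cV[R]_k := \col_j ((kap j)%:R / m%:R).

(** For x in the cube, the mean of F at a random grid point whose coordinates are independent
    binomial frequencies with parameters m and x_j. *)
Definition bern_op m (F : 'cV[R]_k -> R) x : R :=
  \sum_(kap : {ffun 'I_k -> 'I_m.+1}) (\prod_j bern m (x j 0) (kap j)) * F (grid kap).

Definition in_cube x := forall j, 0 <= x j 0 <= 1.

Lemma bern_op1 m x : \sum_(kap : {ffun 'I_k -> 'I_m.+1}) \prod_j bern m (x j 0) (kap j) = 1.
Proof.
rewrite -(bigA_distr_bigA (fun j (i : 'I_m.+1) => bern m (x j 0) i)).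
by apply: big1 => j _; exact: bern_sum1.
Qed.

Lemma bern_op_var m x (i : 'I_k) : (0 < m)%N -> in_cube x ->
  \sum_(kap : {ffun 'I_k -> 'I_m.+1}) (\prod_j bern m (x j 0) (kap j)) * (grid kap i 0 - x i 0) ^+ 2
  <= m%:R^-1.
Proof.
move=> m0 cx.
pose g j (l : 'I_m.+1) := bern m (x j 0) l * (if j == i then (l%:R / m%:R - x i 0) ^+ 2 else 1).
rewrite (eq_bigr (fun kap : {ffun 'I_k -> 'I_m.+1} => \prod_j g j (kap j))); last first.
  move=> kap _; rewrite /g big_split/=; congr (_ * _).
  rewrite (bigD1 i)//= eqxx big1 ?mulr1 ?mxE// => j ji.
  by rewrite (negbTE ji).
rewrite -(bigA_distr_bigA g) (bigD1 i)//= [X in _ * X]big1 ?mulr1; last first.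
  move=> j ji; rewrite /g (negbTE ji).
  by under eq_bigr do rewrite mulr1; exact: bern_sum1.
have mR : (0 : R) < m%:R by rewrite ltr0n.
rewrite /g eqxx.
rewrite (eq_bigr (fun l : 'I_m.+1 => (m%:R ^+ 2)^-1 * (bern m (x i 0) l * (l%:R - m%:R * x i 0) ^+ 2))); last first.
  by move=> l _; field; rewrite gt_eqF.
rewrite -mulr_sumr bern_var subrr expr0n/= addr0.
have /andP[x0 x1] := cx i.
rewrite (_ : _ * _ = m%:R^-1 * (x i 0 * (1 - x i 0))); last by field; rewrite gt_eqF.
rewrite ler_piMr ?invr_ge0//; nra.
Qed.

Lemma bern_op_le m (F : 'cV[R]_k -> R) (B : R) x : in_cube x -> (forall y, `|F y| <= B) ->
  `|bern_op m F x| <= B.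
Proof.
move=> cx FB; rewrite -[leRHS]mul1r -(bern_op1 m x) mulr_suml.
apply: le_trans (ler_norm_sum _ _ _) _; apply: ler_sum => kap _.
have w0 : 0 <= \prod_j bern m (x j 0) (kap j) by apply: prodr_ge0 => j _; exact: bern_ge0.
by rewrite normrM ger0_norm// ler_wpM2l.
Qed.

(** A quadratic modulus of continuity is averaged directly against the weights, so each coordinate
    contributes only its variance, at most 1 / m. *)
Lemma bern_op_approx m (F : 'cV[R]_k -> R) (e K : R) x : (0 < m)%N -> in_cube x -> 0 <= K ->
  (forall y, in_cube y -> `|F y - F x| <= e + K * \sum_j (y j 0 - x j 0) ^+ 2) ->
  `|bern_op m F x - F x| <= e + K * (k%:R / m%:R).
Proof.
move=> m0 cx K0 H.
have mR : (0 : R) < m%:R by rewrite ltr0n.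
pose w (kap : {ffun 'I_k -> 'I_m.+1}) := \prod_j bern m (x j 0) (kap j).
have w0 (kap : {ffun 'I_k -> 'I_m.+1}) : 0 <= w kap.
  by apply: prodr_ge0 => j _; exact: bern_ge0.
have -> : bern_op m F x - F x = \sum_(kap : {ffun 'I_k -> 'I_m.+1}) w kap * (F (grid kap) - F x).
  under eq_bigr do rewrite mulrBr.
  by rewrite sumrB -mulr_suml bern_op1 mul1r.
apply: le_trans (ler_norm_sum _ _ _) _.
apply: (@le_trans _ _ (\sum_(kap : {ffun 'I_k -> 'I_m.+1})
   (w kap * e + K * \sum_j (w kap * (grid kap j 0 - x j 0) ^+ 2)))).
  apply: ler_sum => kap _.
  rewrite normrM ger0_norm// -mulr_sumr mulrCA -mulrDr ler_wpM2l//; apply: H => j.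
  rewrite mxE divr_ge0//= ler_pdivrMr// mul1r ler_nat -ltnS.
  exact: ltn_ord.
rewrite big_split/= -mulr_suml bern_op1 mul1r lerD2l -mulr_sumr ler_wpM2l//.
rewrite exchange_big/=; apply: (@le_trans _ _ (\sum_(j < k) m%:R^-1)).
  by apply: ler_sum => j _; exact: bern_op_var.
by rewrite sumr_const card_ord -[leLHS]mulr_natl.
Qed.

Lemma cube_compact : compact [set x : 'cV[R]_k | in_cube x].
Proof.
have -> : [set x : 'cV[R]_k | in_cube x] =
    trmx @` [set v : 'rV[R]_k | forall i, `[0, 1]%classic (v ord0 i)].
  apply/seteqP; split=> x /=.
    move=> cx; exists x^T; last exact: trmxK.
    by move=> i /=; rewrite mxE in_itv/=; exact: cx.
  by move=> [v Hv <-] j; rewrite mxE; have := Hv j; rewrite /= in_itv.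
apply: continuous_compact.
  apply: continuous_subspaceT; apply: (@continuous_mx R 'rV[R]_k) => i j.
  under eq_fun do rewrite mxE.
  exact: (@coord_continuous R 1 k j i).
have := @rV_compact R k (fun=> `[0, 1]%classic); apply.
by move=> _; exact: segment_compact.
Qed.

Lemma cube_unif_cont (F : 'cV[R]_k -> R) (e : R) : continuous F -> 0 < e ->
  exists2 delta : R, 0 < delta & forall x y : 'cV[R]_k, in_cube x ->
    (forall j, `|y j 0 - x j 0| < delta) -> `|F y - F x| <= e.
Proof.
move=> cF e0.
have /compact_near_coveringP nc := cube_compact.
have e20 : 0 < e / 2 by rewrite divr_gt0.
have := nc R 0^'+ (fun (d : R) x => forall y : 'cV[R]_k, (forall j, `|y j 0 - x j 0| < d) -> `|F y - F x| <= e) _.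
case=> [x cx|d /= d0 Hd].
  have /cvgrPdist_lt /(_ _ e20) := cF x.
  move=> /nbhs_ballP[d /= d0 Hd].
  have d20 : 0 < d / 2 by rewrite divr_gt0.
  (* Halving the radius leaves room for both the move from x to x' and the move from x' to y. *)
  exists (ball x (d / 2), [set d' : R | d' < d / 2]) => /=.
    split; first exact: nbhsx_ballx.
    by apply: nbhs_right_lt.
  move=> [x' d'] /= [[_ xx'] dd'] y yx'.
  have h1 : `|F x - F x'| < e / 2.
    apply: Hd; split=> // i j; have := xx' i j; rewrite /ball/= => h.
    by rewrite (lt_trans h)//; lra.
  have h2 : `|F x - F y| < e / 2.
    apply: Hd; split=> // i j; have := xx' i j; rewrite /ball/= (ord1 j) => h.
    rewrite (_ : x i 0 - y i 0 = (x i 0 - x' i 0) - (y i 0 - x' i 0)); last by ring.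
    by rewrite (le_lt_trans (ler_normB _ _))//; have := yx' i; lra.
  rewrite (_ : F y - F x' = (F x - F x') - (F x - F y)); last by ring.
  by rewrite (le_trans (ler_normB _ _))//; lra.
exists (d / 2); first by rewrite divr_gt0.
move=> x y cx yx; apply: (Hd (d / 2)) => //=; last by rewrite divr_gt0.
by rewrite sub0r normrN gtr0_norm ?divr_gt0//; lra.
Qed.

Lemma bernstein_approx (F : 'cV[R]_k -> R) (B e : R) : continuous F ->
  (forall x, `|F x| <= B) -> 0 < e ->
  exists2 m : nat, (0 < m)%N & forall x, in_cube x -> `|bern_op m F x - F x| <= e.
Proof.
move=> cF FB e0.
have B0 : 0 <= B by rewrite (le_trans _ (FB 0)).
have e20 : 0 < e / 2 by rewrite divr_gt0.
have [d d0 Hd] := cube_unif_cont cF e20.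
(* If some coordinates of x and y differ by at least d, the quadratic term alone reaches 2 B, the
   largest possible value of |F y - F x|. *)
pose K := 2 * B / d ^+ 2.
have K0 : 0 <= K by rewrite divr_ge0 ?mulr_ge0 ?exprn_ge0// ltW.
have modulus x y : in_cube x -> `|F y - F x| <= e / 2 + K * \sum_j (y j 0 - x j 0) ^+ 2.
  move=> cx; have [yx|] := pselect (forall j, `|y j 0 - x j 0| < d).
    rewrite (le_trans (Hd x y cx yx))// lerDl mulr_ge0// sumr_ge0// => j _; exact: sqr_ge0.
  move=> /existsNP[j /negP]; rewrite -leNgt => dj.
  apply: ler_wpDl; first exact: ltW.
  apply: (@le_trans _ _ (2 * B)).
    by rewrite (le_trans (ler_normB _ _))//; have := FB x; have := FB y; lra.
  apply: (@le_trans _ _ (K * (y j 0 - x j 0) ^+ 2)).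
    rewrite /K mulrAC ler_pdivlMr ?exprn_gt0// ler_wpM2l ?mulr_ge0//.
    by rewrite -[leRHS]real_normK ?num_real// lerXn2r// nnegrE (ltW d0).
  rewrite ler_wpM2l// (bigD1 j)//= lerDl sumr_ge0// => i _; exact: sqr_ge0.
exists (Num.trunc (2 * K * k%:R / e)).+1 => // x cx.
have := truncnS_gt (2 * K * k%:R / e); set m := (Num.trunc (2 * K * k%:R / e)).+1 => mK.
have mR : (0 : R) < m%:R by rewrite ltr0n.
apply: le_trans (bern_op_approx (e := e / 2) (K := K) _ cx K0 _) _ => //.
  by move=> y _; exact: modulus.
have : K * (k%:R / m%:R) <= e / 2.
  rewrite mulrA ler_pdivrMr//.
  by move: mK; rewrite ltr_pdivrMr//; lra.
by lra.
Qed.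

End Bernstein.

(** * From the cube to trigonometric polynomials on a box *)

Section TrigApprox.
Variables (R : realType) (k : nat).

Lemma trig_poly_bern m (s : R) (i : nat) (j : 'I_k) :
  trig_poly (fun x : 'cV[R]_k => bern m ((1 + sin (s * x j 0)) / 2) i).
Proof.
elim: m i => [|m IH] i /=; first exact: trig_poly_cst.
have tt : trig_poly (fun x : 'cV[R]_k => (1 + sin (s * x j 0)) / 2).
  have := trig_polyM (trig_polyD (trig_poly_cst k 1) (trig_poly_sin s j)) (trig_poly_cst k 2^-1).
  exact.
apply: trig_polyD.
  apply: trig_polyM; last exact: IH.
  apply: (trig_poly_ext _ (trig_polyD (trig_poly_cst k 1) (trig_polyM (trig_poly_cst k (- 1)) tt))) => x.
  by rewrite mulN1r.
case: i => [|i]; first exact: trig_poly_cst.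
exact: trig_polyM.
Qed.

(** Inverts y -> (1 + sin y) / 2 on |y| <= 1/2; clamping extends it continuously to the line,
    keeping away from the endpoints of the domain of asin. *)
Definition asin_clamp (t : R) : R := asin (clamp 2^-1 (2 * t - 1)).

Lemma continuous_asin_clamp : continuous asin_clamp.
Proof.
have cc : continuous (fun t : R => clamp 2^-1 (2 * t - 1)).
  have c1 : continuous (fun t : R => 2 * t - 1).
    by move=> t; apply: cvgB; [apply: cvgMr; exact: cvg_id|exact: cvg_cst].
  move=> t; apply: (@continuous_max R R (cst (- 2^-1)) ((fun t => 2 * t - 1) \min cst 2^-1)).
    exact: cvg_cst.
  by apply: (@continuous_min R R (fun t => 2 * t - 1)); [exact: c1|exact: cvg_cst].
move=> t; apply: (@continuous_comp _ _ _ (fun t : R => clamp 2^-1 (2 * t - 1)) asin).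
  exact: cc.
apply: continuous_asin; rewrite -ltr_norml.
by rewrite (le_lt_trans (clamp_le _ _))//; lra.
Qed.

Lemma asin_clamp_sin (y : R) : `|y| <= 2^-1 -> asin_clamp ((1 + sin y) / 2) = y.
Proof.
move=> y2; rewrite /asin_clamp.
have -> : 2 * ((1 + sin y) / 2) - 1 = sin y by field.
have sy : `|sin y| <= 2^-1 by rewrite (le_trans (sin_le_norm y)).
have /andP[s1 s2] : - 2^-1 <= sin y <= 2^-1 by rewrite -ler_norml.
rewrite /clamp (min_idPl s2) (max_idPr s1) sinK// in_itv/= -ler_norml.
by rewrite (le_trans y2)// (le_trans _ (pihalf_ge1 R))//; lra.
Qed.

(* The substitution y_j = (1 + sin (s x_j)) / 2, injective on the box, carries Bernstein
   polynomials on the unit cube to trigonometric polynomials. *)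
Lemma trig_approx (f : 'cV[R]_k -> R) (B r e : R) : continuous f ->
  (forall x, `|f x| <= B) -> 0 < r -> 0 < e ->
  exists g : 'cV[R]_k -> R, [/\ trig_poly g, (forall x, `|g x| <= B) &
    forall x : 'cV[R]_k, (forall j, `|x j 0| <= r) -> `|g x - f x| <= e].
Proof.
(* This scale sends the box |x_j| <= r into |s x_j| <= 1/2, where [asin_clamp] undoes the
   substitution. *)
move=> cf fB r0 e0; pose s := (2 * r)^-1.
have s0 : 0 < s by rewrite invr_gt0 mulr_gt0.
pose F (y : 'cV[R]_k) := f (\col_j (s^-1 * asin_clamp (y j 0))).
have cF : continuous F.
  move=> y; apply: (@continuous_comp _ _ _ (fun y : 'cV[R]_k => \col_j (s^-1 * asin_clamp (y j 0)) : 'cV[R]_k) f); last exact: cf.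
  apply: (@continuous_mx R 'cV[R]_k) => i j; under eq_fun do rewrite mxE.
  apply: (@continuousZR 'cV[R]_k).
  apply: (@continuous_compR 'cV[R]_k); first exact: continuous_asin_clamp.
  exact: (@coord_continuous R k 1 i 0).
have FB y : `|F y| <= B by exact: fB.
have [m m0 Hm] := bernstein_approx cF FB e0.
pose c (x : 'cV[R]_k) : 'cV[R]_k := \col_j ((1 + sin (s * x j 0)) / 2).
have cc x : in_cube (c x).
  move=> j; rewrite mxE; have := sin_geN1 (s * x j 0); have := sin_le1 (s * x j 0) => h1 h2.
  by apply/andP; split; lra.
exists (fun x => bern_op m F (c x)); split.
- apply: trig_poly_sum => kap; apply: trig_polyM; last exact: trig_poly_cst.
  apply: trig_poly_prod => j.
  by apply: (trig_poly_ext _ (trig_poly_bern m s (kap j) j)) => x; rewrite mxE.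
- by move=> x; exact: bern_op_le.
- move=> x xr; have := Hm _ (cc x); rewrite {2}/F.
  rewrite (_ : \col_j _ = x)//; apply/colP => j; rewrite !mxE asin_clamp_sin.
    by rewrite mulKf// gt_eqF.
  rewrite normrM gtr0_norm// /s ler_pdivrMl ?mulr_gt0//.
  by rewrite mulrAC mulrV ?unitfE ?mul1r//; exact: xr.
Qed.

End TrigApprox.

(** * Penalized least squares *)

Section Coercive.
Variable R : realType.

Lemma sqr_sum_le (I : Type) (r : seq I) (x : I -> R) :
  (\sum_(i <- r) x i) ^+ 2 <= 2 ^+ size r * \sum_(i <- r) x i ^+ 2.
Proof.
elim: r => [|i r IH]; first by rewrite !big_nil expr0n mulr0.
rewrite !big_cons /= [2 ^+ _.+1]exprS.
set S := \sum_(j <- r) x j in IH *; set Q := \sum_(j <- r) _ in IH *.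
have h : 1 <= 2 ^+ size r :> R by rewrite exprn_ege1// ler1n.
set c := 2 ^+ size r in IH h *.
have : 0 <= (c - 1) * x i ^+ 2 by rewrite mulr_ge0 ?sqr_ge0 ?subr_ge0.
have := sqr_ge0 (x i - S); nra.
Qed.

(** A substitute for the smallest eigenvalue: with C = L L^T the form is |L^T u|^2, and u is
    recovered from L^T u by a fixed matrix whose entries bound the loss. *)
Lemma posdef_coercive p (C : 'M[R]_p) : posdef C ->
  exists2 lam : R, 0 < lam & forall u : 'cV[R]_p,
    lam * \sum_j u j 0 ^+ 2 <= (u^T *m C *m u) 0 0.
Proof.
move=> /gaussian_cholesky[L [uL -> _]].
pose B : 'M[R]_p := invmx L^T; pose K : R := 1 + \sum_j \sum_i 2 ^+ p * B j i ^+ 2.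
have uLT : L^T \in unitmx by rewrite unitmx_tr.
have K0 : 0 < K.
  rewrite ltr_pwDl// sumr_ge0// => j _; rewrite sumr_ge0// => i _.
  by rewrite mulr_ge0 ?sqr_ge0 ?exprn_ge0.
exists K^-1; first by rewrite invr_gt0.
move=> u; rewrite ler_pdivrMl//.
pose y := L^T *m u.
have uE : u = B *m y by rewrite /y mulKmx.
have -> : (u^T *m (L *m L^T) *m u) 0 0 = \sum_i y i 0 ^+ 2.
  rewrite mulmxA -mulmxA -[L in u^T *m L]trmxK -trmx_mul -/y mxE.
  by apply: eq_bigr => i _; rewrite mxE expr2.
have Q0 : 0 <= \sum_i y i 0 ^+ 2 by rewrite sumr_ge0// => i _; exact: sqr_ge0.
rewrite /K mulrDl mul1r; apply: ler_wpDl => //.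
rewrite mulr_suml; apply: ler_sum => j _.
rewrite {1}uE mxE (le_trans (sqr_sum_le _ _))//.
rewrite (_ : size _ = p); last by rewrite /index_enum -enumT unlock size_enum_ord.
rewrite mulr_sumr mulr_suml; apply: ler_sum => i _.
have c0 : 0 <= 2 ^+ p * B j i ^+ 2.
  by apply: mulr_ge0; [exact: exprn_ge0|exact: sqr_ge0].
rewrite exprMn mulrA ler_wpM2l//.
by rewrite (bigD1 i)//= lerDl sumr_ge0// => l _; exact: sqr_ge0.
Qed.

(** With k = a / lam, summing 2 k |u_i| <= k^2 + u_i^2 turns the hypothesis into |u|^2 <= p k^2;
    then p <= (p + 1)^2 avoids a square root. *)
Lemma norm_le_of_quad p (u : 'cV[R]_p) (a lam : R) : 0 < lam -> 0 <= a ->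
  lam * \sum_j u j 0 ^+ 2 <= a * \sum_j `|u j 0| ->
  forall j, `|u j 0| <= a * (p%:R + 1) / lam.
Proof.
move=> l0 a0 H j.
have [a00|an0] := eqVneq a 0.
  move: H; rewrite a00 !mul0r (bigD1 j)//= => H.
  have s0 : 0 <= \sum_(i < p | i != j) u i 0 ^+ 2 by rewrite sumr_ge0// => i _; exact: sqr_ge0.
  have : u j 0 ^+ 2 <= 0 by have := sqr_ge0 (u j 0); nra.
  move=> h; have : u j 0 ^+ 2 == 0 by rewrite eq_le h sqr_ge0.
  by rewrite sqrf_eq0 => /eqP ->; rewrite normr0.
have ap : 0 < a by rewrite lt0r an0.
pose k := a / lam; have k0 : 0 < k by rewrite divr_gt0.
have p0 : 0 <= p%:R :> R by [].
pose Q := \sum_j u j 0 ^+ 2.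
have HQ : Q <= p%:R * k ^+ 2.
  have HS : 2 * k * \sum_j `|u j 0| <= p%:R * k ^+ 2 + Q.
    have -> : p%:R * k ^+ 2 = \sum_(i < p) k ^+ 2 by rewrite sumr_const card_ord mulr_natl.
    rewrite /Q -big_split/= mulr_sumr.
    by apply: ler_sum => i _; rewrite -[u i 0 ^+ 2]real_normK ?num_real//; have := sqr_ge0 (k - `|u i 0|); nra.
  have aE : a = lam * k by rewrite /k mulrCA divff ?mulr1// gt_eqF.
  rewrite -(ler_pM2l l0); move: H; rewrite -/Q aE; set S := \sum_j `|u j 0| in HS * => H.
  have : lam * (2 * k * S) <= lam * (p%:R * k ^+ 2 + Q) by rewrite ler_wpM2l// ltW.
  by lra.
have uQ : `|u j 0| ^+ 2 <= Q.
  rewrite real_normK ?num_real// /Q (bigD1 j)//= lerDl sumr_ge0// => i _; exact: sqr_ge0.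
rewrite (_ : a * _ / lam = k * (p%:R + 1)); last by rewrite /k; ring.
rewrite -(@ler_pXn2r _ 2)// ?nnegrE//; last by rewrite mulr_ge0 ?addr_ge0// ltW.
rewrite (le_trans uQ)// (le_trans HQ)// [leRHS]exprMn [leRHS]mulrC.
by apply: ler_wpM2r; [exact: sqr_ge0|nra].
Qed.

Lemma quad_sumE p (E : 'M[R]_p) (u : 'cV[R]_p) :
  (u^T *m E *m u) 0 0 = \sum_j \sum_i u i 0 * E i j * u j 0.
Proof.
rewrite mxE; apply: eq_bigr => j _; rewrite mxE mulr_suml.
by apply: eq_bigr => i _; rewrite mxE.
Qed.

Lemma quad_perturb p (C D : 'M[R]_p) (lam delta : R) (u : 'cV[R]_p) :
  lam * \sum_j u j 0 ^+ 2 <= (u^T *m C *m u) 0 0 ->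
  (forall i j, `|D i j - C i j| <= delta) ->
  (lam - delta * p%:R) * \sum_j u j 0 ^+ 2 <= (u^T *m D *m u) 0 0.
Proof.
move=> HC HD.
suff : - (delta * p%:R * \sum_j u j 0 ^+ 2) <= (u^T *m (D - C) *m u) 0 0.
  rewrite mulmxBr mulmxBl [X in _ <= X]mxE [X in _ + X]mxE => h.
  by rewrite mulrBl; lra.
set Q := \sum_j u j 0 ^+ 2.
suff : `|(u^T *m (D - C) *m u) 0 0| <= delta * p%:R * Q.
  by rewrite ler_norml => /andP[].
rewrite quad_sumE; apply: le_trans (ler_norm_sum _ _ _) _.
have -> : delta * p%:R * Q = \sum_(j < p) (delta / 2 * (Q + p%:R * u j 0 ^+ 2)).
  rewrite -mulr_sumr big_split/= sumr_const card_ord -mulr_sumr -/Q -mulr_natl.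
  by field.
apply: ler_sum => j _; apply: le_trans (ler_norm_sum _ _ _) _.
have -> : p%:R * u j 0 ^+ 2 = \sum_(i < p) u j 0 ^+ 2 by rewrite sumr_const card_ord mulr_natl.
rewrite /Q -big_split/= mulr_sumr; apply: ler_sum => i _.
rewrite !normrM -[u i 0 ^+ 2]real_normK ?num_real// -[u j 0 ^+ 2]real_normK ?num_real//.
have : `|(D - C) i j| <= delta by rewrite 2!mxE.
have := normr_ge0 ((D - C) i j); have := normr_ge0 (u i 0); have := normr_ge0 (u j 0).
set x := `|u i 0|; set y := `|u j 0|; set z := `|_| => y0 x0 z0 zd.
have d0 := le_trans z0 zd.
apply: (@le_trans _ _ (delta * (x * y))).
  by rewrite -mulrA mulrCA ler_wpM2r ?mulr_ge0.
rewrite -mulrA ler_wpM2l//; have := sqr_ge0 (x - y); lra.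
Qed.

End Coercive.

(** * Stationarity and size of a minimizer of a penalized quadratic *)

Section PenalizedQuadratic.
Variables (R : realType) (p : nat).
Implicit Types (C : 'M[R]_p) (W u h w : 'cV[R]_p).

Definition quad_obj C W u : R := (u^T *m C *m u) 0 0 - 2 * (u^T *m W) 0 0.

(** In the application h is sqrt n times [bstar], so h + u is the rescaled candidate. Taking h = w =
    0 gives least squares, so the size bound below serves both estimators. *)
Definition pen_obj C W h w u : R := quad_obj C W u + \sum_j w j 0 * `|h j 0 + u j 0|.

Lemma quad_obj_shift C W u j (t : R) : C^T = C ->
  quad_obj C W (u + t *: delta_mx j 0) =
  quad_obj C W u + 2 * t * ((C *m u) j 0 - W j 0) + t ^+ 2 * C j j.
Proof.
move=> sC; rewrite /quad_obj.
set e : 'cV[R]_p := delta_mx j 0.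
have eT : e^T = delta_mx 0 j by rewrite /e trmx_delta.
have e1 (v : 'cV[R]_p) : (e^T *m v) 0 0 = v j 0 by rewrite eT -rowE mxE.
have e2 : (u^T *m C *m e) 0 0 = (C *m u) j 0.
  rewrite -[LHS]/(_ 0 0) -(trmxK (u^T *m C *m e)) mxE !trmx_mul trmxK sC.
  exact: e1.
have e3 : (e^T *m C *m e) 0 0 = C j j.
  by rewrite eT -rowE /e -colE !mxE.
have e4 : (e^T *m C *m u) 0 0 = (C *m u) j 0 by rewrite -mulmxA e1.
have aE (X Y : 'M[R]_(1, 1)) : (X + Y) 0 0 = X 0 0 + Y 0 0 by rewrite mxE.
have sE a (X : 'M[R]_(1, 1)) : (a *: X) 0 0 = a * X 0 0 by rewrite mxE.
have -> : (u + t *: e)^T = u^T + t *: e^T by apply/matrixP => a b; rewrite !mxE.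
rewrite !mulmxDl !mulmxDr -!scalemxAl -!scalemxAr -?scalemxAl.
by rewrite !(aE, sE) e1 e2 e3 e4; ring.
Qed.

(* Stationarity (KKT) conditions, from one-coordinate perturbations of the minimizer. *)
Variables (C : 'M[R]_p) (W h w u : 'cV[R]_p).
Hypothesis sC : C^T = C.
Hypothesis min_u : forall v, pen_obj C W h w u <= pen_obj C W h w v.
Hypothesis w0 : forall j, 0 <= w j 0.

Lemma pen_obj_coord j (t : R) :
  0 <= 2 * t * ((C *m u) j 0 - W j 0) + t ^+ 2 * C j j +
    w j 0 * (`|h j 0 + u j 0 + t| - `|h j 0 + u j 0|).
Proof.
have := min_u (u + t *: delta_mx j 0).
rewrite /pen_obj quad_obj_shift// (bigD1 j)//= [X in _ <= _ + X](bigD1 j)//=.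
have -> : (u + t *: delta_mx j 0 : 'cV[R]_p) j 0 = u j 0 + t.
  by rewrite !mxE !eqxx mulr1.
rewrite [X in _ <= _ + (_ + X)](eq_bigr (fun i => w i 0 * `|h i 0 + u i 0|)); last first.
  by move=> i ij; rewrite !mxE (negbTE ij) mulr0 addr0.
by rewrite (addrA (h j 0)); lra.
Qed.

Lemma pen_obj_grad j : `|2 * ((C *m u) j 0 - W j 0)| <= w j 0.
Proof.
set g := 2 * _.
have H (t : R) : - g * t <= `|t| * (`|t| * `|C j j| + w j 0).
  have := pen_obj_coord j t; rewrite (_ : 2 * t * _ = g * t); last by rewrite /g; ring.
  have tri : `|h j 0 + u j 0 + t| - `|h j 0 + u j 0| <= `|t|.
    by rewrite lerBlDl (le_trans (ler_normD _ _)).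
  have := ler_wpM2l (w0 j) tri.
  have : t ^+ 2 * C j j <= `|t| ^+ 2 * `|C j j|.
    by rewrite real_normK ?num_real// ler_wpM2l ?sqr_ge0// ler_norm.
  lra.
apply/ler_addgt0Pl => e e0.
(* The step is short enough for the curvature term to cost at most e; steps t and - t give the two
   sides of the bound. *)
pose t := e / (`|C j j| + 1).
have c1 : 0 < `|C j j| + 1 by rewrite ltr_wpDl.
have t0 : 0 < t by rewrite divr_gt0.
have te : t * `|C j j| <= e.
  by rewrite /t mulrAC ler_pdivrMr// ler_wpM2l ?ltW// ltrDl.
have H1 := H t; have H2 := H (- t).
rewrite normrN (gtr0_norm t0) in H1 H2.
by rewrite ler_norml; apply/andP; split; rewrite -(ler_pM2l t0); nra.
Qed.

(** The competitor sets coordinate j to zero and saves w_j |u_j|, which by minimality cannot exceed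
    the change of the quadratic part. Read contrapositively, a large weight forces the coordinate to
    vanish. *)
Lemma pen_obj_zero j : h j 0 = 0 -> u j 0 != 0 ->
  w j 0 <= 2 * `|(C *m u) j 0 - W j 0| + `|u j 0| * `|C j j|.
Proof.
move=> h0 u0; have un : 0 < `|u j 0| by rewrite normr_gt0.
have := pen_obj_coord j (- u j 0); rewrite h0 !add0r subrr normr0 sub0r sqrrN.
have : - u j 0 * ((C *m u) j 0 - W j 0) <= `|u j 0| * `|(C *m u) j 0 - W j 0|.
  by rewrite (le_trans (ler_norm _))// normrM normrN.
have : u j 0 ^+ 2 * C j j <= `|u j 0| ^+ 2 * `|C j j|.
  by rewrite real_normK ?num_real// ler_wpM2l ?sqr_ge0// ler_norm.
move=> a1 a2 a3; rewrite -(ler_pM2l un); nra.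
Qed.

(** The competitor is u = 0, the true parameter. Where h vanishes its penalty is zero, so only
    weights with h nonzero enter, and the large weights elsewhere do no harm. *)
Lemma pen_obj_size (M d : R) : (forall j, `|W j 0| <= M) ->
  (forall j, h j 0 != 0 -> w j 0 <= d) -> 0 <= d ->
  (u^T *m C *m u) 0 0 <= (2 * M + d) * \sum_j `|u j 0|.
Proof.
move=> WM wd d0; have := min_u 0.
rewrite /pen_obj /quad_obj trmx0 !mul0mx !mxE mulr0 subrr add0r.
have -> : \sum_j w j 0 * `|h j 0 + (0 : 'cV[R]_p) j 0| = \sum_j w j 0 * `|h j 0|.
  by apply: eq_bigr => j _; rewrite mxE addr0.
set q := \sum_j _ * u j 0.
have : \sum_j w j 0 * `|h j 0| - \sum_j w j 0 * `|h j 0 + u j 0| <= d * \sum_j `|u j 0|.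
  rewrite -sumrB mulr_sumr; apply: ler_sum => j _.
  rewrite -mulrBr; have [hj|hj] := eqVneq (h j 0) 0.
    rewrite hj add0r normr0 sub0r.
    have := w0 j; have := normr_ge0 (u j 0); nra.
  have tri : `|h j 0| - `|h j 0 + u j 0| <= `|u j 0|.
    rewrite lerBlDl; rewrite (_ : `|h j 0| = `|h j 0 + u j 0 - u j 0|); last by rewrite addrK.
    exact: ler_normB.
  have := wd j hj; have := w0 j; have := normr_ge0 (u j 0); nra.
have : \sum_j u^T 0 j * W j 0 <= M * \sum_j `|u j 0|.
  rewrite mulr_sumr; apply: ler_sum => j _.
  rewrite mxE (le_trans (ler_norm _))// normrM mulrC ler_wpM2r//.
lra.
Qed.

End PenalizedQuadratic.

Section Submatrix.
Variables (R : realType) (p : nat) (A : {set 'I_p}).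

(** Restriction to A as a matrix, turning subvectors and principal submatrices into products. *)
Definition sel_mx : 'M[R]_(#|A|, p) := \matrix_(i, j) (enum_val i == j)%:R.

Lemma sel_mxE n (v : 'M[R]_(p, n)) i j : (sel_mx *m v) i j = v (enum_val i) j.
Proof.
rewrite mxE (bigD1 (enum_val i))//= mxE eqxx mul1r big1 ?addr0// => l li.
by rewrite mxE eq_sym (negbTE li) mul0r.
Qed.

Lemma subcolE (v : 'cV[R]_p) : subcol A v = sel_mx *m v.
Proof. by apply/matrixP => i j; rewrite sel_mxE mxE ord1. Qed.

Lemma principal_submxE (C : 'M[R]_p) : principal_submx A C = sel_mx *m C *m sel_mx^T.
Proof.
apply/matrixP => i j; rewrite -mulmxA sel_mxE !mxE (bigD1 (enum_val j))//=.
rewrite !mxE eqxx mulr1 big1 ?addr0// => l lj.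
by rewrite !mxE eq_sym (negbTE lj) mulr0.
Qed.

Lemma sel_mxK : sel_mx *m sel_mx^T = 1%:M.
Proof.
apply/matrixP => i j; rewrite sel_mxE !mxE.
by rewrite (inj_eq enum_val_inj) eq_sym.
Qed.

Lemma posdef_principal_submx (C : 'M[R]_p) : posdef C -> posdef (principal_submx A C).
Proof.
move=> [sC HC]; split; first by rewrite principal_submxE !trmx_mul trmxK sC mulmxA.
move=> u u0; have v0 : u *m sel_mx != 0.
  by apply: contra_neq u0 => h; rewrite -[u]mulmx1 -sel_mxK mulmxA h mul0mx.
by have := HC _ v0; rewrite principal_submxE trmx_mul !mulmxA.
Qed.

Lemma sel_mx_supp (u : 'cV[R]_p) : (forall j, j \notin A -> u j 0 = 0) ->
  sel_mx^T *m (sel_mx *m u) = u.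
Proof.
move=> uA; apply/colP => j; rewrite mxE.
have [jA|jA] := boolP (j \in A).
  rewrite (bigD1 (enum_rank_in jA j))//= sel_mxE !mxE enum_rankK_in// eqxx mul1r.
  rewrite big1 ?addr0// => i ij; rewrite !mxE [_ == j](_ : _ = false) ?mul0r//.
  by apply: contra_neqF ij => /eqP ij; apply: enum_val_inj; rewrite enum_rankK_in.
rewrite uA// big1// => i _; rewrite !mxE [_ == j](_ : _ = false) ?mul0r//.
by apply: contraNF jA => /eqP <-; exact: enum_valP.
Qed.

End Submatrix.

Lemma posdef_unitmx (R : realType) p (C : 'M[R]_p) : posdef C -> C \in unitmx.
Proof.
by move=> /gaussian_cholesky[L [uL -> _]]; rewrite unitmx_mul unitmx_tr uL.
Qed.

Lemma mulmx_norm_le (R : realType) m p (B : 'M[R]_(m, p)) (v : 'cV[R]_p) (rho : R) i :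
  0 <= rho -> (forall j, `|v j 0| <= rho) ->
  `|(B *m v) i 0| <= (\sum_i \sum_j `|B i j|) * rho.
Proof.
move=> r0 vr; rewrite mxE (le_trans (ler_norm_sum _ _ _))//.
rewrite mulr_suml (bigD1 i)//= ler_wpDr//.
  by rewrite sumr_ge0// => l _; rewrite mulr_ge0// sumr_ge0.
by rewrite mulr_suml; apply: ler_sum => j _; rewrite normrM ler_wpM2l.
Qed.

Lemma mulmx_norm_le_const (R : realType) m p (B : 'M[R]_(m, p)) (v : 'cV[R]_p) (beta rho : R) i :
  (forall i j, `|B i j| <= beta) -> (forall j, `|v j 0| <= rho) ->
  `|(B *m v) i 0| <= p%:R * (beta * rho).
Proof.
move=> Bb vr; rewrite mxE (le_trans (ler_norm_sum _ _ _))//.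
rewrite (_ : p%:R * _ = \sum_(j < p) beta * rho); last by rewrite sumr_const card_ord mulr_natl.
by apply: ler_sum => j _; rewrite normrM ler_pM.
Qed.

(** * The rescaled regression problem and its deterministic analysis *)

Section Regression.
Variables (R : realType) (p : nat) (bstar : 'cV[R]_p) (x : nat -> 'rV[R]_p).

Definition gram n : 'M[R]_p := n%:R^-1 *: ((design x n)^T *m design x n).
Definition noise (e : nat -> R) n : 'cV[R]_p :=
  (Num.sqrt n%:R)^-1 *: ((design x n)^T *m \col_(i < n) e i).

Lemma tr_gram n : (gram n)^T = gram n.
Proof. by rewrite /gram linearZ/= trmx_mul trmxK. Qed.

Lemma responseE e n : response x bstar e n = design x n *m bstar + \col_(i < n) e i.
Proof.
apply/colP => i; rewrite !mxE; congr (_ + _).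
by apply: eq_bigr => j _; rewrite mxE.
Qed.

Lemma rss_scaled e n (b : 'cV[R]_p) : (0 < n)%N ->
  rss (design x n) (response x bstar e n) b =
  \sum_(i < n) e i ^+ 2 +
  quad_obj (gram n) (noise e n) (Num.sqrt n%:R *: (b - bstar)).
Proof.
move=> n0; set s : R := Num.sqrt n%:R; set X := design x n.
pose v := \col_(i < n) e i; pose u : 'cV[R]_p := b - bstar.
have s0 : s != 0 by rewrite sqrtr_eq0 -ltNge ltr0n.
have s2 : s ^+ 2 = n%:R by rewrite sqr_sqrtr.
rewrite /rss /quad_obj responseE -/X -/v -/u.
have -> : X *m bstar + v - X *m b = v - X *m u.
  by rewrite /u mulmxBr opprB addrA [v + _]addrC.
clearbody u.
have tE (Y : 'M[R]_(1, 1)) : Y 0 0 = Y^T 0 0 by rewrite mxE.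
have aE (Y Z : 'M[R]_(1, 1)) : (Y + Z) 0 0 = Y 0 0 + Z 0 0 by rewrite mxE.
have nE (Y : 'M[R]_(1, 1)) : (- Y) 0 0 = - Y 0 0 by rewrite mxE.
have sE a (Y : 'M[R]_(1, 1)) : (a *: Y) 0 0 = a * Y 0 0 by rewrite mxE.
have -> : (v - X *m u)^T = v^T - u^T *m X^T.
  by rewrite -trmx_mul; apply/matrixP => i j; rewrite !mxE.
have -> : (s *: u)^T = s *: u^T by apply/matrixP => i j; rewrite !mxE.
rewrite /gram /noise -/X -/v -/s !mulmxBl !mulmxBr -!scalemxAl -!scalemxAr -?scalemxAl.
rewrite !(aE, nE, sE) opprD opprK.
have -> : (v^T *m v) 0 0 = \sum_(i < n) e i ^+ 2.
  by rewrite mxE; apply: eq_bigr => i _; rewrite !mxE expr2.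
have -> : (v^T *m (X *m u)) 0 0 = (u^T *m X^T *m v) 0 0.
  by rewrite tE !trmx_mul trmxK.
have sn : s * (n%:R^-1 * s) = 1 by rewrite mulrCA -expr2 s2 mulVf// pnatr_eq0 -lt0n.
rewrite !mulmxA.
set a := (u^T *m X^T *m v) 0 0; set b' := (u^T *m X^T *m X *m u) 0 0.
have -> : s * (s * (n%:R^-1 * b')) = b'.
  by transitivity (s * (n%:R^-1 * s) * b'); [ring|rewrite sn mul1r].
by rewrite mulVKf//; ring.
Qed.

(** The factor 1 / sqrt n comes from writing the penalty in the rescaled coefficients. *)
Definition gdp_weight (n : nat) (alpha eta : R) (b0 : 'cV[R]_p) : 'cV[R]_p :=
  \col_j (alpha / (Num.sqrt n%:R * (`|b0 j 0| + eta))).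

Lemma gdp_obj_scaled e n (alpha eta : R) (b0 b : 'cV[R]_p) : (0 < n)%N ->
  gdp_os_obj (design x n) (response x bstar e n) b0 alpha eta b =
  \sum_(i < n) e i ^+ 2 +
  pen_obj (gram n) (noise e n) (Num.sqrt n%:R *: bstar) (gdp_weight n alpha eta b0)
    (Num.sqrt n%:R *: (b - bstar)).
Proof.
move=> n0; rewrite /gdp_os_obj rss_scaled// /pen_obj -addrA; congr (_ + (_ + _)).
rewrite mulr_sumr; apply: eq_bigr => j _; rewrite !mxE.
have s0 : 0 < Num.sqrt n%:R :> R by rewrite sqrtr_gt0 ltr0n.
rewrite -mulrDr (addrC (bstar _ _)) subrK normrM gtr0_norm// invfM.
set d := (`|b0 j 0| + eta)^-1.
by field; rewrite gt_eqF.
Qed.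

Definition is_ls e n (b0 : 'cV[R]_p) := forall b,
  rss (design x n) (response x bstar e n) b0 <= rss (design x n) (response x bstar e n) b.

Definition is_gdp e n (alpha eta : R) (b0 b1 : 'cV[R]_p) := forall b,
  gdp_os_obj (design x n) (response x bstar e n) b0 alpha eta b1 <=
  gdp_os_obj (design x n) (response x bstar e n) b0 alpha eta b.

Lemma rescale (s : R) (b v : 'cV[R]_p) : s != 0 -> s *: (bstar + s^-1 *: v - bstar) = v.
Proof. by move=> s0; rewrite addrC addKr scalerA divff// scale1r. Qed.

Lemma ls_minimizes e n b0 : (0 < n)%N -> is_ls e n b0 -> forall v,
  pen_obj (gram n) (noise e n) 0 0 (Num.sqrt n%:R *: (b0 - bstar)) <=
  pen_obj (gram n) (noise e n) 0 0 v.
Proof.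
move=> n0 H v.
have s0 : Num.sqrt n%:R != 0 :> R by rewrite sqrtr_eq0 -ltNge ltr0n.
have := H (bstar + (Num.sqrt n%:R)^-1 *: v).
rewrite !rss_scaled// rescale// lerD2l /pen_obj.
have pen0 u : \sum_j (0 : 'cV[R]_p) j 0 * `|(0 : 'cV[R]_p) j 0 + u j 0| = 0.
  by apply: big1 => j _; rewrite mxE mul0r.
by rewrite !pen0 !addr0.
Qed.

Lemma gdp_minimizes e n alpha eta b0 b1 : (0 < n)%N -> is_gdp e n alpha eta b0 b1 -> forall v,
  pen_obj (gram n) (noise e n) (Num.sqrt n%:R *: bstar) (gdp_weight n alpha eta b0)
    (Num.sqrt n%:R *: (b1 - bstar)) <=
  pen_obj (gram n) (noise e n) (Num.sqrt n%:R *: bstar) (gdp_weight n alpha eta b0) v.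
Proof.
move=> n0 H v.
have s0 : Num.sqrt n%:R != 0 :> R by rewrite sqrtr_eq0 -ltNge ltr0n.
have := H (bstar + (Num.sqrt n%:R)^-1 *: v).
by rewrite !gdp_obj_scaled// rescale// lerD2l.
Qed.

Let A := finset (fun j : 'I_p => bstar j 0 != 0).

(* The estimator at a fixed n on the event |noise| <= M: K0 and K1 bound the rescaled errors of
   the least squares and of the penalized estimator, d bounds the weights on A. *)
Lemma gdp_fixed_n (C : 'M[R]_p) (lam M d K0 K1 beta rho : R) e n (alpha eta c : R) b0 b1 :
  (0 < n)%N -> 0 < alpha -> 0 < eta -> 0 < lam -> 0 <= M -> 0 <= d ->
  principal_submx A C \in unitmx ->
  (forall u : 'cV[R]_p, lam * \sum_j u j 0 ^+ 2 <= (u^T *m gram n *m u) 0 0) ->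
  (forall i j, `|gram n i j| <= beta) ->
  (forall i j, `|(C - gram n) i j| <= rho) ->
  K0 = 2 * M * (p%:R + 1) / lam -> K1 = (2 * M + d) * (p%:R + 1) / lam ->
  (forall j, j \in A -> K0 <= Num.sqrt n%:R * `|bstar j 0| / 2) ->
  (forall j, j \in A -> K1 < Num.sqrt n%:R * `|bstar j 0|) ->
  (forall j, j \in A -> alpha / Num.sqrt n%:R * (2 / `|bstar j 0|) <= d) ->
  eta * Num.sqrt n%:R <= c ->
  (K0 + c) * (2 * (p%:R * (beta * K1) + M) + K1 * beta) < alpha ->
  is_ls e n b0 -> is_gdp e n alpha eta b0 b1 ->
  (forall j, `|noise e n j 0| <= M) ->
  finset (fun j : 'I_p => b1 j 0 != 0) = A /\
  forall i, `|(Num.sqrt n%:R *: (subcol A b1 - subcol A bstar) -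
     invmx (principal_submx A C) *m subcol A (noise e n)) i 0| <=
    (\sum_i \sum_j `|invmx (principal_submx A C) i j|) * (d + p%:R * (rho * K1)).
Proof.
move=> n0 a0 eta0 l0 M0 d0 uC Hlam Hbeta Hrho K0E K1E HK0 HK1 Hd Hc Halpha Hls Hgdp HM.
set s : R := Num.sqrt n%:R in HK0 HK1 Hd Hc *.
have s0 : 0 < s by rewrite sqrtr_gt0 ltr0n.
have s_neq0 : s != 0 by rewrite gt_eqF.
pose v : 'cV[R]_p := s *: (b0 - bstar); pose u : 'cV[R]_p := s *: (b1 - bstar).
have vE j : b0 j 0 = bstar j 0 + s^-1 * v j 0.
  by rewrite !mxE mulKf//; ring.
have uE j : b1 j 0 = bstar j 0 + s^-1 * u j 0.
  by rewrite !mxE mulKf//; ring.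
have p1 : 0 < p%:R + 1 :> R by rewrite ltr_wpDl.
have vK j : `|v j 0| <= K0.
  rewrite K0E; apply: norm_le_of_quad => //; first by rewrite mulr_ge0.
  apply: le_trans (Hlam v) _.
  have := pen_obj_size (ls_minimizes n0 Hls) _ HM _ (lexx 0); rewrite addr0; apply.
  - by move=> j'; rewrite mxE.
  - by move=> j' _; rewrite mxE.
pose w := gdp_weight n alpha eta b0.
have w0 j : 0 <= w j 0.
  by rewrite mxE divr_ge0 ?mulr_ge0 ?addr_ge0// ?(ltW a0) ?(ltW eta0)// ltW.
have wA j : j \in A -> w j 0 <= d.
  move=> jA; apply: le_trans (Hd j jA).
  have bj : 0 < `|bstar j 0| by rewrite normr_gt0; move: jA; rewrite inE.
  rewrite mxE -/s invfM mulrA ler_wpM2l ?divr_ge0 ?(ltW a0) ?(ltW s0)//.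
  rewrite -[2 / _]invf_div lef_pV2 ?posrE ?divr_gt0 ?ltr_wpDl//.
  (* The least squares error is at most half of the true coefficient, so its weight on A is at most
     the weight at half that coefficient. *)
  have : `|bstar j 0| / 2 <= `|b0 j 0|.
    have h1 : `|s^-1 * v j 0| <= `|bstar j 0| / 2.
      rewrite normrM gtr0_norm ?invr_gt0// ler_pdivrMl// mulrA.
      exact: le_trans (vK j) (HK0 j jA).
    have h2 : `|bstar j 0| <= `|b0 j 0| + `|s^-1 * v j 0|.
      rewrite (_ : bstar j 0 = b0 j 0 - s^-1 * v j 0); last by rewrite vE addrK.
      exact: ler_normB.
    lra.
  by move=> h; rewrite (le_trans h)// lerDl ltW.
have hE j : (s *: bstar) j 0 = s * bstar j 0 by rewrite mxE.
have min_u := gdp_minimizes n0 Hgdp.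
have K1' j : `|u j 0| <= K1.
  rewrite K1E; apply: norm_le_of_quad => //; first by rewrite addr_ge0// mulr_ge0.
  apply: le_trans (Hlam u) _.
  apply: (pen_obj_size min_u w0 HM _ d0) => j'.
  rewrite hE mulf_eq0 (negbTE s_neq0)/= => h; apply: wA; by rewrite inE.
have grad j : `|(gram n *m u) j 0 - noise e n j 0| <= d \/ j \notin A.
  have [jA|jA] := boolP (j \in A); [left|by right].
  have := pen_obj_grad (tr_gram n) min_u w0 j; have := wA j jA.
  rewrite normrM ger0_norm//; have := normr_ge0 ((gram n *m u) j 0 - noise e n j 0); lra.
have K10 : 0 <= K1 by rewrite K1E divr_ge0 ?mulr_ge0 ?addr_ge0 ?mulr_ge0// ltW.
have K00 : 0 <= K0 by rewrite K0E divr_ge0 ?mulr_ge0// ltW.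
(* Off A the least squares coefficient is pure error, so the denominator of the weight is at most K0
   + c. A nonzero u_j would bound the weight by [Big], hence alpha by (K0 + c) [Big], against the
   assumption on alpha. *)
have u0 j : j \notin A -> u j 0 = 0.
  rewrite inE negbK => /eqP bj; apply/eqP; apply: contraT => uj.
  have hj : (s *: bstar) j 0 = 0 by rewrite hE bj mulr0.
  have := pen_obj_zero (tr_gram n) min_u hj uj.
  have g1 : `|(gram n *m u) j 0| <= p%:R * (beta * K1) by exact: mulmx_norm_le_const.
  have g2 : `|(gram n *m u) j 0 - noise e n j 0| <= p%:R * (beta * K1) + M.
    by rewrite (le_trans (ler_normB _ _))// lerD.
  have g3 : `|u j 0| * `|gram n j j| <= K1 * beta by rewrite ler_pM.
  set Big := 2 * (p%:R * (beta * K1) + M) + K1 * beta in Halpha.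
  move=> wB; have {}wB : w j 0 <= Big by rewrite /Big; lra.
  have den : 0 < s * (`|b0 j 0| + eta) by rewrite mulr_gt0// ltr_wpDl.
  have denle : s * (`|b0 j 0| + eta) <= K0 + c.
    rewrite mulrDr lerD//; last by rewrite mulrC.
    by rewrite vE bj add0r normrM gtr0_norm ?invr_gt0// mulVKf.
  have Big0 : 0 <= Big by exact: le_trans (w0 j) wB.
  move: wB; rewrite mxE -/s ler_pdivrMr// => aB.
  have := ler_wpM2l Big0 denle; lra.
have supp : finset (fun j : 'I_p => b1 j 0 != 0) = A.
  apply/setP => j; rewrite !inE; have [jA|jA] := boolP (j \in A); last first.
    rewrite uE u0// mulr0 addr0; by rewrite inE in jA.
  have bj : bstar j 0 != 0 by rewrite inE in jA.
  (* A vanishing coefficient on A would be a rescaled error of size sqrt n |[bstar] j|, larger than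
     K1. *)
  rewrite bj; apply: contraTneq (HK1 j jA) => b10; rewrite -leNgt.
  have : u j 0 = - (s * bstar j 0).
    by rewrite !mxE b10 sub0r mulrN.
  by move=> uj; have := K1' j; rewrite uj normrN normrM gtr0_norm.
split => // i.
have -> : s *: (subcol A b1 - subcol A bstar) = sel_mx R A *m u.
  by rewrite !subcolE -mulmxBr scalemxAr.
(* Since u vanishes off A, C_A u_A is the restriction of C u. After factoring out the inverse of
   C_A, the residual C u - W on A splits into the stationarity defect, at most d, and the effect of
   C - [gram]. *)
rewrite subcolE -[sel_mx R A *m u](mulKmx uC) -mulmxBr.
have -> : principal_submx A C *m (sel_mx R A *m u) = sel_mx R A *m (C *m u).
  by rewrite principal_submxE -[LHS]mulmxA sel_mx_supp// mulmxA.
rewrite -mulmxBr; apply: mulmx_norm_le => [|j].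
  have r0 : 0 <= p%:R * (rho * K1).
    by rewrite mulr_ge0// mulr_ge0// (le_trans _ (Hrho (enum_val i) (enum_val i))).
  by rewrite addr_ge0.
rewrite sel_mxE; have jA : enum_val j \in A by exact: enum_valP.
have -> : C *m u - noise e n = (gram n *m u - noise e n) + (C - gram n) *m u.
  by rewrite mulmxBl [RHS]addrC addrA subrK.
rewrite mxE [X in X + _]mxE [X in _ + X + _]mxE.
rewrite (le_trans (ler_normD _ _))// lerD//; last exact: mulmx_norm_le_const.
by case: (grad (enum_val j)) => //; rewrite jA.
Qed.

Variables (C : 'M[R]_p) (alpha eta : nat -> R) (c : R).
Hypothesis gram_cvg : forall i j, (fun n => gram n i j) @ \oo --> C i j.
Hypothesis pdC : posdef C.
Hypothesis alpha_gt0 : forall n, 0 < alpha n.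
Hypothesis eta_gt0 : forall n, 0 < eta n.
Hypothesis alpha_oo : alpha @ \oo --> +oo.
Hypothesis alpha_sqrt : (fun n => alpha n / Num.sqrt n%:R) @ \oo --> (0 : R).
Hypothesis eta_sqrt : (fun n => eta n * Num.sqrt n%:R) @ \oo --> c.

Lemma sqrt_natr_cvg : (fun n : nat => Num.sqrt n%:R : R) @ \oo --> +oo.
Proof.
apply/cvgryPge => K; near=> n.
have [K0|K0] := leP K 0; first by rewrite (le_trans K0).
rewrite -(@ler_pXn2r _ 2)// ?nnegrE ?(ltW K0)// sqr_sqrtr//.
by near: n; exact: nbhs_infty_ger.
Unshelve. all: by end_near. Qed.

(** The threshold in n is chosen before e, b0 and b1, so it is the same for all sample points with
    bounded noise. *)
Lemma gdp_eventually (M tau : R) : 0 <= M -> 0 < tau ->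
  \forall n \near \oo, forall e b0 b1,
    is_ls e n b0 -> is_gdp e n (alpha n) (eta n) b0 b1 ->
    (forall j, `|noise e n j 0| <= M) ->
    finset (fun j : 'I_p => b1 j 0 != 0) = A /\
    forall i, `|(Num.sqrt n%:R *: (subcol A b1 - subcol A bstar) -
       invmx (principal_submx A C) *m subcol A (noise e n)) i 0| <= tau.
Proof.
move=> M0 tau0.
have uC : principal_submx A C \in unitmx by apply/posdef_unitmx/posdef_principal_submx.
have [lam0 lam00 Hlam] := posdef_coercive pdC.
(* Half of the coercivity constant of C is given up to absorb the difference between [gram] and
   C. *)
pose lam : R := lam0 / 2; have l0 : 0 < lam by rewrite divr_gt0.
pose K0 := 2 * M * (p%:R + 1) / lam; pose K1' := (2 * M + 1) * (p%:R + 1) / lam.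
have p1 : 0 < p%:R + 1 :> R by rewrite ltr_wpDl.
have K1'0 : 0 < K1' by rewrite divr_gt0// mulr_gt0// ltr_wpDl// mulr_ge0.
pose KB : R := \sum_i \sum_j `|invmx (principal_submx A C) i j|.
have KB0 : 0 <= KB by rewrite sumr_ge0// => i _; rewrite sumr_ge0.
(* The cap 1 bounds K1 by K1', which is free of d; the other entry leaves at most tau / 2 after
   multiplication by KB. *)
pose d : R := Num.min 1 (tau / (2 * (KB + 1))).
have KB1 : 0 < KB + 1 by rewrite ltr_wpDl.
have d0 : 0 < d by rewrite lt_min ltr01 divr_gt0// mulr_gt0.
have d1 : d <= 1 by rewrite ge_min lexx.
have dtau : d <= tau / (2 * (KB + 1)) by rewrite ge_min lexx orbT.
pose K1 := (2 * M + d) * (p%:R + 1) / lam.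
have K1K : K1 <= K1'.
  by rewrite ler_wpM2r ?invr_ge0 ?(ltW l0)// ler_wpM2r ?(ltW p1)// lerD2l.
have K10 : 0 <= K1.
  by rewrite divr_ge0 ?(ltW l0)// mulr_ge0 ?(ltW p1)// addr_ge0 ?mulr_ge0// ltW.
(* The first entry preserves coercivity with constant [lam]; the second keeps the contribution of C
   - [gram] to the final error within tau / 2. *)
pose rho : R := Num.min (lam / (p%:R + 1)) (tau / (2 * (KB + 1) * (p%:R * K1' + 1))).
have pK1 : 0 < p%:R * K1' + 1 by rewrite ltr_wpDl// mulr_ge0// ltW.
have rho0 : 0 < rho by rewrite lt_min !divr_gt0// !mulr_gt0.
pose beta : R := \sum_i \sum_j (`|C i j| + 1).
(* As eta_n sqrt n tends to c, it is eventually at most c + 1. The whole expression is constant in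
   n, so alpha_n exceeds it eventually. *)
pose Big := (K0 + (c + 1)) * (2 * (p%:R * (beta * K1) + M) + K1 * beta).
have near_A (Q : nat -> 'I_p -> Prop) :
    (forall j, j \in A -> \forall n \near \oo, Q n j) ->
    \forall n \near \oo, forall j, j \in A -> Q n j.
  move=> H; apply: filter_forall => j; have [jA|jA] := boolP (j \in A).
    by apply: filterS (H j jA) => n h _.
  by apply: nearW => n h.
have bpos j : j \in A -> 0 < `|bstar j 0| by rewrite inE normr_gt0.
have lin (K a : R) : 0 < a -> \forall n \near \oo, K <= Num.sqrt n%:R * a.
  move=> a1; near=> n; rewrite -ler_pdivrMr//.
  by near: n; move/cvgryPge : sqrt_natr_cvg; exact.
have near_gram (r : R) : 0 < r -> \forall n \near \oo, forall i j, `|(C - gram n) i j| <= r.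
  move=> r0; apply: filter_forall => i; apply: filter_forall => j.
  have /cvgrPdist_le H := @gram_cvg i j.
  by apply: filterS (H r r0) => n h; rewrite 2!mxE.
have c1 : c < c + 1 by rewrite ltrDl.
near=> n.
have Hrho i j : `|(C - gram n) i j| <= rho by move: i j; near: n; exact: near_gram.
have Hgram (u : 'cV[R]_p) : lam * \sum_j u j 0 ^+ 2 <= (u^T *m gram n *m u) 0 0.
  apply: le_trans (quad_perturb (Hlam u) (D := gram n) (delta := rho) _); last first.
    by move=> i j; rewrite distrC; have := Hrho i j; rewrite 2!mxE.
  rewrite ler_wpM2r//; first by rewrite sumr_ge0// => j _; exact: sqr_ge0.
  have : rho * (p%:R + 1) <= lam by rewrite -ler_pdivlMr// ge_min lexx.
  rewrite /lam; lra.
have Hbeta i j : `|gram n i j| <= beta.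
  apply: (@le_trans _ _ (`|C i j| + 1)).
    have : `|(C - gram n) i j| <= 1 by move: i j; near: n; exact: near_gram.
    rewrite (_ : gram n i j = C i j - (C - gram n) i j); last by rewrite [X in _ - X]mxE [X in _ - (_ + X)]mxE; ring.
    by move=> h; rewrite (le_trans (ler_normB _ _))// lerD2l.
  rewrite /beta (bigD1 i)//= ler_wpDr//.
    by rewrite sumr_ge0// => l _; rewrite sumr_ge0// => l' _; rewrite addr_ge0.
  by rewrite (bigD1 j)//= lerDl sumr_ge0// => l _; rewrite addr_ge0.
move=> e b0 b1 Hls Hgdp HM.
have n0 : (0 < n)%N by near: n; exists 1%N.
have HK0 j : j \in A -> K0 <= Num.sqrt n%:R * `|bstar j 0| / 2.
  move: j; near: n; apply: near_A => j jA; under eq_near do rewrite -mulrA.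
  by apply: lin; rewrite divr_gt0// bpos.
have HK1 j : j \in A -> K1 < Num.sqrt n%:R * `|bstar j 0|.
  move=> jA; apply: (@lt_le_trans _ _ (K1 + 1)); first by rewrite ltrDl.
  by move: j jA; near: n; apply: near_A => j jA; apply: lin; exact: bpos.
have Hd j : j \in A -> alpha n / Num.sqrt n%:R * (2 / `|bstar j 0|) <= d.
  move: j; near: n; apply: near_A => j jA.
  have bj := bpos j jA.
  have db : 0 < d / (2 / `|bstar j 0|) by rewrite !divr_gt0.
  near=> n; rewrite -ler_pdivlMr ?divr_gt0//.
  by near: n; apply: cvgr_le db; exact: alpha_sqrt.
have Hc : eta n * Num.sqrt n%:R <= c + 1.
  by near: n; apply: cvgr_le c1; exact: eta_sqrt.
have HBig : Big < alpha n.
  by near: n; move/cvgryPgt : alpha_oo; exact.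
have [S1 S2] := @gdp_fixed_n C lam M d K0 K1 beta rho e n (alpha n) (eta n) (c + 1) b0 b1
  n0 (alpha_gt0 n) (eta_gt0 n) l0 M0 (ltW d0) uC Hgram Hbeta Hrho erefl erefl HK0 HK1 Hd Hc HBig Hls Hgdp HM.
split => // i; apply: le_trans (S2 i) _.
rewrite -/KB.
have h1 : d * (2 * (KB + 1)) <= tau by rewrite -ler_pdivlMr// mulr_gt0.
have h2 : rho * (2 * (KB + 1) * (p%:R * K1' + 1)) <= tau.
  by rewrite -ler_pdivlMr ?mulr_gt0// ge_min lexx orbT.
have h3 : p%:R * (rho * K1) <= rho * (p%:R * K1' + 1).
  rewrite mulrCA ler_wpM2l ?(ltW rho0)// (le_trans (ler_wpM2l _ K1K))// lerDl//.
apply: (@le_trans _ _ ((KB + 1) * (d + rho * (p%:R * K1' + 1)))); last by lra.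
apply: ler_pM => //; last by rewrite lerD2l.
- by rewrite addr_ge0 ?(ltW d0)// mulr_ge0// mulr_ge0// ltW.
- by rewrite lerDl.
Unshelve. all: by end_near. Qed.

End Regression.

(** * Weak convergence *)

Lemma E_close d (T : measurableType d) (R : realType) (P : probability T R)
    (f g : T -> R) (D : set T) (M t : R) :
  bounded_measurable f -> bounded_measurable g -> measurable D -> 0 <= t ->
  (forall w, `|f w| <= M) -> (forall w, `|g w| <= M) -> (forall w, D w -> `|f w - g w| <= t) ->
  `|\int[P]_w f w - \int[P]_w g w| <= t + 2 * M * fine (P (~` D)).
Proof.
move=> bf bg mD t0 fM gM fg.
have bI : bounded_measurable (\1_(~` D) : T -> R) by apply: bm_indic; exact: measurableC.
rewrite -EB//; apply: le_trans (le_normr_Rintegral _ _) _ => //.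
  by apply: bm_integrable; apply: bmD => //; exact: bmN.
apply: (@le_trans _ _ (\int[P]_w (t + 2 * M * \1_(~` D) w))).
  apply: le_Rintegral => //.
  - exact: integrable_norm (bm_integrable P (bmD bf (bmN bg))).
  - by apply: bm_integrable; apply: bmD; [exact: bm_cst|exact: bmZ].
  - move=> w _; rewrite indicE; have [Dw|Dw] := pselect (D w).
      by rewrite memNset ?mulr0 ?addr0 ?fg// => /(_ Dw).
    rewrite mem_set// mulr1 ler_wpDl// (le_trans (ler_normB _ _))//.
    by have := fM w; have := gM w; lra.
rewrite ED ?Rintegral_cst1 ?EZ ?E_indic//; [exact: measurableC|exact: bm_cst|exact: bmZ].
Qed.

Section WeakConvergence.
Context d (T : measurableType d) (R : realType) (P : probability T R).
Variable k : nat.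
Local Notation bm := bounded_measurable.

Definition measurable_vec (Y : T -> 'cV[R]_k) := forall j, measurable_fun setT (fun w => Y w j 0).

Lemma measurable_linear_form (th : 'rV[R]_k) Y : measurable_vec Y ->
  measurable_fun setT (fun w => (th *m Y w) 0 0).
Proof.
move=> mY; under eq_fun do rewrite mxE.
by apply: measurable_sum => j; exact: measurable_funM.
Qed.

Lemma bm_cos_form (th : 'rV[R]_k) (u : R) Y : measurable_vec Y ->
  bm (fun w => cos (u + (th *m Y w) 0 0)).
Proof.
by move=> mY; apply: bm_cos; apply: measurable_funD => //; exact: measurable_linear_form.
Qed.

Lemma measurable_trig_poly g Y : trig_poly g -> measurable_vec Y ->
  measurable_fun setT (fun w => g (Y w)).
Proof.
move=> [s gs] mY; under eq_fun do rewrite gs /trig_eval.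
apply: measurable_sum => a; apply: measurable_funM => //.
by case: (bm_cos_form a.2 a.1.2 mY).
Qed.

Lemma continuous_trig_poly (g : 'cV[R]_k -> R) : trig_poly g -> continuous g.
Proof.
move=> [s gs]; have -> : g = trig_eval s by exact/funext.
apply: (@continuous_sumR 'cV[R]_k) => a; apply: (@continuousZR 'cV[R]_k).
apply: (@continuous_compR 'cV[R]_k); first exact: continuous_cos.
apply: (@continuousDR 'cV[R]_k); first exact: (@cst_continuous 'cV[R]_k R).
rewrite (_ : (fun _ => _) = fun x : 'cV[R]_k => \sum_j a.2 0 j * x j 0); last first.
  by apply/funext => x; rewrite mxE.
apply: (@continuous_sumR 'cV[R]_k) => j; apply: (@continuousZR 'cV[R]_k).
exact: (@coord_continuous R k 1 j 0).
Qed.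

Lemma trig_approx_seq (f : 'cV[R]_k -> R) (M : R) : continuous f -> (forall x, `|f x| <= M) ->
  exists g : nat -> 'cV[R]_k -> R, [/\ forall m, trig_poly (g m),
    forall m (x : 'cV[R]_k), `|g m x| <= M &
    forall m (x : 'cV[R]_k), (forall j, `|x j 0| <= m.+1%:R) -> `|g m x - f x| <= m.+1%:R^-1].
Proof.
move=> cf fM.
have H m : exists g : 'cV[R]_k -> R, [/\ trig_poly g, (forall x, `|g x| <= M) &
    forall x : 'cV[R]_k, (forall j, `|x j 0| <= m.+1%:R) -> `|g x - f x| <= m.+1%:R^-1].
  by apply: trig_approx => //; rewrite ?invr_gt0 ltr0n.
have [g Hg] := choice H.
by exists g; split=> m; case: (Hg m).
Qed.

Lemma trig_approx_seq_cvg (f : 'cV[R]_k -> R) (g : nat -> 'cV[R]_k -> R) :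
  (forall m (x : 'cV[R]_k), (forall j, `|x j 0| <= m.+1%:R) -> `|g m x - f x| <= m.+1%:R^-1) ->
  forall x : 'cV[R]_k, g ^~ x @ \oo --> f x.
Proof.
move=> H x; apply/cvgrPdist_le => /= e e0.
pose K := \sum_j `|x j 0|.
near=> m.
rewrite distrC (le_trans (H m x _))//.
  move=> j; apply: (@le_trans _ _ K).
    by rewrite /K (bigD1 j)//= lerDl sumr_ge0.
  apply: (@le_trans _ _ m%:R); last by rewrite ler_nat.
  by near: m; exact: nbhs_infty_ger.
rewrite invf_ple ?posrE ?ltr0n//; apply: (@le_trans _ _ m%:R); last by rewrite ler_nat.
by near: m; exact: nbhs_infty_ger.
Unshelve. all: by end_near. Qed.

(** Measurability is known coordinatewise. It passes to finite sums of cosines of linear forms, and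
    f is a pointwise limit of these. *)
Lemma measurable_continuous_vec (f : 'cV[R]_k -> R) (M : R) Y : continuous f ->
  (forall x, `|f x| <= M) -> measurable_vec Y -> bm (fun w => f (Y w)).
Proof.
move=> cf fM mY; split; last by exists M.
have [g [tg _ Hg]] := trig_approx_seq cf fM.
apply: (measurable_fun_cvg (h := fun m w => g m (Y w))).
  by move=> m; exact: measurable_trig_poly.
by move=> w _; exact: (trig_approx_seq_cvg Hg).
Qed.

Variables (Z : nat -> T -> 'cV[R]_k) (S : 'M[R]_k).
Hypothesis mZ : forall n, measurable_vec (Z n).
Hypothesis pdS : posdef S.
Hypothesis tight : forall e : R, 0 < e -> exists r : R, \forall n \near \oo,
  exists D, [/\ measurable D, fine (P (~` D)) <= e & forall w, D w -> forall j, `|Z n w j 0| <= r].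
Hypothesis cos_cvg : forall (u : R) (th : 'rV[R]_k),
  (fun n => \int[P]_w cos (u + (th *m Z n w) 0 0)) @ \oo -->
  expR (- ((th *m S *m th^T) 0 0 / 2)) * cos u.

Lemma trig_poly_cvg (L : 'M[R]_k) g : S = L *m L^T -> trig_poly g ->
  (fun n => \int[P]_w g (Z n w)) @ \oo --> gauss_iter (fun z => g (L *m z)).
Proof.
move=> SL [s gs]; rewrite (_ : g = trig_eval s); last exact/funext.
have bc (a : R * R * 'rV[R]_k) : bounded_continuous (fun z : 'cV[R]_k => a.1.1 * cos (a.1.2 + (a.2 *m (L *m z)) 0 0)).
  split; last first.
    exists `|a.1.1| => z; rewrite normrM ler_piMr// ler_norml cos_geN1 cos_le1//.
  have tp : trig_poly (fun z : 'cV[R]_k => a.1.1 * cos (a.1.2 + (a.2 *m (L *m z)) 0 0)).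
    by exists [:: (a.1.1, a.1.2, a.2 *m L)] => z; rewrite /trig_eval big_seq1/= mulmxA.
  exact: continuous_trig_poly.
elim: s {gs} => [|a s IH].
  have -> : (fun n => \int[P]_w trig_eval [::] (Z n w)) = (fun=> 0).
    by apply/funext => n; rewrite /trig_eval; under eq_Rintegral do rewrite big_nil; exact: Rintegral_cst1.
  (* Writing zero as [0 * 0] lets [gauss_iterZ] evaluate the integral. *)
  have -> : (fun z : 'cV[R]_k => trig_eval [::] (L *m z)) = (fun z => 0 * 0 : R).
    by apply/funext => z; rewrite /trig_eval big_nil mulr0.
  rewrite (gauss_iterZ (h := fun=> 0)) ?mul0r; first exact: cvg_cst.
  by split; [exact: (@cst_continuous 'cV[R]_k R)|exists 0 => x; rewrite normr0].
have tE x : trig_eval (a :: s) x = a.1.1 * cos (a.1.2 + (a.2 *m x) 0 0) + trig_eval s x.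
  by rewrite /trig_eval big_cons.
have bs n : bm (fun w => trig_eval s (Z n w)).
  apply: bm_sum => b; apply: bmZ; exact: bm_cos_form.
have -> : (fun n => \int[P]_w trig_eval (a :: s) (Z n w)) =
    (fun n => a.1.1 * \int[P]_w cos (a.1.2 + (a.2 *m Z n w) 0 0) + \int[P]_w trig_eval s (Z n w)).
  apply/funext => n; under eq_Rintegral do rewrite tE.
  rewrite ED//; last by apply: bmZ; exact: bm_cos_form.
  by rewrite EZ//; exact: bm_cos_form.
have -> : gauss_iter (fun z => trig_eval (a :: s) (L *m z)) =
    a.1.1 * (expR (- ((a.2 *m S *m a.2^T) 0 0 / 2)) * cos a.1.2) + gauss_iter (fun z => trig_eval s (L *m z)).
  have -> : (fun z : 'cV[R]_k => trig_eval (a :: s) (L *m z)) =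
     (fun z => a.1.1 * cos (a.1.2 + (a.2 *m (L *m z)) 0 0) + trig_eval s (L *m z)).
    by apply/funext => z; rewrite tE.
  rewrite gauss_iterD//; last first.
    split; last first.
      exists (\sum_(b <- s) `|b.1.1|) => z; rewrite (le_trans (ler_norm_sum _ _ _))//.
      apply: ler_sum => b _; rewrite normrM ler_piMr// ler_norml cos_geN1 cos_le1//.
    by apply: (@continuous_sumR 'cV[R]_k) => b; case: (bc b).
  congr (_ + _); rewrite gauss_iterZ; last first.
    by have := bc (1, a.1.2, a.2); rewrite /=; under eq_fun do rewrite mul1r.
  congr (_ * _); under eq_fun do rewrite mulmxA.
  rewrite gauss_iter_cos SL trmx_mul.
  by rewrite !mulmxA.
by apply: cvgD IH; apply: cvgMr; exact: cos_cvg.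
Qed.

(** The function f is exchanged for a trigonometric polynomial g under the law of Z_n and under the
    limit. Under Z_n, tightness makes the exterior of the box improbable, and the common bound M
    controls f - g there. *)
Lemma cvg_in_dist_normal_of_cos : cvg_in_dist_normal P Z S.
Proof.
move=> f cf [M fM].
have [L [uL SL HL]] := gaussian_cholesky pdS.
have M0 : 0 <= M by rewrite (le_trans _ (fM 0)).
rewrite (_ : iter_lebesgue_int _ = gauss_iter (fun z => f (L *m z))); last first.
  transitivity (iter_lebesgue_int (fun x => f x * normal_density S (x - 0))).
    by congr iter_lebesgue_int; apply/funext => x; rewrite subr0.
  rewrite HL; last by split => //; exists M.
  by congr gauss_iter; apply/funext => z; rewrite add0r.
have -> : (fun n => fine 'E_P[fun w => f (Z n w)]%E) = (fun n => \int[P]_w f (Z n w)).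
  by apply/funext => n; rewrite unlock.
have [g [tg gM gf]] := trig_approx_seq cf fM.
have cLf (h : 'cV[R]_k -> R) : continuous h -> continuous (fun z : 'cV[R]_k => h (L *m z)).
  move=> ch z; apply: (@continuous_comp _ _ _ (fun z : 'cV[R]_k => L *m z) h); last exact: ch.
  have -> : (fun z : 'cV[R]_k => L *m z) = (fun z => 0 + L *m z) by apply/funext => y; rewrite add0r.
  exact: continuous_mx_affine.
have gauss_cvg : (fun m => gauss_iter (fun z => g m (L *m z))) @ \oo --> gauss_iter (fun z => f (L *m z)).
  apply: (gauss_iter_cvg (M := M)) => [m|m z|z].
  - by apply: cLf; exact: continuous_trig_poly.
  - exact: gM.
  - exact: (trig_approx_seq_cvg gf).
apply/cvgrPdist_le => /= e e0.
(* The errors below add up to at most 3 e1 + 2 M e1. *)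
pose e1 : R := e / (4 + 4 * M).
have M4 : 0 < 4 + 4 * M by lra.
have e10 : 0 < e1 by rewrite divr_gt0.
have [r Hr] := tight e10.
have [m Hm] : exists m, [/\ r <= m.+1%:R, m.+1%:R^-1 <= e1 &
    `|gauss_iter (fun z => f (L *m z)) - gauss_iter (fun z => g m (L *m z))| <= e1].
  suff : \forall m \near \oo, [/\ r <= m.+1%:R, m.+1%:R^-1 <= e1 &
      `|gauss_iter (fun z => f (L *m z)) - gauss_iter (fun z => g m (L *m z))| <= e1].
    by move=> [N _ HN]; exists N; apply: HN => /=.
  near=> m; split.
  - apply: (@le_trans _ _ m%:R); last by rewrite ler_nat.
    by near: m; exact: nbhs_infty_ger.
  - rewrite invf_ple ?posrE ?ltr0n//; apply: (@le_trans _ _ m%:R); last by rewrite ler_nat.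
    by near: m; exact: nbhs_infty_ger.
  - by near: m; move/cvgrPdist_le : gauss_cvg; exact.
have [rm me1 gm] := Hm.
have /cvgrPdist_le /(_ _ e10) cg := trig_poly_cvg SL (tg m).
apply: filterS2 Hr cg => n [D [mD PD HD]] cg.
have bf := measurable_continuous_vec cf fM (mZ n).
have bg : bm (fun w => g m (Z n w)).
  by split; [exact: measurable_trig_poly|exists M].
have fg : `|\int[P]_w f (Z n w) - \int[P]_w g m (Z n w)| <= e1 + 2 * M * e1.
  apply: (@le_trans _ _ (e1 + 2 * M * fine (P (~` D)))); last first.
    by rewrite lerD2l ler_wpM2l// mulr_ge0.
  apply: E_close => //; first exact: ltW.
  move=> w Dw; rewrite distrC (le_trans (gf m _ _))// => j.
  by rewrite (le_trans (HD w Dw j)).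
have eE : e = (4 + 4 * M) * e1 by rewrite /e1 mulrCA divff ?mulr1// gt_eqF.
move: gm cg fg; set a := gauss_iter _; set b := gauss_iter _; set a' := \int[P]_w _; set b' := \int[P]_w _.
move=> gm cg fg.
rewrite (_ : a - b' = (a - b) + (b - a') - (b' - a')); last by ring.
rewrite (le_trans (ler_normB _ _))//.
have := ler_normD (a - b) (b - a').
have : 0 <= M * e1 by rewrite mulr_ge0// ltW.
lra.
Unshelve. all: by end_near. Qed.

End WeakConvergence.

(** * Asymptotics of the score *)

Section Moments.
Context d (T : measurableType d) (R : realType) (P : probability T R).
Variables (X : T -> R) (s : R).
Hypothesis X2 : X \in Lfun P 2.

Lemma Rintegral_expectation : ('E_P[X] = 0)%E -> \int[P]_w X w = 0.
Proof. by rewrite unlock /Rintegral => ->. Qed.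

Lemma Rintegral_variance : ('E_P[X] = 0)%E -> ('V_P[X] = s%:E)%E -> \int[P]_w (X w ^+ 2) = s.
Proof.
move=> m0; rewrite varianceE// m0 expe2 mul0e sube0 unlock /Rintegral => h.
by rewrite -[RHS]/(fine s%:E) -h; congr (fine (integral _ _ _)).
Qed.
End Moments.

(** For fixed b the difference is a function of t = a - b that vanishes at 0, with derivative -
    sin(t + b). *)
Lemma cos_lipschitz (R : realType) (a b : R) : `|cos a - cos b| <= `|a - b|.
Proof.
have -> : cos a - cos b = cos (a - b) * cos b - sin (a - b) * sin b - cos b.
  by rewrite -cosD subrK.
rewrite -[leRHS]mul1r.
apply: (@mvt_bound _ (fun t => cos t * cos b - sin t * sin b - cos b)
  (fun t => - (sin t * cos b + cos t * sin b))).
- by move=> t; apply: is_derive_eq; rewrite /GRing.scale/=; ring.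
- by rewrite cos0 sin0 mul0r mul1r subr0 subrr.
- by move=> t _; rewrite normrN -sinD ler_norml sin_geN1 sin_le1.
Qed.

Lemma cvg_sumR (R : realType) (I : Type) (r : seq I) (u : I -> nat -> R) (l : I -> R) :
  (forall i, u i @ \oo --> l i) ->
  (fun n => \sum_(i <- r) u i n) @ \oo --> \sum_(i <- r) l i.
Proof.
move=> ul; elim: r => [|i r IH].
  by rewrite big_nil; under eq_fun do rewrite big_nil; exact: cvg_cst.
by rewrite big_cons; under eq_fun do rewrite big_cons; exact: cvgD.
Qed.

Section Score.
Context d (T : measurableType d) (R : realType) (P : probability T R).
Variables (p : nat) (x : nat -> 'rV[R]_p) (C : 'M[R]_p).
Variable e : nat -> T -> R.
Hypothesis me : forall i, measurable_fun setT (e i).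
Hypothesis indep : mutually_independent P e.
Hypothesis same : identically_distributed P e.
Variable sigma : R.
Hypothesis integrable_sqr : P.-integrable setT (EFin \o (fun w => e 0%N w ^+ 2)).
Hypothesis mean0 : \int[P]_w e 0%N w = 0.
Hypothesis var0 : \int[P]_w (e 0%N w ^+ 2) = sigma ^+ 2.
Hypothesis gram_cvg : forall i j, (fun n => gram x n i j) @ \oo --> C i j.

Local Notation score n w := (noise x (fun i => e i w) n).
Local Notation bm := bounded_measurable.

Lemma design_form (th : 'rV[R]_p) n (i : 'I_n) :
  (th *m (design x n)^T) 0 i = (th *m (x i)^T) 0 0.
Proof. by rewrite [LHS]mxE [RHS]mxE; apply: eq_bigr => j _; rewrite !mxE. Qed.

Lemma score_linsum (th : 'rV[R]_p) n w : (th *m score n w) 0 0 =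
  linsum e (fun i => (th *m (x i)^T) 0 0 / Num.sqrt n%:R) n w.
Proof.
rewrite /noise -scalemxAr mulmxA mxE [X in _ * X]mxE mulr_sumr /linsum.
by apply: eq_bigr => i _; rewrite [X in _ * (_ * X)]mxE design_form mulrA [_^-1 * _]mulrC.
Qed.

Lemma sum_sqr_score (th : 'rV[R]_p) n :
  (\sum_(i < n) (th *m (x i)^T) 0 0 ^+ 2) / n%:R = (th *m gram x n *m th^T) 0 0.
Proof.
rewrite /gram -scalemxAr -scalemxAl mulmxA -[_ *m _ *m th^T]mulmxA mxE mulrC; congr (_ * _).
rewrite mxE; apply: eq_bigr => i _.
by rewrite -{2}[design x n]trmxK -trmx_mul [X in _ = _ * X]mxE design_form expr2.
Qed.

Lemma quad_gram_cvg (th : 'rV[R]_p) :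
  (fun n => (th *m gram x n *m th^T) 0 0) @ \oo --> (th *m C *m th^T) 0 0.
Proof.
have E (B : 'M[R]_p) : (th *m B *m th^T) 0 0 = \sum_j (\sum_i th 0 i * B i j) * th 0 j.
  by rewrite mxE; apply: eq_bigr => j _; rewrite [X in X * _]mxE [X in _ * X]mxE.
rewrite E; under eq_fun do rewrite E.
apply: cvg_sumR => j; apply: cvgMl; apply: cvg_sumR => i; apply: cvgMr.
exact: gram_cvg.
Qed.

Lemma score_cos_cvg (u : R) (th : 'rV[R]_p) :
  (fun n => \int[P]_w cos (u + (th *m score n w) 0 0)) @ \oo -->
  expR (- (sigma ^+ 2 * (th *m C *m th^T) 0 0 / 2)) * cos u.
Proof.
under eq_fun do (under eq_Rintegral do rewrite score_linsum).
apply: (clt_cos me indep same integrable_sqr mean0 var0 (s := fun i => (th *m (x i)^T) 0 0)).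
by under eq_fun do rewrite sum_sqr_score; exact: quad_gram_cvg.
Qed.

Lemma score_coord n w (j : 'I_p) :
  score n w j 0 = ((delta_mx 0 j : 'rV[R]_p) *m score n w) 0 0.
Proof. by rewrite -rowE [RHS]mxE. Qed.

Lemma measurable_score n (j : 'I_p) : measurable_fun setT (fun w => score n w j 0).
Proof.
under eq_fun do rewrite score_coord score_linsum.
exact: measurable_linsum.
Qed.

Definition score_bounded (M : R) n := [set w | forall j, `|score n w j 0| <= M].

Lemma measurable_score_bounded M n : measurable (score_bounded M n).
Proof.
rewrite (_ : score_bounded M n = \bigcap_(j in [set: 'I_p]) [set w | `|score n w j 0| <= M]); last first.
  by apply/seteqP; split=> w /= H j; [move=> _; exact: H|exact: (H j I)].
apply: fin_bigcap_measurable => // j _.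
rewrite -[X in measurable X]setTI; apply: measurable_fun_ler => //.
by apply: measurableT_comp => //; exact: measurable_score.
Qed.

(** A union bound over the coordinates; the Chebyshev bounds add up to the trace of [gram]. *)
Lemma score_tail (M : R) n : 0 < M ->
  fine (P (~` score_bounded M n)) <= sigma ^+ 2 * (\sum_j gram x n j j) / M ^+ 2.
Proof.
move=> M0.
pose B (j : 'I_p) := [set w | M < `|score n w j 0|].
have mB j : measurable (B j).
  rewrite -[B j]setTI; apply: measurable_fun_ltr => //.
  by apply: measurableT_comp => //; exact: measurable_score.
have mS := measurable_score_bounded M n.
rewrite -(E_indic P (measurableC mS)).
apply: (@le_trans _ _ (\int[P]_w (\sum_j \1_(B j) w : R))).
  apply: le_E; [exact/bm_indic/measurableC|by apply: bm_sum => j; exact: bm_indic|].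
  move=> w; rewrite indicE; case: (boolP (w \in _)) => [|_]; last first.
    by rewrite sumr_ge0.
  rewrite inE/= => /existsNP[j /negP]; rewrite -ltNge => wj.
  rewrite (bigD1 j)//= indicE mem_set// lerDl sumr_ge0//.
rewrite Rintegral_sum; last by move=> j; apply: bm_integrable; exact: bm_indic.
rewrite mulr_sumr mulr_suml; apply: ler_sum => j _.
rewrite E_indic//.
have -> : B j = [set w | M < `|linsum e (fun i => ((delta_mx 0 j : 'rV[R]_p) *m (x i)^T) 0 0 / Num.sqrt n%:R) n w|].
  by apply/funext => w; rewrite /B/= score_coord score_linsum.
apply: le_trans (linsum_chebyshev me indep same integrable_sqr mean0 var0 _ _ M0) _.
rewrite ler_wpM2r ?invr_ge0 ?sqr_ge0// ler_wpM2l ?sqr_ge0//.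
have -> : gram x n j j = ((delta_mx 0 j : 'rV[R]_p) *m gram x n *m (delta_mx 0 j : 'rV[R]_p)^T) 0 0.
  by rewrite -rowE trmx_delta -colE [RHS]mxE [RHS]mxE.
rewrite -sum_sqr_score mulr_suml; apply: ler_sum => i _.
by rewrite expr_div_n sqr_sqrtr.
Qed.

Lemma score_tight (r : R) : 0 < r -> exists M : R, 0 <= M /\
  \forall n \near \oo, fine (P (~` score_bounded M n)) <= r.
Proof.
move=> r0.
pose t : R := `|\sum_j C j j| + 1.
have t0 : 0 < t by rewrite ltr_wpDl.
(* Then sigma^2 t = r (M - 1) <= r M^2, with t an eventual bound on the trace. *)
pose M : R := 1 + sigma ^+ 2 * t / r.
have K0 : 0 <= sigma ^+ 2 * t / r by apply: divr_ge0; [apply: mulr_ge0; [exact: sqr_ge0|exact: ltW]|exact: ltW].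
have M1 : 1 <= M by rewrite lerDl.
have M0 : 0 < M by exact: lt_le_trans M1.
exists M; split; first exact: ltW.
have tr_cvg : (fun n => \sum_j gram x n j j) @ \oo --> \sum_j C j j.
  by apply: cvg_sumR => j; exact: gram_cvg.
have Ct : \sum_j C j j < t by rewrite (le_lt_trans (ler_norm _))// ltrDl.
near=> n.
have gt : \sum_j gram x n j j <= t by near: n; apply: cvgr_le Ct; exact: tr_cvg.
apply: le_trans (score_tail n M0) _.
rewrite ler_pdivrMr ?exprn_gt0//.
apply: (@le_trans _ _ (sigma ^+ 2 * t)); first by rewrite ler_wpM2l// sqr_ge0.
have -> : sigma ^+ 2 * t = r * (M - 1).
  by rewrite /M addrAC subrr add0r mulrCA divff ?mulr1// gt_eqF.
rewrite ler_pM2l//; nra.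
Unshelve. all: by end_near. Qed.

End Score.

Lemma posdef_invmx (R : realType) k (Q : 'M[R]_k) : posdef Q -> posdef (invmx Q).
Proof.
move=> pdQ; have uQ := posdef_unitmx pdQ; have [sQ pQ] := pdQ.
split=> [|u u0]; first by rewrite trmx_inv sQ.
have u'0 : u *m invmx Q != 0.
  by apply: contra_neq u0 => h; rewrite -(mulmxKV uQ u) h mul0mx.
have := pQ _ u'0.
by rewrite mulmxKV// trmx_mul trmx_inv sQ mulmxA.
Qed.

Lemma posdefZ (R : realType) k (Q : 'M[R]_k) (a : R) : 0 < a -> posdef Q -> posdef (a *: Q).
Proof.
move=> a0 [sQ pQ]; split=> [|u u0]; first by rewrite linearZ/= sQ.
by rewrite -scalemxAr -scalemxAl mxE mulr_gt0// pQ.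
Qed.

Lemma measurable_support d (T : measurableType d) (R : realType) (p : nat) (A : {set 'I_p})
    (b : T -> 'cV[R]_p) : (forall j, measurable_fun setT (fun w => b w j 0)) ->
  measurable [set w | finset (fun j : 'I_p => b w j 0 != 0) = A].
Proof.
move=> mb.
rewrite (_ : [set w | _] = \bigcap_(j in [set: 'I_p]) [set w | (b w j 0 != 0) = (j \in A)]); last first.
  apply/seteqP; split=> w /= H.
    by move=> j _; rewrite /= -H inE.
  by apply/setP => j; rewrite inE; exact: (H j I).
apply: fin_bigcap_measurable => // j _.
have m0 : measurable [set w | b w j 0 = 0].
  by rewrite -[X in measurable X]setTI; exact: (mb j measurableT [set 0]).
case: (j \in A).
  rewrite (_ : [set w | _] = ~` [set w | b w j 0 = 0]); first exact: measurableC.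
  by apply/seteqP; split=> w /= /eqP.
rewrite (_ : [set w | _] = [set w | b w j 0 = 0]) //.
by apply/seteqP; split=> w /=; [move/negbFE/eqP|move->; rewrite eqxx].
Qed.

(** * Transfer from a likely event to probabilities and cosine means *)

Section Probability.
Context d (T : measurableType d) (R : realType) (P : probability T R).

Lemma cvg_probability1 (S : nat -> set T) : (forall n, measurable (S n)) ->
  (forall r : R, 0 < r -> \forall n \near \oo, exists D,
    [/\ measurable D, fine (P (~` D)) <= r & D `<=` S n]) ->
  (fun n => P (S n)) @ \oo --> 1%E.
Proof.
move=> mS H.
have fS n : P (S n) \is a fin_num by exact: fin_num_measure.
apply/fine_cvgP; split; first exact: nearW.
apply/cvgrPdist_le => /= r r0.
apply: filterS (H r r0) => n [D [mD PD DS]].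
have -> : 1 - fine (P (S n)) = fine (P (~` S n)) by rewrite probability_setC// fineB.
rewrite ger0_norm ?fine_ge0//; apply: le_trans PD; apply: fine_le.
- by apply: fin_num_measure; exact: measurableC.
- by apply: fin_num_measure; exact: measurableC.
- apply: le_measure; rewrite ?inE; [exact: measurableC|exact: measurableC|].
  by move=> w nS /DS.
Qed.

Lemma E_cos_form_close k (th : 'rV[R]_k) (u t : R) (Y Z : T -> 'cV[R]_k) (D : set T) :
  measurable_vec Y -> measurable_vec Z -> measurable D -> 0 <= t ->
  (forall w, D w -> forall i, `|(Z w - Y w) i 0| <= t) ->
  `|\int[P]_w cos (u + (th *m Z w) 0 0) - \int[P]_w cos (u + (th *m Y w) 0 0)| <=
    (\sum_i \sum_j `|th i j|) * t + 2 * fine (P (~` D)).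
Proof.
move=> mY mZ mD t0 ZY.
have cos1 (a : R) : `|cos a| <= 1 by rewrite ler_norml cos_geN1 cos_le1.
rewrite -[2]mulr1; apply: E_close => //; try exact: bm_cos_form.
  by rewrite mulr_ge0// sumr_ge0// => i _; rewrite sumr_ge0.
move=> w Dw; apply: le_trans (cos_lipschitz _ _) _.
have -> : u + (th *m Z w) 0 0 - (u + (th *m Y w) 0 0) = (th *m (Z w - Y w)) 0 0.
  by rewrite mulmxBr [RHS]mxE [X in _ = _ + X]mxE; ring.
by apply: mulmx_norm_le => // i; exact: ZY.
Qed.

End Probability.

Theorem theorem2 (R : realType) (d : measure_display) (T : measurableType d)
  (P : probability T R) (p : nat)
  (bstar : 'cV[R]_p) (x : nat -> 'rV[R]_p) (eps : nat -> T -> R) (sigma : R)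
  (C : 'M[R]_p) (alpha eta : nat -> R) (c : R)
  (b0 b1 : nat -> T -> 'cV[R]_p) :
  (* (A1) errors i.i.d., mean 0, variance sigma^2 > 0 *)
  (forall i, measurable_fun setT (eps i)) ->
  mutually_independent P eps ->
  identically_distributed P eps ->
  eps 0%N \in Lfun P 2 ->
  ('E_P[eps 0%N] = 0)%E ->
  ('V_P[eps 0%N] = (sigma ^+ 2)%:E)%E ->
  0 < sigma ->
  (* (A2) (1/n) X'X -> C, C positive definite *)
  (forall i j : 'I_p,
     (fun n : nat => (((design x n)^T *m design x n) i j) / n%:R) @ \oo --> C i j) ->
  posdef C ->
  (* b0 n is a least squares estimator *)
  (forall n w (b : 'cV[R]_p),
     rss (design x n) (response x bstar (fun i => eps i w) n) (b0 n w)
     <= rss (design x n) (response x bstar (fun i => eps i w) n) b) ->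
  (* tuning parameters *)
  (forall n, 0 < alpha n) -> (forall n, 0 < eta n) ->
  (* b1 n is the GDP(OS) estimator (a minimizer of the objective) *)
  (forall n w (b : 'cV[R]_p),
     gdp_os_obj (design x n) (response x bstar (fun i => eps i w) n) (b0 n w)
       (alpha n) (eta n) (b1 n w)
     <= gdp_os_obj (design x n) (response x bstar (fun i => eps i w) n) (b0 n w)
       (alpha n) (eta n) b) ->
  (* the estimators are random vectors (measurable coordinates) *)
  (forall n (j : 'I_p), measurable_fun setT (fun w => b0 n w j 0)) ->
  (forall n (j : 'I_p), measurable_fun setT (fun w => b1 n w j 0)) ->
  (* rates *)
  alpha @ \oo --> +oo ->
  (fun n => alpha n / Num.sqrt n%:R) @ \oo --> 0 ->
  (fun n => eta n * Num.sqrt n%:R) @ \oo --> c ->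
  let A := finset (fun j : 'I_p => bstar j 0 != 0) in
  (* (1) selection consistency *)
  ((fun n => P [set w | finset (fun j : 'I_p => b1 n w j 0 != 0) = A]) @ \oo --> 1%E)
  /\
  (* (2) asymptotic normality on A *)
  cvg_in_dist_normal P
    (fun n w => Num.sqrt n%:R *: (subcol A (b1 n w) - subcol A bstar))
    (sigma ^+ 2 *: invmx (principal_submx A C)).
Proof.
move=> meps indep same L2 m0 v0 s0 gramC pdC ls a0 e0 gdp _ mb1 aoo asq esq A.
have isq := Lfun2_integrable_sqr L2.
have mean0 := Rintegral_expectation m0.
have var0 := Rintegral_variance L2 m0 v0.
have gram_cvg (i j : 'I_p) : (fun n => gram x n i j) @ \oo --> C i j.
  by under eq_fun do rewrite /gram mxE mulrC; exact: gramC.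
pose Omega (M : R) n := score_bounded x eps M n.
have mOmega M n : measurable (Omega M n) by exact: measurable_score_bounded.
have Omega_tight := score_tight meps indep same isq mean0 var0 gram_cvg.
pose Z n w := Num.sqrt n%:R *: (subcol A (b1 n w) - subcol A bstar).
pose B := invmx (principal_submx A C).
pose Y n w := B *m subcol A (noise x (fun i => eps i w) n).
have close (M t : R) : 0 <= M -> 0 < t -> \forall n \near \oo, forall w, Omega M n w ->
    finset (fun j : 'I_p => b1 n w j 0 != 0) = A /\ forall i, `|(Z n w - Y n w) i 0| <= t.
  move=> M0 t0.
  have ev := gdp_eventually bstar gram_cvg pdC a0 e0 aoo asq esq M0 t0.
  apply: filterS ev => n H w Ow.
  exact: H (ls n w) (gdp n w) Ow.
split.
  pose Sel n := [set w | finset (fun j : 'I_p => b1 n w j 0 != 0) = A].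
  have mSel n : measurable (Sel n) by apply: measurable_support => j; exact: mb1.
  apply: (cvg_probability1 mSel) => r r0.
  have [M [M0 HM]] := Omega_tight r r0.
  (* The tolerance 1 is arbitrary: here the support statement of [close] is what counts. *)
  apply: filterS2 HM (close M 1 M0 ltr01) => n PO HO.
  by exists (Omega M n); split => // w Ow; case: (HO w Ow).
rewrite -/Z.
have pdQ := posdef_principal_submx A pdC.
have uQ := posdef_unitmx pdQ.
have mZ n : measurable_vec (Z n).
  move=> j; rewrite /Z; under eq_fun do rewrite !mxE.
  by apply: measurable_funM => //; apply: measurable_funB.
apply: cvg_in_dist_normal_of_cos => //.
- by apply: posdefZ; [exact: exprn_gt0|exact: posdef_invmx].
- move=> r r0; have [M [M0 HM]] := Omega_tight r r0.
  exists ((\sum_i \sum_j `|B i j|) * M + 1).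
  apply: filterS2 HM (close M 1 M0 ltr01) => n PO HO.
  exists (Omega M n); split => // w Ow j.
  have [_ /(_ j) h] := HO w Ow.
  have Yb : `|Y n w j 0| <= (\sum_i \sum_j `|B i j|) * M.
    by apply: mulmx_norm_le => // i; rewrite mxE; exact: Ow.
  rewrite -(subrK (Y n w) (Z n w)) mxE (le_trans (ler_normD _ _))// addrC.
  by rewrite lerD.
- move=> u th.
  (* The linear form th of Y is the linear form th' of the score, to which the cosine limit
     applies. *)
  pose th' := th *m B *m sel_mx R A.
  have YE n w : (th *m Y n w) 0 0 = (th' *m noise x (fun i => eps i w) n) 0 0.
    by rewrite /th' /Y subcolE !mulmxA.
  (* The sandwich of C_A between two copies of its inverse B collapses to B, the asserted covariance
     up to sigma^2. *)
  have qE : (th *m (sigma ^+ 2 *: B) *m th^T) 0 0 = sigma ^+ 2 * (th' *m C *m th'^T) 0 0.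
    rewrite -scalemxAr -scalemxAl mxE; congr (_ * _).
    have -> : th' *m C *m th'^T = th *m B *m principal_submx A C *m (th *m B)^T.
      by rewrite principal_submxE /th' [(_ *m sel_mx R A)^T]trmx_mul !mulmxA.
    by rewrite mulmxKV// trmx_mul trmx_inv pdQ.1 mulmxA.
  rewrite qE.
  have cY := score_cos_cvg (u := u) (th := th') meps indep same isq mean0 var0 gram_cvg.
  apply/cvgrPdist_le => /= r r0.
  have K0 : 0 <= \sum_i \sum_j `|th i j| by rewrite sumr_ge0// => i _; rewrite sumr_ge0.
  set K := \sum_i _ in K0.
  (* Exchanging Z for Y costs K t <= r / 4 on the event and twice r / 8 off it; the limit for Y
     costs another r / 4. *)
  pose t : R := r / (4 * (K + 1)).
  have t0 : 0 < t by rewrite divr_gt0// mulr_gt0// ltr_wpDl.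
  have Kt : K * t <= r / 4.
    by rewrite /t mulrCA ler_wpM2l ?(ltW r0)// invfM mulrCA ler_piMr// ler_pdivrMr ?mul1r ?lerDl// ltr_wpDl.
  have r8 : 0 < r / 8 by rewrite divr_gt0.
  have r4 : 0 < r / 4 by rewrite divr_gt0.
  have [M [M0 HM]] := Omega_tight _ r8.
  move/cvgrPdist_le : cY => /(_ _ r4) cY.
  apply: filterS3 HM (close M t M0 t0) cY => n PO HO cY.
  have mY : measurable_vec (Y n).
    move=> j; rewrite (_ : (fun w => Y n w j 0) =
        (fun w => (row j (B *m sel_mx R A) *m noise x (fun i => eps i w) n) 0 0)); last first.
      by apply/funext => w; rewrite /Y subcolE mulmxA -row_mul [RHS]mxE.
    by apply: measurable_linear_form => i; exact: measurable_score.
  have := E_cos_form_close P th u mY (mZ n) (mOmega M n) (ltW t0) (fun w Ow => (HO w Ow).2).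
  under [X in `|_ - X|]eq_Rintegral do rewrite YE.
  rewrite -/K => ZY; apply: le_trans (ler_distD (\int[P]_w cos (u + (th' *m noise x (fun i => eps i w) n) 0 0)) _ _) _.
  rewrite [X in _ + X]distrC; move: r0 cY ZY PO Kt; rewrite /Omega; clear; lra.
Qed.
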